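(* Let $K$ be a classical knot or link diagram formed by one isolated classical crossing $v$ and a classical tangle $T$, with associated coefficients $\alpha,\beta \in \mathbb{Z}[A,A^{-1}]$ of the bracket expansion of $T$, and let $K_v$ be the virtual diagram obtained from $K$ by virtualizing the crossing $v$. If $\alpha$ and $\beta$ are both non-zero, then $K_v$ is a non-classical and non-trivial virtual link.
   Context: A virtual knot or link is an equivalence class of planar diagrams with classical and virtual crossings, under the classical Reidemeister moves together with the move replacing an arc containing only virtual crossings by any other arc with the same endpoints (all of whose new crossings are virtual). It is non-classical if it is not equivalent to any diagram without virtual crossings, and non-trivial if it is not equivalent to a crossingless diagram. The crossing $v$ lies in a disk meeting $K$ only in $v$ and four ends; the complementary part of the diagram is a classical tangle $T$ with four ends. $K_v$ is obtained by virtualizing $v$: the tangle consisting of the single crossing $v$ is replaced by the tangle consisting of the opposite (switched) crossing flanked by two virtual crossings. (Equivalently, the Gauss diagram of $K_v$ is that of $K$ with the sign of $v$ reversed and the over/under information at $v$ unchanged.) The Kauffman bracket $\langle\cdot\rangle$ is given by $\langle \text{crossing}\rangle = A\langle A\text{-smoothing}\rangle + A^{-1}\langle B\text{-smoothing}\rangle$, with a disjoint trivial loop contributing the factor $d=-A^2-A^{-2}$ and $\langle \text{crossingless unknot}\rangle = 1$. Expanding the tangle $T$ with these relations gives $\langle T\rangle = \alpha \langle E_\alpha\rangle + \beta\langle E_\beta\rangle$, where $E_\alpha, E_\beta$ are the two crossingless tangles with the same four ends and $\alpha,\beta\in\mathbb{Z}[A,A^{-1}]$. The labels are chosen so that replacing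 $T$ in $K$ by $E_\alpha$ (respectively $E_\beta$) gives a one-crossing diagram with bracket $-A^{-3}$ (respectively $-A^{3}$). *)

(* Defs.v *)
(* Mathematical Components *)
From HB Require Import structures.
From mathcomp Require Import all_boot all_order all_algebra.
From Stdlib Require Import Relation_Operators.

Set Implicit Arguments.
Unset Strict Implicit.
Unset Printing Implicit Defensive.

Import GRing.Theory.
Local Open Scope ring_scope.

(** * Codes of planar diagrams *)

(* A diagram is drawn as a 4-valent graph whose edges carry distinct labels
   and recorded, like a PD code, by the list of its vertices.  The arguments
   of a vertex are the labels of the edges met when turning counterclockwise
   around it.
   - [Pt a b]: a marked point on an arc.  Thus [Pt a a] is a crossingless
     circle.  Marks carry no information (see [same_mark] below).
   - [Vi a b c d]: a virtual crossing of the strands a-c and b-d.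
   - [Cl o a b c d]: a classical crossing of the strands a-c and b-d; the
     strand a-c passes over if [o], and the strand b-d passes over otherwise.
   The tangles occurring as parts of a diagram are sublists of its code: the
   labels occurring only once in the sublist are the ends of the tangle. *)
Definition label := nat.

Inductive node :=
| Pt of label & label
| Vi of label & label & label & label
| Cl of bool & label & label & label & label.

Lemma node_comparable : comparable node.
Proof. by move=> u v; rewrite /decidable; do !decide equality. Defined.

HB.instance Definition _ := hasDecEq.Build node (compareP node_comparable).

Definition code := seq node.

Definition ends (v : node) : seq label :=
  match v with
  | Pt a b => [:: a; b]
  | Vi a b c d | Cl _ a b c d => [:: a; b; c; d]
  end.

Definition labels (C : code) : seq label := flatten (map ends C).

Definition is_virtual (v : node) := if v is Vi _ _ _ _ then true else false.
Definition is_mark (v : node) := if v is Pt _ _ then true else false.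

Definition closed_code (C : code) : bool :=
  all (fun l => count_mem l (labels C) == 2) (labels C).

(** * Planarity *)

Definition adjacent (C : code) : rel 'I_(size C) :=
  fun i j => has (mem (ends (tnth (in_tuple C) j)))
                 (ends (tnth (in_tuple C) i)).

Definition components (C : code) : nat := n_comp (@adjacent C) predT.

(* The half-edges: a vertex together with a position around it. *)
Definition slot (C : code) : finType :=
  {i : 'I_(size C) & 'I_(size (ends (tnth (in_tuple C) i)))}.

Definition slot_label (C : code) (s : slot C) : label :=
  nth 0%N (ends (tnth (in_tuple C) (tag s))) (tagged s).

Definition slot_next (C : code) (s : slot C) : slot C :=
  @Tagged _ (tag s) (fun i => 'I_(size (ends (tnth (in_tuple C) i))))
    (ordS (tagged s)).

Definition slot_opp (C : code) (s : slot C) : slot C :=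
  odflt s [pick t : slot C | (t != s) && (slot_label t == slot_label s)].

Definition faces (C : code) : nat :=
  fcard (fun s : slot C => slot_next (slot_opp s)) predT.

(* Euler's formula V - E + F = 2 c: each of the c components is drawn on a
   sphere. *)
Definition planar (C : code) : bool :=
  (size C + faces C == #|slot C|./2 + 2 * components C)%N.

Definition is_diagram (C : code) : bool := closed_code C && planar C.

(** * Equivalence of virtual link diagrams *)

Definition relabel (f : label -> label) (v : node) : node :=
  match v with
  | Pt a b => Pt (f a) (f b)
  | Vi a b c d => Vi (f a) (f b) (f c) (f d)
  | Cl o a b c d => Cl o (f a) (f b) (f c) (f d)
  end.

(* Two codes of one and the same planar diagram. *)
Inductive same_diagram : code -> code -> Prop :=
| same_perm C D of perm_eq C D : same_diagram C D
| same_relabel f C of injective f : same_diagram C (map (relabel f) C)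
| same_turn_Pt a b C : same_diagram (Pt a b :: C) (Pt b a :: C)
| same_turn_Vi a b c d C : same_diagram (Vi a b c d :: C) (Vi b c d a :: C)
| same_turn_Cl o a b c d C :
    same_diagram (Cl o a b c d :: C) (Cl (~~ o) b c d a :: C)
| same_mark a b C of a != b :
    same_diagram (Pt a b :: C)
      (map (relabel (fun l => if l == b then a else l)) C).

(* In the third move the strands a1-b3, a2-b2, a3-b1 cross pairwise; the side
   condition excludes the cyclic choices of over/under information, for which
   no strand is on top. *)
Inductive reidemeister : code -> code -> Prop :=
| reidemeister1 o a b x C :
    reidemeister (Cl o a x x b :: C) (Pt a b :: C)
| reidemeister2 o a b c d x y C :
    reidemeister [:: Cl o a b x y, Cl (~~ o) y x c d & C]
                 [:: Pt a d, Pt b c & C]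
| reidemeister3 (o12 o13 o23 : bool) a1 a2 a3 b1 b2 b3 x y z C
    of (o12 == o23) ==> (o13 == o12) :
    reidemeister
      [:: Cl o12 a1 a2 x y, Cl o13 x a3 b3 z, Cl o23 y z b2 b1 & C]
      [:: Cl o23 a2 a3 x y, Cl o13 a1 y z b1, Cl o12 z x b3 b2 & C].

(* [draw_arc e f C D]: D is obtained from C, a diagram with two loose ends e
   and f, by joining e to f by an arc all of whose crossings are virtual.  The
   pen, at the loose end e, may leave a mark on the arc, or cross a strand at
   a mark from either side. *)
Inductive draw_arc : label -> label -> code -> code -> Prop :=
| draw_end e f C : draw_arc e f C (Pt e f :: C)
| draw_mark e f g C D of draw_arc g f (Pt e g :: C) D : draw_arc e f C D
| draw_left e f g s t C1 C2 D of draw_arc g f (Vi e s g t :: C1 ++ C2) D :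
    draw_arc e f (C1 ++ Pt s t :: C2) D
| draw_right e f g s t C1 C2 D of draw_arc g f (Vi e t g s :: C1 ++ C2) D :
    draw_arc e f (C1 ++ Pt s t :: C2) D.

Definition detour (D D' : code) : Prop :=
  exists e f C, draw_arc e f C D /\ draw_arc e f C D'.

(* Requiring both sides to be planar diagrams is what forces the local
   replacements above to take place in a disk, and the arcs in [detour] to be
   drawn in the plane of the rest of the diagram. *)
Definition virtual_move (D D' : code) : Prop :=
  [/\ is_diagram D, is_diagram D' &
      [\/ same_diagram D D', reidemeister D D' | detour D D']].

Definition virtual_equiv : code -> code -> Prop :=
  clos_refl_sym_trans code virtual_move.

Definition classical (C : code) : bool := ~~ has is_virtual C.
Definition crossingless (C : code) : bool := all is_mark C.

Definition classical_link (D : code) : Prop :=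
  exists D', [/\ is_diagram D', classical D' & virtual_equiv D D'].

Definition trivial_link (D : code) : Prop :=
  exists D', [/\ is_diagram D', crossingless D' & virtual_equiv D D'].

(** * Virtualization of a crossing *)

Definition fresh (C : code) : label := (\max_(l <- labels C) l).+1.

(* The crossing [Cl o a b c d] is replaced by
       a     x     w     d
         Vi    Cl    Vi
       b     y     z     c
   where the middle crossing has the rising diagonal over exactly when the
   falling diagonal a-c was over in the original one. *)
Definition virtualize (o : bool) (a b c d : label) (T : code) : code :=
  let n := fresh (Cl o a b c d :: T) in
  let: (x, y, z, w) := (n, n.+1, n.+2, n.+3) in
  [:: Vi a b y x, Cl (~~ o) x y z w, Vi w z c d & T].

(** * The Kauffman bracket *)

(* Z[A, A^-1] is taken inside the field of fractions of Z[A]. *)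
Definition laurent : fieldType := {fraction {poly int}}.

Definition A : laurent := tofrac 'X.

Definition loop_value : laurent := - A ^+ 2 - A ^- 2.

(* The A-smoothing joins the two regions swept out when the overcrossing
   strand is turned counterclockwise. *)
Definition smoothing_ad (a b c d : label) : code := [:: Pt a d; Pt b c].
Definition smoothing_ab (a b c d : label) : code := [:: Pt a b; Pt c d].

Definition A_smoothing (o : bool) a b c d : code :=
  if o then smoothing_ad a b c d else smoothing_ab a b c d.
Definition B_smoothing (o : bool) a b c d : code :=
  if o then smoothing_ab a b c d else smoothing_ad a b c d.

(* All the crossingless codes obtained by smoothing the classical crossings,
   each with its coefficient. *)
Fixpoint states (C : code) : seq (laurent * code) :=
  match C with
  | [::] => [:: (1, [::])]
  | Cl o a b c d :: C' =>
      [seq (A * s.1, A_smoothing o a b c d ++ s.2) | s <- states C'] ++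
      [seq (A^-1 * s.1, B_smoothing o a b c d ++ s.2) | s <- states C']
  | Vi a b c d :: C' =>
      [seq (s.1, [:: Pt a c, Pt b d & s.2]) | s <- states C']
  | Pt a b :: C' => [seq (s.1, Pt a b :: s.2) | s <- states C']
  end.

(* The bracket of a nonempty closed diagram, equal to 1 on one circle. *)
Definition bracket (C : code) : laurent :=
  \sum_(s <- states C) s.1 * loop_value ^+ (components s.2).-1.

Definition joined (S : code) (x y : label) : bool :=
  [exists i : 'I_(size S), exists j : 'I_(size S),
    [&& x \in ends (tnth (in_tuple S) i), y \in ends (tnth (in_tuple S) j)
      & connect (@adjacent S) i j]].

Definition same_joins (S E : code) : bool :=
  all (fun v => if v is Pt x y then joined S x y else false) E.

(* The coefficient of <E> in the expansion of <T>, for a crossingless tangle E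
   with the same ends as T and no closed loop: the states of T that join the
   ends as E does contribute, each loop other than the [size E] arcs giving a
   factor [loop_value]. *)
Definition tangle_coef (T E : code) : laurent :=
  \sum_(s <- states T | same_joins s.2 E)
     s.1 * loop_value ^+ (components s.2 - size E).

(* Main.v *)
(* The invariant is a state sum computing the arrow polynomial with its arrow
   numbers reduced modulo 2.  Orient the diagram.  Colour the edges by elements of
   a finite ring I and expand every crossing as in the Kauffman bracket, except
   that a smoothing which does not respect the orientation shifts colours by
   kappa along its two arcs, up to sign.  A state circle then contributes #|I| if
   its total shift vanishes and 0 otherwise, so that the invariance is that of the
   bracket at a value x of A with #|I| = - x^2 - x^-2.

   On a planar classical diagram the shifts are the increments of an Alexander
   numbering, because every cycle on the sphere bounds, so the twisted sum is equal
   to the untwisted one.  Having a well oriented diagram on which the two sums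
   differ is thus an obstruction to being classical.  In K_v the crossing is seen
   from the tangle T with its cyclic order reversed.  After the shifts of T are
   removed by an Alexander numbering of K, only the states made of two parallel
   essential circles, through the smoothing of v against the orientation, have a
   nonzero total shift, namely 2 kappa.  The difference of the two sums is a unit
   times #|I|^2 alpha(x) or #|I|^2 beta(x), and it is nonzero for a suitable x and
   for kappa of order 4. *)

Require Import Defs.
From mathcomp Require Import all_boot all_order all_algebra all_field.
From mathcomp Require Import zify ring lra.
From Stdlib Require Import FunctionalExtensionality.

Set Implicit Arguments.
Unset Strict Implicit.
Unset Printing Implicit Defensive.

Import Order.TTheory GRing.Theory Num.Theory.
Local Open Scope ring_scope.

(** * Euler's formula and flows on the edges *)

(** Colours in a finite ring replace formal arrow variables so that each move becomes an identity
    between tensors on an open tangle, and no state circle has to be followed through a move. The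
    price is that the loop value must be the cardinal of a ring: [A] is specialized at a solution of
    [x ^+ 2 + x ^- 2 = - 4 n], and as [n] varies this gives infinitely many values, more than a
    nonzero polynomial can kill. The factor 4 provides [kappa] with [2 kappa] nonzero and
    [4 kappa = 0], so that a shift by [2 kappa] has no sign to track. An unoriented code has several
    orientations and a move carries each of them to some other one, so what travels along an
    equivalence is the existence of an orientation for which the two sums differ. The orientation
    chosen for K decides which smoothing of the crossing goes against it, hence which of the two
    coefficients must not vanish. Planarity is known only through Euler's formula. Rational linear
    algebra turns it into the statement that every circulation is a difference of face values. One
    direction gives Alexander numberings, the other shows that K_v is again planar. *)

Section ClassSpace.
Variables (T : finType) (e : rel T).
Hypothesis e_sym : connect_sym e.

(** Its rows are the indicators of the classes, so its row space consists of the class functions.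
    Counting components, faces or edges thus becomes computing ranks. *)
Definition class_mx : 'M[rat]_#|T| :=
  \matrix_(i, j) (connect e (enum_val i) (enum_val j))%:R.

Lemma class_mxP (v : 'rV[rat]_#|T|) :
  reflect (forall x y, e x y -> v 0 (enum_rank x) = v 0 (enum_rank y))
          (v <= class_mx)%MS.
Proof.
apply: (iffP submxP) => [[u ->] x y exy | v_const].
  rewrite !mxE; apply: eq_bigr => i _; rewrite !mxE !enum_rankK.
  by rewrite (same_connect_r e_sym (connect1 exy)).
have v_root x : v 0 (enum_rank (fingraph.root e x)) = v 0 (enum_rank x).
  have /connectP[p ep ->] := connect_root e x.
  elim: p x ep => //= y p IHp x /andP[/v_const-> /IHp ->] //.
(* Each class indicator is taken once, at the root, with the value of [v] there as coefficient. *)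
exists (\row_i (if roots e (enum_val i) then v 0 i else 0)).
apply/rowP=> j; rewrite !mxE (bigD1 (enum_rank (fingraph.root e (enum_val j)))) //=.
rewrite !mxE enum_rankK roots_root // v_root enum_valK.
rewrite e_sym connect_root mulr1 big1 ?addr0 // => i neq_i.
rewrite !mxE; case: ifP => [/eqP root_i|_]; last by rewrite mul0r.
case: (boolP (connect _ _ _)) => [/(fingraph.rootP e_sym) eq_r|]; last by rewrite mulr0.
by rewrite -eq_r root_i enum_valK eqxx in neq_i.
Qed.

(** The matrix factors through the set of roots, which bounds the rank above; its restriction to the
    rows and columns of the roots is the identity, which bounds it below. *)
Lemma rank_class_mx : \rank class_mx = n_comp e predT.
Proof.
set k := n_comp e predT.
pose r (a : 'I_k) : T := enum_val a.
have r_root a : fingraph.root e (r a) = r a.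
  by have := enum_valP a; rewrite inE andbT => /eqP.
apply/eqP; rewrite eqn_leq; apply/andP; split.
  have -> : class_mx = (\matrix_(i < #|T|, a < k) (fingraph.root e (enum_val i) == r a)%:R)
                    *m (\matrix_(a < k, j < #|T|) (connect e (r a) (enum_val j))%:R).
    apply/matrixP=> i j; rewrite !mxE.
    have root_in : fingraph.root e (enum_val i) \in predI (roots e) predT.
      by rewrite inE andbT roots_root.
    rewrite (bigD1 (enum_rank_in root_in (fingraph.root e (enum_val i)))) //=.
    rewrite !mxE /r enum_rankK_in // eqxx mul1r big1 ?addr0.
      by rewrite (same_connect e_sym (connect_root e (enum_val i))).
    move=> a neq_a; rewrite !mxE; case: eqP => [ra|]; last by rewrite mul0r.
    by case/eqP: neq_a; apply: enum_val_inj; rewrite enum_rankK_in // -ra.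
  exact: leq_trans (mxrankM_maxl _ _) (rank_leq_col _).
pose S : 'M[rat]_(k, #|T|) := \matrix_(a, i) (r a == enum_val i)%:R.
have S_J A a j : (S *m A) a j = A (enum_rank (r a)) j :> rat.
  rewrite mxE (bigD1 (enum_rank (r a))) //= mxE enum_rankK eqxx mul1r.
  rewrite big1 ?addr0 // => i neq_i; rewrite mxE; case: eqP => [ra|].
    by rewrite ra enum_valK eqxx in neq_i.
  by rewrite mul0r.
have SJS : S *m (S *m class_mx)^T = 1%:M.
  apply/matrixP=> a b; rewrite S_J [LHS]mxE S_J !mxE !enum_rankK.
  rewrite -(root_connect e_sym) !r_root eq_sym.
  by rewrite (inj_eq enum_val_inj).
rewrite -[X in (X <= _)%N](mxrank1 rat k) -SJS.
by apply: leq_trans (mxrankM_maxr _ _) _; rewrite mxrank_tr mxrankM_maxr.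
Qed.

End ClassSpace.

Lemma fcard_involution (T : finType) (f : T -> T) :
  involutive f -> (forall x, f x != x) -> (fcard f predT * 2 = #|T|)%N.
Proof.
move=> fK f_neq; have injf := can_inj fK.
apply: (@fcard_order_set T f injf 2 predT) => //.
apply/subsetP=> x _; rewrite inE.
by rewrite (@order_cycle _ f [:: x;
  f x]) //= ?fK ?eqxx //= ?inE ?eqxx // andbT eq_sym f_neq.
Qed.

Definition mk_slot (C : code) (i : 'I_(size C))
    (j : 'I_(size (ends (tnth (in_tuple C) i)))) : slot C :=
  @Tagged _ i (fun i => 'I_(size (ends (tnth (in_tuple C) i)))) j.

Lemma sum_slot (R : nmodType) (C : code) (G : slot C -> R) :
  \sum_s G s = \sum_(i < size C) \sum_j G (@mk_slot C i j).
Proof.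
rewrite (sig_big_dep xpredT (fun _ => xpredT) (fun i j => G (@mk_slot C i j))) /=.
by apply: eq_bigr => -[i j] _.
Qed.

Lemma count_slot (C : code) l :
  count_mem l (labels C) = #|[pred s : slot C | slot_label s == l]|.
Proof.
rewrite -sum1_card big_mkcond sum_slot /labels count_flatten -map_comp sumnE.
rewrite big_map big_tnth; apply: eq_bigr => i _.
rewrite /= -sum1_count big_mkcond (big_nth 0%N) big_mkord.
by apply: eq_bigr => j _.
Qed.

Lemma slot_label_in (C : code) (s : slot C) : slot_label s \in labels C.
Proof.
rewrite -has_pred1 has_count count_slot; apply/card_gt0P; exists s.
by rewrite inE.
Qed.

Lemma closed_count C l : closed_code C -> l \in labels C ->
  count_mem l (labels C) = 2.
Proof. by move=> /allP C_closed /C_closed /eqP. Qed.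

Section ClosedCode.
Variable C : code.
Hypothesis C_closed : closed_code C.
Local Notation opp := (@slot_opp C).
Local Notation next := (@slot_next C).

Lemma card_same_label (s : slot C) :
  #|[pred t : slot C | slot_label t == slot_label s]| = 2.
Proof. by rewrite -count_slot closed_count // slot_label_in. Qed.

(** Closedness leaves exactly one other half-edge with the same label, so the arbitrary choice made
    by [slot_opp] is forced and its default is never reached. *)
Lemma slot_oppE (s t : slot C) :
  (t == opp s) = (t != s) && (slot_label t == slot_label s).
Proof.
have [t0 t0P t0_uniq] : exists2 t0, t0 != s /\ slot_label t0 = slot_label s &
    forall t, t != s -> slot_label t = slot_label s -> t = t0.
  have := card_same_label s; rewrite (cardD1 s) inE eqxx add1n => -[] /eqP.
  case/card1P=> t0 t0P; exists t0 => [|t1 neq1 lab1].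
    by have := t0P t0; rewrite !inE eqxx => /andP[-> /eqP].
  by have := t0P t1; rewrite !inE neq1 lab1 eqxx => /esym/eqP.
have ->: opp s = t0.
  rewrite /slot_opp; case: pickP => [t1 /andP[neq1 /eqP lab1] | none] /=.
    exact: t0_uniq.
  by have := none t0; case: t0P => -> ->; rewrite eqxx.
apply/eqP/andP=> [-> | [neq_t /eqP]]; last exact: t0_uniq.
by case: t0P => -> ->.
Qed.

Lemma slot_opp_neq s : opp s != s.
Proof. by have := eqxx (opp s); rewrite slot_oppE => /andP[? /eqP]. Qed.

Lemma slot_label_opp s : slot_label (opp s) = slot_label s.
Proof. by have := eqxx (opp s); rewrite slot_oppE => /andP[? /eqP]. Qed.

Lemma slot_oppK : involutive opp.
Proof.
move=> s; apply/eqP; rewrite eq_sym slot_oppE.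
by rewrite eq_sym slot_opp_neq slot_label_opp eqxx.
Qed.

Lemma slot_next_inj : injective next.
Proof.
move=> [i j] [i' j'] eq_next; have /= eq_i := congr1 tag eq_next.
case: _ / eq_i j' eq_next => j' /eqP; rewrite /slot_next eq_Tagged /=.
by move=> /eqP/ordS_inj->.
Qed.

Lemma slot_face_inj : injective (fun s => next (opp s)).
Proof. by move=> s t /slot_next_inj/(can_inj slot_oppK). Qed.

Local Notation N := #|slot C|.
Local Notation fnrow g := (\row_(j < N) g (enum_val j) : 'rV[rat]_N).
(* The row spaces of these matrices consist of the functions on half-edges that are
   constant on vertices, on faces, and on edges, respectively. *)
Local Notation vertex_mx :=
  (\matrix_(i < #|'I_(size C)|, j < N) (tag (enum_val j) == enum_val i)%:R : 'M[rat]_(_,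
    _)).
Local Notation opp_mx := (\matrix_(i < N,
  j < N) (enum_val i == opp (enum_val j))%:R : 'M[rat]_N).
Local Notation face_mx := (class_mx (frel (fun s : slot C => next (opp s)))).
Local Notation edge_mx := (class_mx (frel opp)).

Lemma rowE (v : 'rV[rat]_N) : v = fnrow (fun s => v 0 (enum_rank s)).
Proof. by apply/rowP=> j; rewrite mxE enum_valK. Qed.

Lemma row_pull (u : 'rV[rat]_#|'I_(size C)|) s :
  (u *m vertex_mx) 0 (enum_rank s) = u 0 (enum_rank (tag s)).
Proof.
rewrite mxE (bigD1 (enum_rank (tag s))) //= mxE !enum_rankK eqxx mulr1.
rewrite big1 ?addr0 // => i neq_i; rewrite mxE enum_rankK.
by case: eqP => [eq_i|_]; [rewrite eq_i enum_valK eqxx in neq_i | rewrite mulr0].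
Qed.

Lemma row_vertexP (v : 'rV_N) :
  reflect (forall s t, tag s = tag t -> v 0 (enum_rank s) = v 0 (enum_rank t))
          (v <= vertex_mx)%MS.
Proof.
apply: (iffP submxP) => [[u ->] s t eq_st | v_const].
  by rewrite !row_pull eq_st.
pose u : 'rV[rat]_#|'I_(size C)| := \row_i (if [pick s : slot C | tag s == enum_val i] is
  Some s
                 then v 0 (enum_rank s) else 0).
exists u; rewrite [LHS]rowE [RHS]rowE; apply/rowP=> j.
rewrite [LHS]mxE [RHS]mxE row_pull mxE enum_rankK.
case: pickP => [s /eqP|/(_ (enum_val j))]; last by rewrite eqxx.
by move/v_const->.
Qed.

Lemma rank_vertex_mx : \rank vertex_mx = size C.
Proof.
apply/eqP; rewrite -[X in _ == X]card_ord; apply/row_freeP.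
have size_gt0 (i : 'I_(size C)) : (0 < size (ends (tnth (in_tuple C) i)))%N.
  by case: (tnth _ i).
pose first i := mk_slot (Ordinal (size_gt0 i)).
exists (\matrix_(j, i) (enum_val j == first (enum_val i))%:R).
apply/matrixP=> i i'; rewrite !mxE (bigD1 (enum_rank (first (enum_val i')))) //=.
rewrite !mxE enum_rankK eqxx mulr1 big1 ?addr0 => [|j neq_j].
  by rewrite /= (inj_eq enum_val_inj) eq_sym.
rewrite !mxE; case: (_ =P first _) => [eq_j|_]; last by rewrite mulr0.
by rewrite -eq_j enum_valK eqxx in neq_j.
Qed.

Lemma slot_next_const (X : Type) (h : slot C -> X) :
  (forall s, h (next s) = h s) -> forall s t, tag s = tag t -> h s = h t.
Proof.
move=> h_next; suff h_first i k (lt_k : (k < size (ends (tnth (in_tuple C) i)))%N)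
    (lt_0 : (0 < size (ends (tnth (in_tuple C) i)))%N) :
    h (mk_slot (Ordinal lt_k)) = h (mk_slot (Ordinal lt_0)).
  case=> [i [j lt_j]] [i' [j' lt_j']] /= eq_i; case: _ / eq_i lt_j' => lt_j'.
  by rewrite (h_first _ _ lt_j (leq_ltn_trans (leq0n _) lt_j)) -(h_first _ _ lt_j').
elim: k lt_k => [|k IHk] lt_k; first by congr (h (mk_slot _)); apply: val_inj.
rewrite -(IHk (ltnW lt_k)) -(h_next (mk_slot (Ordinal (ltnW lt_k)))).
by congr (h (mk_slot _)); apply: val_inj; rewrite /= modn_small.
Qed.

Lemma adjacentP i j :
  reflect (exists s t : slot C, [/\ tag s = i, tag t = j & slot_label s = slot_label t])
          (adjacent i j).
Proof.
apply: (iffP hasP) => [[l l_i l_j] | [s [t [<- <- lab_st]]]].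
  have [lt_i lt_j] : (index l (ends (tnth (in_tuple C) i)) < size (ends (tnth (in_tuple
    C) i)))%N
    /\ (index l (ends (tnth (in_tuple C) j)) < size (ends (tnth (in_tuple C) j)))%N.
    by rewrite !index_mem.
  exists (mk_slot (Ordinal lt_i)), (mk_slot (Ordinal lt_j)).
  by split; rewrite // /slot_label /= !nth_index.
exists (slot_label s); last rewrite /= lab_st.
  exact: (mem_nth 0%N (ltn_ord (tagged s))).
exact: (mem_nth 0%N (ltn_ord (tagged t))).
Qed.

Lemma row_opp_mx (v : 'rV_N) s : (v *m opp_mx) 0 (enum_rank s) = v 0 (enum_rank (opp s)).
Proof.
rewrite mxE (bigD1 (enum_rank (opp s))) //= mxE !enum_rankK eqxx mulr1.
rewrite big1 ?addr0 // => j neq_j; rewrite mxE enum_rankK.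
by case: eqP => [eq_j|_]; [rewrite -eq_j enum_valK eqxx in neq_j | rewrite mulr0].
Qed.

Lemma opp_mx_sym : opp_mx^T = opp_mx.
Proof.
by apply/matrixP=> i j; rewrite !mxE eq_sym (can2_eq slot_oppK slot_oppK) eq_sym.
Qed.

Lemma opp_connect_sym : connect_sym (frel opp).
Proof. exact: fconnect_sym (can_inj slot_oppK). Qed.

Lemma row_edgeP (v : 'rV_N) :
  reflect (forall s, v 0 (enum_rank (opp s)) = v 0 (enum_rank s)) (v <= edge_mx)%MS.
Proof.
apply: (iffP (class_mxP opp_connect_sym _)) => [v_opp s | v_opp s _ /eqP<-] //.
by apply/esym/v_opp; apply/eqP.
Qed.

Local Notation opp_combination a := (1%:M + (a : rat) *: opp_mx)%R.

Lemma row_opp_combination (v : 'rV_N) (a : rat) s :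
  (v *m (opp_combination a)) 0 (enum_rank s) =
  v 0 (enum_rank s) + a * v 0 (enum_rank (opp s)).
Proof. by rewrite mulmxDr mulmx1 -scalemxAr mxE [X in _ + X]mxE row_opp_mx. Qed.

Lemma row_mul1mx (A : 'M[rat]_N) k : row k A = row k 1%:M *m A.
Proof. by rewrite -row_mul mul1mx. Qed.

Lemma row_eq (v w : 'rV[rat]_N) :
  (forall s, v 0 (enum_rank s) = w 0 (enum_rank s)) -> v = w.
Proof. by move=> eq_vw; apply/rowP=> j; rewrite -(enum_valK j). Qed.

(** A symmetric function is its own average over the two halves of each edge, which is where the
    factor 1/2 comes from. *)
Lemma edge_mxE : (edge_mx :=: opp_combination 1)%MS.
Proof.
apply/eqmxP/andP; split; apply/row_subP=> k.
  have /row_edgeP v_sym := row_sub k edge_mx; move: (row k edge_mx) v_sym => v v_sym.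
  suff -> : v = (2^-1 *: v) *m (opp_combination 1) by apply: submxMl.
  by apply: row_eq => s; rewrite row_opp_combination !mxE v_sym; lra.
by rewrite row_mul1mx; apply/row_edgeP=> s; rewrite !row_opp_combination slot_oppK; lra.
Qed.

Lemma kermx_antisymmetric : (kermx (opp_combination (-1)) :=: edge_mx)%MS.
Proof.
apply/eqmxP/andP; split; apply/row_subP=> k.
  have /sub_kermxP := row_sub k (kermx (opp_combination (-1))).
  move: (row _ _) => v v0; apply/row_edgeP=> s.
  by have := row_opp_combination v (-1) s; rewrite v0 mxE; lra.
have /row_edgeP := row_sub k edge_mx; move: (row k edge_mx) => v v_sym.
by apply/sub_kermxP/row_eq=> s; rewrite row_opp_combination v_sym mxE; lra.
Qed.

Lemma face_connect_sym : connect_sym (frel (fun s => next (opp s))).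
Proof. exact: fconnect_sym slot_face_inj. Qed.

Lemma row_faceP (v : 'rV_N) :
  reflect (forall s, v 0 (enum_rank (next (opp s))) = v 0 (enum_rank s)) (v <= face_mx)%MS.
Proof.
apply: (iffP (class_mxP face_connect_sym _)) => [v_face s | v_face s _ /eqP<-] //.
by apply/esym/v_face; apply/eqP.
Qed.

(** The face permutation is [next] after [opp]; on functions invariant under [opp], invariance under
    it and under [next] are the same condition. *)
Lemma face_edge_cap : (face_mx :&: edge_mx :=: vertex_mx :&: edge_mx)%MS.
Proof.
apply/eqmxP/andP; split; apply/row_subP=> k.
  have := row_sub k (face_mx :&: edge_mx)%MS; move: (row _ _) => v.
  rewrite !sub_capmx => /andP[/row_faceP v_face v_Ym]; rewrite v_Ym andbT.
  have /row_edgeP v_opp := v_Ym; apply/row_vertexP/slot_next_const => s.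
  by rewrite -{1}[s]slot_oppK v_face v_opp.
have := row_sub k (vertex_mx :&: edge_mx)%MS; move: (row _ _) => v.
rewrite !sub_capmx => /andP[/row_vertexP v_tag v_Ym]; rewrite v_Ym andbT.
by have /row_edgeP v_opp := v_Ym; apply/row_faceP=> s; rewrite -[RHS]v_opp; apply: v_tag.
Qed.

Lemma adjacent_connect_sym : connect_sym (@adjacent C).
Proof.
apply: sym_connect_sym => i j; apply/adjacentP/adjacentP => -[s [t [? ? ?]]];
by exists t, s.
Qed.

Lemma row_free_vertex_mx : row_free vertex_mx.
Proof. by rewrite /row_free rank_vertex_mx card_ord. Qed.

(** A function constant on vertices is pulled back from the vertex set, and constancy on edges then
    makes it a class function for adjacency. *)
Lemma rank_vertex_edge_cap : \rank (vertex_mx :&: edge_mx)%MS = components C.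
Proof.
rewrite /components -(rank_class_mx adjacent_connect_sym) -(mxrankMfree _
  row_free_vertex_mx).
apply: eqmx_rank; apply/andP; split; apply/row_subP=> k.
  have := row_sub k (vertex_mx :&: edge_mx)%MS; move: (row _ _) => v.
  rewrite sub_capmx => /andP[/submxP[u ->] /row_edgeP v_opp]; apply: submxMr.
  apply/(class_mxP adjacent_connect_sym) => i j /adjacentP[s [t [<- <- lab_st]]].
  rewrite -!row_pull; case: (eqVneq t s) => [-> // | neq_ts].
  have /eqP-> : t == opp s by rewrite slot_oppE neq_ts lab_st eqxx.
  by rewrite v_opp.
rewrite row_mul sub_capmx submxMl; apply/row_edgeP=> s; rewrite !row_pull.
have /(class_mxP adjacent_connect_sym) J_adj := row_sub k (class_mx (@adjacent C)).
by apply: J_adj; apply/adjacentP; exists (opp s), s; rewrite slot_label_opp.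
Qed.

Lemma rank_edge_mx : (\rank edge_mx * 2 = N)%N.
Proof.
rewrite rank_class_mx; last exact: opp_connect_sym.
exact: fcard_involution slot_oppK slot_opp_neq.
Qed.

Definition circulation (v : 'rV[rat]_N) :=
  (forall s, v 0 (enum_rank (opp s)) = - v 0 (enum_rank s)) /\
  (forall i, \sum_(s : slot C | tag s == i) v 0 (enum_rank s) = 0).

(* A circulation is orthogonal to the coboundaries and to the symmetric functions,
   and Euler's formula says that the boundaries of faces have the right rank to be
   all the circulations. *)
Local Notation cut_mx := (vertex_mx + (opp_combination 1))%MS.

Lemma circulationP v : circulation v <-> (v <= kermx cut_mx^T)%MS.
Proof.
have som_sym : (opp_combination 1)^T = opp_combination 1 by rewrite linearD linearZ /=
  opp_mx_sym trmx1.
have tr0 (m : nat) (A : 'M[rat]_(m, N)) : (v *m A^T == 0) = (A <= kermx v^T)%MS.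
  rewrite -[LHS](inj_eq trmx_inj) trmx_mul trmxK trmx0.
  by apply/eqP/sub_kermxP.
have -> : (v <= kermx cut_mx^T)%MS = (v *m vertex_mx^T == 0) && (v *m (opp_combination
  1)^T == 0).
  by rewrite !tr0 -addsmx_sub -tr0; apply/sub_kermxP/eqP.
rewrite som_sym.
have sumE i : (v *m vertex_mx^T) 0 (enum_rank i) = \sum_(s : slot C | tag s == i) v 0
  (enum_rank s).
  rewrite mxE (reindex (@enum_rank _)) /=; last by exists enum_val => ? _;
    rewrite ?enum_valK ?enum_rankK.
  rewrite [RHS]big_mkcond; apply: eq_bigr => s _; rewrite !mxE !enum_rankK.
  by case: eqP; rewrite ?mulr1 ?mulr0.
split=> [[v_opp v_sum] | /andP[/eqP vV /eqP vS]].
  apply/andP; split; last by apply/eqP/row_eq=> s; rewrite row_opp_combination v_opp mxE;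
    lra.
  by apply/eqP/rowP=> i; rewrite -(enum_valK i) sumE v_sum mxE.
split=> [s | i]; last by rewrite -sumE vV mxE.
by have := row_opp_combination v 1 s; rewrite vS mxE; lra.
Qed.

Lemma face_circulation u : (u <= face_mx)%MS -> circulation (u *m opp_combination (-1)).
Proof.
move/row_faceP=> u_face; split=> [s | i];
  first by rewrite !row_opp_combination slot_oppK; lra.
(* The value at [opp s] equals the value at [next s], so the sum around a vertex telescopes. *)
under eq_bigr => s _ do rewrite row_opp_combination mulN1r -(u_face (opp s)) slot_oppK.
by rewrite sumrB (reindex_inj slot_next_inj) /= -sumrB big1 // => s _; rewrite subrr.
Qed.

Lemma face_sub : (face_mx *m opp_combination (-1) <= kermx cut_mx^T)%MS.
Proof.
apply/row_subP=> k; rewrite row_mul; apply/circulationP/face_circulation.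
exact: row_sub.
Qed.

(** With V vertices, E edges, F faces and c components, the circulations have dimension E - V + c
    and the face boundaries F - c. Since [face_sub] always gives one inequality, Euler's formula
    amounts to the other. *)
Lemma planar_rank :
  planar C = (\rank (kermx cut_mx^T) <= \rank (face_mx *m opp_combination (-1)))%N.
Proof.
have rB := mxrank_sum_cap vertex_mx (opp_combination 1).
have rcap : \rank (vertex_mx :&: opp_combination 1)%MS = components C.
  by rewrite -rank_vertex_edge_cap; apply: eqmx_rank;
    rewrite !(cap_eqmx (eqmx_refl _) edge_mxE) submx_refl.
have rF := mxrank_mul_ker face_mx (opp_combination (-1)).
have rFcap : \rank (face_mx :&: kermx (opp_combination (-1)))%MS = components C.
  rewrite -rank_vertex_edge_cap -(eqmx_rank (introT eqmxP face_edge_cap)); apply: eqmx_rank.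
  by rewrite !(cap_eqmx (eqmx_refl _) kermx_antisymmetric) submx_refl.
have rfaces : \rank face_mx = faces C by rewrite (rank_class_mx face_connect_sym).
have rS : \rank (opp_combination 1) = \rank edge_mx by apply/esym/eqmx_rank/eqmxP/edge_mxE.
have rle := mxrankS face_sub; have r2 := rank_edge_mx.
move: rB rF rle; rewrite rcap rFcap rfaces rS rank_vertex_mx mxrank_ker mxrank_tr /planar
  => rB rF rle.
have half : #|slot C|./2 = \rank edge_mx by apply: double_inj; lia.
have rBle := rank_leq_row cut_mx; rewrite half {half}.
move: (\rank cut_mx) (\rank (face_mx *m _)) (\rank edge_mx) r2 rB rF rle rBle => rB' rF' rY.
by move: #|slot C| (size C) (faces C) (components C) => n v f c; lia.
Qed.

(** This is the vanishing of the first rational homology of the surface carrying the diagram,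
    written as the existence of face values with prescribed jumps across the edges. *)
Lemma planarP :
  planar C <-> forall v, circulation v ->
    exists2 u : 'rV_N, (forall s, u 0 (enum_rank (next (opp s))) = u 0 (enum_rank s)) &
      forall s, u 0 (enum_rank s) - u 0 (enum_rank (opp s)) = v 0 (enum_rank s).
Proof.
rewrite planar_rank (geq_leqif (mxrank_leqif_sup face_sub));
  split=> [subF v /circulationP v_circ | ex_pot].
  have /submxP[w ->] := submx_trans v_circ subF.
  exists (w *m face_mx) => [|s]; first by apply/row_faceP/submxMl.
  by rewrite mulmxA row_opp_combination; lra.
apply/row_subP=> k; have /circulationP/ex_pot[u /row_faceP/submxP[w def_u] u_pot] :=
  row_sub k (kermx cut_mx^T).
apply/submxP; exists w; rewrite mulmxA -def_u; apply: row_eq => s.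
by rewrite -u_pot row_opp_combination; lra.
Qed.

End ClosedCode.

(** * Flows and face values on numbered half-edges *)

Definition vertex (C : code) i := nth (Pt 0 0) C i.
Definition degree (C : code) i := size (ends (vertex C i)).
(** Half-edges are pairs of plain numbers here, rather than elements of the dependent type [slot C],
    so that those of two related codes can be compared and treated by cases. *)
Definition half_edge (C : code) i j := (i < size C)%N && (j < degree C i)%N.
Definition half_label (C : code) i j := nth 0%N (ends (vertex C i)) j.

(* Values on half-edges: the flow through a vertex is balanced, and both halves of
   an edge carry the same flow, with opposite signs. *)
Definition flow (C : code) (g : nat -> nat -> rat) :=
  (forall i, (i < size C)%N -> \sum_(j < degree C i) g i j = 0) /\
  (forall i j i' j', half_edge C i j -> half_edge C i' j' -> (i, j) != (i', j') ->
     half_label C i j = half_label C i' j' -> g i' j' = - g i j).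

(* Values on the faces: [r i j] is the value at the corner of the vertex [i] met
   just before its half-edge [j]. *)
Definition corner_potential (C : code) (g r : nat -> nat -> rat) :=
  (forall i j, half_edge C i j -> r i j - r i (j.+1 %% degree C i)%N = g i j) /\
  (forall i j i' j', half_edge C i j -> half_edge C i' j' -> (i, j) != (i', j') ->
     half_label C i j = half_label C i' j' -> r i j = r i' (j'.+1 %% degree C i')%N).

Section HalfEdges.
Variable C : code.

Lemma degreeE (i : 'I_(size C)) : degree C i = size (ends (tnth (in_tuple C) i)).
Proof. by rewrite /degree /vertex (tnth_nth (Pt 0 0)). Qed.

Definition at_vertex (s : slot C) : nat := tag s.
Definition at_place (s : slot C) : nat := tagged s.

Lemma half_edgeP i j : half_edge C i j ->
  exists2 s : slot C, at_vertex s = i & at_place s = j.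
Proof.
case/andP=> lt_i lt_j; rewrite (degreeE (Ordinal lt_i)) in lt_j.
by exists (mk_slot (Ordinal lt_j)).
Qed.

Lemma half_edge_slot (s : slot C) : half_edge C (at_vertex s) (at_place s).
Proof. by rewrite /half_edge degreeE !ltn_ord. Qed.

Lemma half_label_slot (s : slot C) : half_label C (at_vertex s) (at_place s) = slot_label s.
Proof. by rewrite /half_label /vertex -(tnth_nth _ (in_tuple C)). Qed.

Lemma slot_eqE (s t : slot C) :
  (s == t) = ((at_vertex s, at_place s) == (at_vertex t, at_place t)).
Proof.
rewrite /at_vertex /at_place; apply/eqP/eqP=> [-> //|].
case: s t => [i j] [i' j'] /= [/val_inj eq_i].
by case: _ / eq_i j' => j' /val_inj->.
Qed.

Definition slot_val (F : slot C -> rat) i j : rat :=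
  if [pick s : slot C | (at_vertex s == i) && (at_place s == j)] is Some s
  then F s else 0.

Lemma slot_valE F s : slot_val F (at_vertex s) (at_place s) = F s.
Proof.
rewrite /slot_val; case: pickP => [t /andP[/eqP eq_i /eqP eq_j] | /(_ s)].
  by congr F; apply/eqP; rewrite slot_eqE eq_i eq_j.
by rewrite !eqxx.
Qed.

Lemma at_vertex_next (s : slot C) : at_vertex (slot_next s) = at_vertex s.
Proof. by []. Qed.

Lemma at_place_next (s : slot C) :
  at_place (slot_next s) = ((at_place s).+1 %% degree C (at_vertex s))%N.
Proof. by rewrite degreeE. Qed.

Lemma slot_valN F s :
  slot_val F (at_vertex s) ((at_place s).+1 %% degree C (at_vertex s))%N = F (slot_next s).
Proof. by rewrite -at_place_next -at_vertex_next slot_valE. Qed.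

Lemma sum_tag (F : slot C -> rat) (i : 'I_(size C)) :
  \sum_(s : slot C | tag s == i) F s = \sum_(j < degree C i) slot_val F i j.
Proof.
rewrite big_mkcond sum_slot (bigD1 i) //= [X in _ + X]big1 ?addr0 => [|i' neq_i];
  last first.
  by apply: big1 => j _; rewrite /= (negbTE neq_i).
rewrite degreeE; apply: eq_bigr => j _; rewrite /= eqxx.
exact/esym/(slot_valE F (mk_slot j)).
Qed.

Hypothesis C_closed : closed_code C.

Lemma half_edge_oppP s t :
  (((at_vertex s, at_place s) != (at_vertex t, at_place t)) &&
   (half_label C (at_vertex s) (at_place s) == half_label C (at_vertex t) (at_place t))) =
  (t == slot_opp s).
Proof. by rewrite slot_oppE // -slot_eqE !half_label_slot eq_sym [X in _ && X]eq_sym. Qed.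

Lemma planar_cornerP :
  planar C <-> forall g, flow C g -> exists r, corner_potential C g r.
Proof.
rewrite planarP //; split=> [C_planar g [g_sum g_opp] | C_pot v [v_opp v_sum]].
  pose v : 'rV[rat]_#|slot C| := \row_j g (at_vertex (enum_val j)) (at_place (enum_val j)).
  have vE s : v 0 (enum_rank s) = g (at_vertex s) (at_place s) by rewrite mxE enum_rankK.
  have v_circ : circulation v.
    split=> [s | i].
      rewrite !vE; have := eqxx (slot_opp s); rewrite -half_edge_oppP.
      by case/andP=> neq_s /eqP; apply: g_opp; rewrite ?half_edge_slot.
    rewrite sum_tag -[RHS](g_sum i (ltn_ord i)); apply: eq_bigr => j _.
    have : half_edge C i j by rewrite /half_edge !ltn_ord.
    move: (nat_of_ord i) (nat_of_ord j) => k l /half_edgeP[s <- <-].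
    by rewrite (slot_valE (fun s => v 0 (enum_rank s))) vE.
  have [u u_face u_pot] := C_planar v v_circ.
  exists (slot_val (fun s => u 0 (enum_rank s)));
    split=> [i j /half_edgeP[s <- <-] | i j i' j'].
    rewrite slot_valE slot_valN -vE -u_pot; congr (_ - _).
    by rewrite -[s in LHS](slot_oppK C_closed) u_face.
  move=> /half_edgeP[s <- <-] /half_edgeP[t <- <-] neq_st /eqP lab_st.
  have /eqP-> : t == slot_opp s by rewrite -half_edge_oppP neq_st.
  by rewrite slot_valE slot_valN u_face.
pose g := slot_val (fun s => v 0 (enum_rank s)).
have gE s : g (at_vertex s) (at_place s) = v 0 (enum_rank s).
  exact: (slot_valE (fun s => v 0 (enum_rank s))).
have g_flow : flow C g.
  split=> [i lt_i | i j i' j' /half_edgeP[s <- <-] /half_edgeP[t <- <-] neq_st /eqP lab_st].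
    by rewrite -[RHS](v_sum (Ordinal lt_i)) sum_tag.
  have /eqP-> : t == slot_opp s by rewrite -half_edge_oppP neq_st.
  by rewrite !gE v_opp.
have [r [r_pot r_opp]] := C_pot g g_flow.
have r_opp' s : r (at_vertex (slot_opp s)) (at_place (slot_opp s)) = r (at_vertex s)
  ((at_place s).+1 %% degree C (at_vertex s))%N.
  have := eqxx (slot_opp (slot_opp s));
    rewrite -half_edge_oppP slot_oppK // => /andP[neq_s /eqP].
  by apply: r_opp; rewrite ?half_edge_slot.
exists (\row_j r (at_vertex (enum_val j)) (at_place (enum_val j))) => s;
  rewrite !mxE !enum_rankK.
  have := r_opp' (slot_opp s); rewrite slot_oppK // => ->.
  by rewrite at_place_next.
by rewrite -gE -r_pot ?half_edge_slot // r_opp'.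
Qed.

End HalfEdges.

(** * Sums over the colourings of the edges *)

Section SumOver.
Variables (R : comPzRingType) (I : finZmodType).
Implicit Types (h : label -> I) (G H : (label -> I) -> R) (s t : seq label).

Definition recolor h l i : label -> I := fun l' => if l' == l then i else h l'.

(** Colourings are total functions, with base colouring [h] off the list [s]. The set of labels can
    then change along a move without any change of type. *)
Fixpoint sum_over s G h : R :=
  if s is l :: s' then \sum_i sum_over s' G (recolor h l i) else G h.

Lemma recolorC h k l i j : k != l ->
  recolor (recolor h k i) l j = recolor (recolor h l j) k i.
Proof.
move=> neq_kl; apply: functional_extensionality => m; rewrite /recolor.
by case: (eqVneq m l) => [->|//]; case: eqP => // eq_lk; rewrite eq_lk eqxx in neq_kl.
Qed.

Lemma sum_over_cat s t G : sum_over (s ++ t) G =1 sum_over s (sum_over t G).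
Proof. by elim: s => //= l s IHs h; apply: eq_bigr => i _; apply: IHs. Qed.

Lemma eq_sum_over s G H : G =1 H -> sum_over s G =1 sum_over s H.
Proof.
move=> eqGH; elim: s => //= l s IHs h.
by apply: eq_bigr => i _; apply: IHs.
Qed.

Lemma sum_over_swap k l G h : sum_over [:: k; l] G h = sum_over [:: l; k] G h.
Proof.
case: (eqVneq k l) => [-> // | neq_kl] /=; rewrite exchange_big /=.
by apply: eq_bigr => j _; apply: eq_bigr => i _; rewrite recolorC.
Qed.

Lemma sum_over1C l s G : sum_over [:: l] (sum_over s G) =1 sum_over s (sum_over [:: l] G).
Proof.
elim: s => //= k s IHs h; have /= -> := sum_over_swap l k (sum_over s G) h.
by apply: eq_bigr => i _; have /= -> := IHs (recolor h k i).
Qed.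

Lemma sum_overC s t G : sum_over s (sum_over t G) =1 sum_over t (sum_over s G).
Proof.
elim: s t => //= l s IHs t h.
have /= -> := eq_sum_over [:: l] (IHs t) h.
by have /= -> := sum_over1C l t (sum_over s G) h.
Qed.

Lemma sum_over_perm s t G : perm_eq s t -> sum_over s G =1 sum_over t G.
Proof.
move=> eq_st h; move: s t eq_st; apply: catCA_perm_subst => s1 s2 s3.
by rewrite !catA !sum_over_cat sum_overC.
Qed.

Lemma sum_overZ s c G h : sum_over s (fun h => c * G h) h = c * sum_over s G h.
Proof.
elim: s h => //= l s IHs h.
by rewrite big_distrr; apply: eq_bigr => i _; apply: IHs.
Qed.

Lemma sum_overB s G H h :
  sum_over s (fun h => G h - H h) h = sum_over s G h - sum_over s H h.
Proof.
elim: s h => //= l s IHs h; rewrite -sumrB.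
by apply: eq_bigr => i _; apply: IHs.
Qed.

Lemma sum_over_sum (T : Type) (r : seq T) (G : T -> (label -> I) -> R) s h :
  sum_over s (fun h => \sum_(u <- r) G u h) h = \sum_(u <- r) sum_over s (G u) h.
Proof.
elim: s h => //= l s IHs h; rewrite exchange_big.
by apply: eq_bigr => i _; apply: IHs.
Qed.

Definition ignores s (H : (label -> I) -> R) :=
  forall h l i, l \in s -> H (recolor h l i) = H h.

Lemma sum_over_factor s H G h : ignores s H ->
  sum_over s (fun h => H h * G h) h = H h * sum_over s G h.
Proof.
elim: s h => //= l s IHs h H_s; rewrite big_distrr; apply: eq_bigr => i _ /=.
rewrite IHs => [|h' l' i' l'_s]; first by rewrite H_s ?mem_head.
by rewrite H_s // inE l'_s orbT.
Qed.

(** Each summation variable is translated bijectively; only the base colouring keeps a trace of the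
    shift, and [sum_over_base] discards it when [G] reads listed labels only. *)
Lemma sum_over_shift s (m : label -> I) G h :
  sum_over s (fun h => G (fun l => h l - m l)) h = sum_over s G (fun l => h l - m l).
Proof.
elim: s h => //= l s IHs h.
rewrite [RHS](reindex_inj (@subIr I (m l))) /=; apply: eq_bigr => i _; rewrite IHs.
congr (sum_over s G _); apply: functional_extensionality => l'.
by rewrite /recolor; case: eqP => [->|].
Qed.

(** The predicate [A] makes the induction go through: it collects the labels that have already been
    recoloured. *)
Lemma sum_over_free s (A : pred label) G h h' :
  (forall h h', (forall l, (l \in s) || A l -> h l = h' l) -> G h = G h') ->
  {in A, h =1 h'} -> sum_over s G h = sum_over s G h'.
Proof.
elim: s A h h' => [|l s IHs] A h h' /= G_free eqA; first exact: G_free.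
apply: eq_bigr => i _; apply: (IHs (fun k => (k == l) || A k)) => [g g' eq_g | k].
  by apply: G_free => k A_k; apply: eq_g; rewrite orbCA orbA -in_cons.
rewrite unfold_in /recolor; case: eqP => //= _; exact: eqA.
Qed.

Lemma sum_over_base s G h h' :
  (forall h h', {in s, h =1 h'} -> G h = G h') -> sum_over s G h = sum_over s G h'.
Proof.
move=> G_free; apply: (@sum_over_free s pred0) => // g g' eq_g.
by apply: G_free => l l_s; apply: eq_g; rewrite l_s.
Qed.

Lemma sum_over_map f s G h : injective f ->
  sum_over (map f s) (fun h => G (h \o f)) h = sum_over s G (h \o f).
Proof.
move=> injf; elim: s h => //= l s IHs h; apply: eq_bigr => i _; rewrite IHs.
congr (sum_over s G _); apply: functional_extensionality => l'.
by rewrite /recolor /= (inj_eq injf).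
Qed.

End SumOver.

Arguments sum_over : simpl never.

Lemma sum_over_nil (R : comPzRingType) (I : finZmodType) (G : (label -> I) -> R) h :
  sum_over [::] G h = G h.
Proof. by []. Qed.

Lemma sum_over_cons (R : comPzRingType) (I : finZmodType) l s (G : (label -> I) -> R) h :
  sum_over (l :: s) G h = \sum_i sum_over s G (recolor h l i).
Proof. by []. Qed.

(** * Oriented codes and their state sums *)

(* The booleans tell whether the strands a-c and b-d (or a-b, for a mark) are
   directed from the former to the latter. *)
Definition oriented_node : Type := node * (bool * bool).

(** The boolean of an end is [true] when its edge enters the vertex. A mark reads only the first of
    its two booleans. *)
Definition directed_ends (v : oriented_node) : seq (label * bool) :=
  let: (p, q) := v.2 in
  match v.1 with
  | Pt a b => [:: (a, p); (b, ~~ p)]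
  | Vi a b c d | Cl _ a b c d => [:: (a, p); (b, q); (c, ~~ p); (d, ~~ q)]
  end.

Definition direction (l : label) (e : label * bool) : int :=
  if e.1 == l then (if e.2 then 1 else -1) else 0.

(** When a label occurs twice, zero flux says that one end enters a vertex and the other leaves one.
    Being additive, the flux also makes sense for tangles. *)
Definition flux (D : seq oriented_node) (l : label) : int :=
  \sum_(v <- D) \sum_(e <- directed_ends v) direction l e.

Definition is_oriented (D : seq oriented_node) := forall l, flux D l = 0.

Section StateSum.
Variables (F : fieldType) (x : F) (I : finComNzRingType).

(** The skein relation of the bracket with each smoothing replaced by two Kronecker deltas; a closed
    loop then contributes its number of colours. *)
Definition crossing_weight (o : bool) (i j k l : I) : F :=
  (if o then x else x^-1) * ((i == l) && (j == k))%:R +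
  (if o then x^-1 else x) * ((i == j) && (k == l))%:R.

(* The shifts at the four ends form an Alexander numbering around the crossing, which
   is why only the smoothing against the orientation sees kappa. *)
Definition weight (kappa : I) (v : oriented_node) (h : label -> I) : F :=
  match v.1 with
  | Pt a b => (h a == h b)%:R
  | Vi a b c d => ((h a == h c) && (h b == h d))%:R
  | Cl o a b c d =>
      crossing_weight o (h a - kappa *+ v.2.2) (h b - kappa *+ ~~ v.2.1)
                        (h c - kappa *+ ~~ v.2.2) (h d - kappa *+ v.2.1)
  end.

Definition code_weight kappa (D : seq oriented_node) h : F :=
  \prod_(v <- D) weight kappa v h.

Definition state_sum kappa (D : seq oriented_node) : F :=
  sum_over (undup (labels (unzip1 D))) (code_weight kappa D) (fun=> 0).

Lemma code_weight_cat kappa L D h :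
  code_weight kappa (L ++ D) h = code_weight kappa L h * code_weight kappa D h.
Proof. exact: big_cat. Qed.

Lemma code_weight_cons kappa v D h :
  code_weight kappa (v :: D) h = weight kappa v h * code_weight kappa D h.
Proof. exact: big_cons. Qed.

Lemma labels_cat C D : labels (C ++ D) = labels C ++ labels D.
Proof. by rewrite /labels map_cat flatten_cat. Qed.

Lemma labels_cons v C : labels (v :: C) = ends v ++ labels C.
Proof. by []. Qed.

Lemma eq_code_weight kappa D h h' :
  {in labels (unzip1 D), h =1 h'} -> code_weight kappa D h = code_weight kappa D h'.
Proof.
elim: D => [|[v [p q]] D IHD]; first by rewrite /code_weight !big_nil.
rewrite /= labels_cons => eq_h; rewrite !code_weight_cons; congr (_ * _); last first.
  by apply: IHD => l l_D; apply: eq_h; rewrite mem_cat l_D orbT.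
by case: v eq_h => [a b | a b c d | o a b c d] eq_h;
  rewrite /weight /= !eq_h ?inE ?eqxx ?orbT.
Qed.

Lemma code_weight_ignores kappa D s :
  (forall l, l \in s -> l \notin labels (unzip1 D)) -> ignores s (code_weight kappa D).
Proof.
move=> s_D h l i /s_D l_D; apply: eq_code_weight => k k_D.
by rewrite /recolor; case: eqP => // eq_kl; rewrite -eq_kl k_D in l_D.
Qed.

Lemma state_sum_base kappa D h :
  state_sum kappa D = sum_over (undup (labels (unzip1 D))) (code_weight kappa D) h.
Proof.
apply: sum_over_base => h1 h2 eq_h; apply: eq_code_weight => l l_D.
by apply: eq_h; rewrite mem_undup.
Qed.

Lemma state_sum_perm kappa D D' : perm_eq D D' -> state_sum kappa D = state_sum kappa D'.
Proof.
move=> eqD; rewrite /state_sum (@sum_over_perm _ _ _ (undup (labels (unzip1 D')))).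
  by apply: eq_sum_over => h; apply: perm_big.
apply/perm_undup => l; have := perm_mem (perm_flatten (perm_map ends (perm_map fst eqD))) l.
by [].
Qed.

(** Labels interior to the replaced tangle are summed first, with everything else as a constant
    factor, so that an identity of open tangles implies one of diagrams. *)
Lemma state_sum_local kappa L L' D (xs xs' : seq label) u :
  uniq xs -> uniq xs' ->
  (forall l, l \in xs -> (l \in labels (unzip1 L)) && (l \notin labels (unzip1 D))) ->
  (forall l, l \in xs' -> (l \in labels (unzip1 L')) && (l \notin labels (unzip1 D))) ->
  (forall l, (l \notin xs) && ((l \in labels (unzip1 L)) || (l \in labels (unzip1 D)))
           = (l \notin xs') && ((l \in labels (unzip1 L')) || (l \in labels (unzip1 D)))) ->
  (forall h, sum_over xs (code_weight kappa L) h = u * sum_over xs' (code_weight kappa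
    L') h) ->
  state_sum kappa (L ++ D) = u * state_sum kappa (L' ++ D).
Proof.
move=> uxs uxs' xsP xs'P outer eqL.
pose ls (A : seq label) (M : seq oriented_node) := [seq l <- undup (labels (unzip1 (M ++
  D))) | l \notin A].
have in_ls A M l : (l \in ls A M) = (l \notin A) && ((l \in labels (unzip1 M)) || (l \in
  labels (unzip1 D))).
  by rewrite mem_filter mem_undup /unzip1 map_cat labels_cat mem_cat.
have Z_ls A M : uniq A ->
    (forall l, l \in A -> (l \in labels (unzip1 M)) && (l \notin labels (unzip1 D))) ->
    state_sum kappa (M ++ D) =
    sum_over (ls A M) (fun h => code_weight kappa D h * sum_over A (code_weight kappa M)
      h) (fun=> 0).
  move=> uA AP; rewrite /state_sum (@sum_over_perm _ _ _ (ls A M ++ A)).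
    rewrite sum_over_cat; apply: eq_sum_over => h; rewrite -sum_over_factor.
      by apply: eq_sum_over => h'; rewrite code_weight_cat mulrC.
    by apply: code_weight_ignores => l /AP/andP[].
  apply: uniq_perm; rewrite ?undup_uniq ?cat_uniq ?filter_uniq ?undup_uniq ?uA //= ?andbT.
    by apply/hasPn=> l l_A; rewrite in_ls l_A.
  move=> l; rewrite mem_cat in_ls mem_undup /unzip1 map_cat labels_cat mem_cat -!/unzip1.
  by case: (boolP (l \in A)) => [/AP/andP[-> _] | _]; rewrite /= ?orbF.
rewrite (Z_ls xs L uxs xsP) (Z_ls xs' L' uxs' xs'P) -sum_overZ.
rewrite (@sum_over_perm _ _ _ (ls xs' L')); last first.
  by apply: uniq_perm; rewrite ?filter_uniq ?undup_uniq // => l; rewrite !in_ls outer.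
by apply: eq_sum_over => h; rewrite eqL mulrCA.
Qed.

End StateSum.

(** * Local identities behind the Reidemeister moves *)

Section Tensors.
Variables (F : fieldType) (x : F) (I : finComNzRingType).
Hypotheses (x_neq0 : x != 0) (loop_value : #|I|%:R = - x ^+ 2 - x ^- 2 :> F).
Local Notation cw := (@crossing_weight F x I).

(** Only differences of colours matter at a crossing. All the gauge changes below rest on this. *)
Lemma crossing_weightB t o i j k l : cw o (i - t) (j - t) (k - t) (l - t) = cw o i j k l.
Proof. by rewrite /crossing_weight !(inj_eq (@subIr I t)). Qed.

Lemma sum_delta1 (P : I -> bool) b i0 :
  (forall i, P i = b && (i == i0)) -> \sum_i (P i)%:R = b%:R :> F.
Proof.
move=> P_eq; rewrite (bigD1 i0) //= P_eq eqxx andbT big1 ?addr0 // => i neq_i.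
by rewrite P_eq (negbTE neq_i) andbF.
Qed.

Lemma sum_delta2 (P : I -> I -> bool) b i0 j0 :
  (forall i j, P i j = [&& b, i == i0 & j == j0]) ->
  \sum_i \sum_j (P i j)%:R = b%:R :> F.
Proof.
move=> P_eq; rewrite -(@sum_delta1 (fun i => b && (i == i0)) b i0) //.
by apply: eq_bigr => i _; apply: (@sum_delta1 _ _ j0) => j; rewrite P_eq andbA.
Qed.

Lemma sum_delta3 (P : I -> I -> I -> bool) b i0 j0 k0 :
  (forall i j k, P i j k = [&& b, i == i0, j == j0 & k == k0]) ->
  \sum_i \sum_j \sum_k (P i j k)%:R = b%:R :> F.
Proof.
move=> P_eq; rewrite -(@sum_delta1 (fun i => b && (i == i0)) b i0) //.
apply: eq_bigr => i _; apply: (@sum_delta2 _ _ j0 k0) => j k.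
by rewrite P_eq andbA.
Qed.

Lemma sum_const (b : bool) : \sum_(i : I) b%:R = #|I|%:R * b%:R :> F.
Proof. by rewrite sumr_const mulr_natl. Qed.

Lemma sum_loop2 (P : I -> I -> bool) b :
  (forall i j, P i j = b && (j == i)) -> \sum_i \sum_j (P i j)%:R = #|I|%:R * b%:R :> F.
Proof.
move=> P_eq; rewrite -sum_const; apply: eq_bigr => i _.
exact: (@sum_delta1 _ _ i).
Qed.

Lemma sum_loop3 (P : I -> I -> I -> bool) b :
  (forall i j k, P i j k = [&& b, j == i & k == i]) ->
  \sum_i \sum_j \sum_k (P i j k)%:R = #|I|%:R * b%:R :> F.
Proof.
move=> P_eq; rewrite -sum_const; apply: eq_bigr => i _.
exact: (@sum_delta2 _ _ i i).
Qed.

Ltac split_eqs :=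
  let H := fresh in
  apply/idP/idP; move=> H;
  repeat match goal with
  | H : is_true (_ && _) |- _ => let H1 := fresh in let H2 := fresh in case/andP: H => H1 H2
  | H : is_true (?a == ?a) |- _ => clear H
  | H : is_true (?a == ?b) |- _ => move/eqP in H; subst
  end; rewrite ?eqxx //.

Lemma kink_tensor o i j :
  \sum_k cw o i k k j = (if o then - x ^+ 3 else - x ^- 3) * (i == j)%:R.
Proof.
rewrite big_split /= -!big_distrr /=.
under eq_bigr do rewrite eqxx andbT; rewrite sum_const.
rewrite (@sum_delta1 _ (i == j) i) => [|k]; last by split_eqs.
by rewrite loop_value; case: o; field.
Qed.

(** Of the four states, one joins the ends as required with coefficient 1; the other three join them
    alike, with total coefficient [x ^+ 2 + x ^- 2 + #|I|], which vanishes. *)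
Lemma bigon_tensor o a b c d :
  \sum_i \sum_j cw o a b i j * cw (~~ o) j i c d = ((a == d) && (b == c))%:R.
Proof.
pose A o : F := if o then x else x^-1; pose B o : F := if o then x^-1 else x.
transitivity (\sum_i \sum_j (A o * B o * [&& a == j, b == i, j == d & i == c]%:R +
   A o * A o * [&& a == j, b == i, j == i & c == d]%:R +
   B o * B o * [&& a == b, i == j, j == d & i == c]%:R +
   A o * B o * [&& a == b, i == j, j == i & c == d]%:R)).
  apply: eq_bigr => i _; apply: eq_bigr => j _.
  by rewrite /crossing_weight /A /B -!mulnb !natrM; case: o => /=; ring.
under eq_bigr do rewrite !big_split -!big_distrr /=.
rewrite !big_split -!big_distrr /=.
rewrite (@sum_delta2 _ ((a == d) && (b == c)) b a); last by move=> i j; split_eqs.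
rewrite (@sum_delta2 _ ((a == b) && (c == d)) b a); last by move=> i j; split_eqs.
rewrite (@sum_delta2 _ ((a == b) && (c == d)) d d); last by move=> i j; split_eqs.
rewrite (@sum_loop2 _ ((a == b) && (c == d))); last by move=> i j; split_eqs.
by rewrite loop_value /A /B; case: o; field.
Qed.

Lemma triangle_tensor o12 o13 o23 a1 a2 a3 b1 b2 b3 : (o12 == o23) ==> (o13 == o12) ->
  \sum_i \sum_j \sum_k cw o12 a1 a2 i j * cw o13 i a3 b3 k * cw o23 j k b2 b1 =
  \sum_i \sum_j \sum_k cw o23 a2 a3 i j * cw o13 a1 j k b1 * cw o12 k i b3 b2.
Proof.
move=> o_order.
pose A o : F := if o then x else x^-1; pose B o : F := if o then x^-1 else x.
pose M1 : F := [&& a1 == b1, a2 == b2 & a3 == b3]%:R.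
pose M2 : F := [&& a1 == a2, a3 == b3 & b1 == b2]%:R.
pose M3 : F := [&& a2 == a3, b2 == b3 & a1 == b1]%:R.
pose M4 : F := [&& a2 == a3, a1 == b3 & b1 == b2]%:R.
pose M5 : F := [&& a1 == a2, a3 == b1 & b2 == b3]%:R.
(* Total coefficient of the four states that join the ends as in [M2] before the move; after the
   move it is the coefficient of [M3]. *)
pose N := A o12 * A o13 * B o23 + B o12 * A o13 * A o23 + #|I|%:R * (B o12 * A o13 * B o23)
          + B o12 * B o13 * B o23.
transitivity (A o12 * A o13 * A o23 * M1 + N * M2 + A o12 * B o13 * A o23 * M3
  + A o12 * B o13 * B o23 * M4 + B o12 * B o13 * A o23 * M5); last symmetry.
- transitivity (\sum_i \sum_j \sum_k (
    A o12 * A o13 * A o23 * [&& a1 == j, a2 == i, i == k, a3 == b3, j == b1 & k == b2]%:R +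
    A o12 * A o13 * B o23 * [&& a1 == j, a2 == i, i == k, a3 == b3, j == k & b2 == b1]%:R +
    A o12 * B o13 * A o23 * [&& a1 == j, a2 == i, i == a3, b3 == k, j == b1 & k == b2]%:R +
    A o12 * B o13 * B o23 * [&& a1 == j, a2 == i, i == a3, b3 == k, j == k & b2 == b1]%:R +
    B o12 * A o13 * A o23 * [&& a1 == a2, i == j, i == k, a3 == b3, j == b1 & k == b2]%:R +
    B o12 * A o13 * B o23 * [&& a1 == a2, i == j, i == k, a3 == b3, j == k & b2 == b1]%:R +
    B o12 * B o13 * A o23 * [&& a1 == a2, i == j, i == a3, b3 == k, j == b1 & k == b2]%:R +
    B o12 * B o13 * B o23 * [&& a1 == a2, i == j, i == a3, b3 == k, j == k & b2 == b1]%:R)).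
    do 3![apply: eq_bigr => ? _]; rewrite /crossing_weight -/(A o12) -/(A o13) -/(A o23).
    by rewrite -/(B o12) -/(B o13) -/(B o23) -!mulnb !natrM; ring.
  under eq_bigr do [under eq_bigr do rewrite !big_split -!big_distrr /=;
    rewrite !big_split -!big_distrr /=].
  rewrite !big_split -!big_distrr /=.
  rewrite (@sum_delta3 _ [&& a1 == b1, a2 == b2 & a3 == b3] a2 a1 a2);
    last by move=> i j k; split_eqs.
  rewrite (@sum_delta3 _ [&& a1 == a2, a3 == b3 & b1 == b2] a2 a1 a2);
    last by move=> i j k; split_eqs.
  rewrite (@sum_delta3 _ [&& a2 == a3, b2 == b3 & a1 == b1] a2 a1 b3);
    last by move=> i j k; split_eqs.
  rewrite (@sum_delta3 _ [&& a2 == a3, a1 == b3 & b1 == b2] a2 a1 b3);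
    last by move=> i j k; split_eqs.
  rewrite (@sum_delta3 _ [&& a1 == a2, a3 == b3 & b1 == b2] b1 b1 b1);
    last by move=> i j k; split_eqs.
  rewrite (@sum_loop3 _ [&& a1 == a2, a3 == b3 & b1 == b2]); last by move=> i j k;
    split_eqs.
  rewrite (@sum_delta3 _ [&& a1 == a2, a3 == b1 & b2 == b3] a3 a3 b3);
    last by move=> i j k; split_eqs.
  rewrite (@sum_delta3 _ [&& a1 == a2, a3 == b3 & b1 == b2] a3 a3 b3);
    last by move=> i j k; split_eqs.
  by rewrite -/M1 -/M2 -/M3 -/M4 -/M5 /N; ring.
transitivity (\sum_i \sum_j \sum_k (
    A o23 * A o13 * A o12 * [&& a2 == j, a3 == i, a1 == b1, j == k, k == b2 & i == b3]%:R +
    A o23 * A o13 * B o12 * [&& a2 == j, a3 == i, a1 == b1, j == k, k == i & b3 == b2]%:R +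
    A o23 * B o13 * A o12 * [&& a2 == j, a3 == i, a1 == j, k == b1, k == b2 & i == b3]%:R +
    A o23 * B o13 * B o12 * [&& a2 == j, a3 == i, a1 == j, k == b1, k == i & b3 == b2]%:R +
    B o23 * A o13 * A o12 * [&& a2 == a3, i == j, a1 == b1, j == k, k == b2 & i == b3]%:R +
    B o23 * A o13 * B o12 * [&& a2 == a3, i == j, a1 == b1, j == k, k == i & b3 == b2]%:R +
    B o23 * B o13 * A o12 * [&& a2 == a3, i == j, a1 == j, k == b1, k == b2 & i == b3]%:R +
    B o23 * B o13 * B o12 * [&& a2 == a3, i == j, a1 == j, k == b1, k == i & b3 == b2]%:R)).
  do 3![apply: eq_bigr => ? _]; rewrite /crossing_weight -/(A o12) -/(A o13) -/(A o23).
  by rewrite -/(B o12) -/(B o13) -/(B o23) -!mulnb !natrM; ring.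
under eq_bigr do [under eq_bigr do rewrite !big_split -!big_distrr /=;
  rewrite !big_split -!big_distrr /=].
rewrite !big_split -!big_distrr /=.
rewrite (@sum_delta3 _ [&& a1 == b1, a2 == b2 & a3 == b3] a3 a2 a2);
  last by move=> i j k; split_eqs.
rewrite (@sum_delta3 _ [&& a2 == a3, b2 == b3 & a1 == b1] a3 a2 a2);
  last by move=> i j k; split_eqs.
rewrite (@sum_delta3 _ [&& a1 == a2, a3 == b3 & b1 == b2] a3 a2 b1);
  last by move=> i j k; split_eqs.
rewrite (@sum_delta3 _ [&& a1 == a2, a3 == b1 & b2 == b3] a3 a2 b1);
  last by move=> i j k; split_eqs.
rewrite (@sum_delta3 _ [&& a2 == a3, b2 == b3 & a1 == b1] b2 b2 b2);
  last by move=> i j k; split_eqs.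
rewrite (@sum_loop3 _ [&& a2 == a3, b2 == b3 & a1 == b1]); last by move=> i j k; split_eqs.
rewrite (@sum_delta3 _ [&& a2 == a3, a1 == b3 & b1 == b2] a1 a1 b1);
  last by move=> i j k; split_eqs.
rewrite (@sum_delta3 _ [&& a2 == a3, b2 == b3 & a1 == b1] a1 a1 b1);
  last by move=> i j k; split_eqs.
rewrite -/M1 -/M2 -/M3 -/M4 -/M5 /N.
(* The two expansions differ only by exchanging [N] and this monomial on [M2] and [M3]. Their
   equality uses both the loop value and the exclusion of cyclic over/under choices. *)
have N_eq : A o12 * B o13 * A o23 = N.
  rewrite /N loop_value /A /B; move: o_order; clear N A B M1 M2 M3 M4 M5.
  by case: o12; case: o13; case: o23 => // _; field.
apply: subr0_eq; transitivity ((N - A o12 * B o13 * A o23) * (M3 - M2)).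
  by rewrite /N; ring.
by rewrite N_eq subrr mul0r.
Qed.

(* An Alexander numbering of the triangle, the same at its six ends before and after
   the move, reduces this to the untwisted identity. *)
Lemma twisted_triangle_tensor (kappa : I) (p1 p2 p3 : bool) o12 o13 o23 a1 a2 a3 b1 b2 b3 :
  (o12 == o23) ==> (o13 == o12) ->
  let tw i (b : bool) := i - kappa *+ b in
  \sum_i \sum_j \sum_k cw o12 (tw a1 p2) (tw a2 (~~ p1)) (tw i (~~ p2)) (tw j p1)
                     * cw o13 (tw i p3) (tw a3 (~~ p1)) (tw b3 (~~ p3)) (tw k p1)
                     * cw o23 (tw j p3) (tw k (~~ p2)) (tw b2 (~~ p3)) (tw b1 p2) =
  \sum_i \sum_j \sum_k cw o23 (tw a2 p3) (tw a3 (~~ p2)) (tw i (~~ p3)) (tw j p2)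
                     * cw o13 (tw a1 p3) (tw j (~~ p1)) (tw k (~~ p3)) (tw b1 p1)
                     * cw o12 (tw k p2) (tw i (~~ p1)) (tw b3 (~~ p2)) (tw b2 p1).
Proof.
move=> o_order tw; rewrite /tw {tw}.
have reindex3 (G : I -> I -> I -> F) i0 j0 k0 :
    \sum_i \sum_j \sum_k G i j k = \sum_i \sum_j \sum_k G (i + i0) (j + j0) (k + k0).
  rewrite (reindex_inj (addIr i0)); apply: eq_bigr => i _.
  rewrite (reindex_inj (addIr j0)); apply: eq_bigr => j _.
  by rewrite (reindex_inj (addIr k0)).
(* The identities hold for any function [K] of a boolean; as an opaque function it is an atom for
   [ring]. *)
have [K KE] : exists K : bool -> I, forall b : bool, kappa *+ b = K b.
  by exists (fun b => kappa *+ b).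
rewrite !KE.
(* Translations of the second and third crossings that make the shifts agree at both ends of each
   inner edge. *)
pose t2 := K (~~ p2) - K p3; pose t3 := K p1 - K p3.
have := triangle_tensor (a1 - K p2) (a2 - K (~~ p1)) (a3 - K (~~ p1) - t2)
  (b1 - K p2 - t3) (b2 - K (~~ p3) - t3) (b3 - K (~~ p3) - t2) o_order.
congr (_ = _); apply/esym.
  apply: (etrans (reindex3 _ (K (~~ p2)) (K p1) (t2 + K p1))).
  do 3![apply: eq_bigr => ? _]; congr (_ * _ * _).
  - by congr cw; ring.
  - by rewrite -[RHS](crossing_weightB (- t2)); congr cw; rewrite /t2; ring.
  by rewrite -[RHS](crossing_weightB (- t3)); congr cw; rewrite /t3 /t2; ring.
(* Here all three crossings are translated, so that the shifts at the six outer ends are those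
   obtained before the move. *)
pose s1 := K (~~ p1) - K p3; pose s2 := K p2 - K p3; pose s3 := K (~~ p3) - K p3.
apply: (etrans (reindex3 _ (s1 + K (~~ p3)) (s1 + K p2) (s2 + K (~~ p3)))).
do 3![apply: eq_bigr => ? _]; congr (_ * _ * _).
- by rewrite -[RHS](crossing_weightB (- s1)); congr cw; rewrite /s1 /t2; ring.
- by rewrite -[RHS](crossing_weightB (- s2)); congr cw; rewrite /s1 /s2 /t3; ring.
by rewrite -[RHS](crossing_weightB (- s3)); congr cw; rewrite /s1 /s2 /s3 /t2 /t3; ring.
Qed.

End Tensors.

(** * Invariance of the state sums *)

Lemma flux_cat D D' l : flux (D ++ D') l = flux D l + flux D' l.
Proof. exact: big_cat. Qed.

Lemma flux_cons v D l :
  flux (v :: D) l = \sum_(e <- directed_ends v) direction l e + flux D l.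
Proof. exact: big_cons. Qed.

Lemma directed_endsE v : unzip1 (directed_ends v) = ends v.1.
Proof. by case: v => [[a b | a b c d | o a b c d] [p q]]. Qed.

Lemma flux_notin D l : l \notin labels (unzip1 D) -> flux D l = 0.
Proof.
elim: D => [|v D IHD]; first by rewrite /flux big_nil.
rewrite /= labels_cons mem_cat negb_or => /andP[l_v /IHD l_D].
rewrite flux_cons {}l_D addr0 big1_seq // => e /andP[_ e_v].
rewrite /direction; case: eqP => // eq_l; case/negP: l_v.
by rewrite -eq_l -directed_endsE map_f.
Qed.

Section Moves.
Variables (F : fieldType) (x : F) (I : finComNzRingType).
Hypotheses (x_neq0 : x != 0) (loop_eq : #|I|%:R = - x ^+ 2 - x ^- 2 :> F).
Local Notation Z := (@state_sum F x I).

(* The unit [u] does not depend on [kappa], so that the comparison of the twisted and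
   untwisted sums is transported. *)
Definition transports (C C' : code) := forall D, unzip1 D = C -> is_oriented D ->
  exists D', [/\ unzip1 D' = C', is_oriented D' &
    exists2 u, u != 0 & forall kappa, Z kappa D' = u * Z kappa D].

Lemma transports_refl C : transports C C.
Proof. by move=> D <- D_or; exists D; split=> //; exists 1; rewrite ?oner_neq0 // => k;
  rewrite mul1r. Qed.

Lemma transports_trans C1 C2 C3 :
  transports C1 C2 -> transports C2 C3 -> transports C1 C3.
Proof.
move=> t12 t23 D D1 D_or; have [D' [D2 D'_or [u u0 Zu]]] := t12 D D1 D_or.
have [D'' [D3 D''_or [u' u'0 Zu']]] := t23 D' D2 D'_or.
exists D''; split=> //; exists (u' * u); first by rewrite mulf_neq0.
by move=> k; rewrite Zu' Zu mulrA.
Qed.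

Definition interchangeable C C' := transports C C' /\ transports C' C.

Lemma interchangeable_sym C C' : interchangeable C C' -> interchangeable C' C.
Proof. by case. Qed.

Lemma interchangeable_trans C1 C2 C3 :
  interchangeable C1 C2 -> interchangeable C2 C3 -> interchangeable C1 C3.
Proof.
by move=> [t12 t21] [t23 t32]; split;
  [apply: transports_trans t23 | apply: transports_trans t21].
Qed.

Definition inner (xs : seq label) (L C : code) :=
  uniq xs && all (fun l => (l \in labels L) && (l \notin labels C)) xs.

Definition same_outer (xs : seq label) L (xs' : seq label) L' (C : code) := forall l,
  (l \notin xs) && ((l \in labels L) || (l \in labels C)) =
  (l \notin xs') && ((l \in labels L') || (l \in labels C)).

(** Only the inner labels are assumed coherently oriented. Preserving the flux at every label keeps
    any orientation of the rest of the diagram coherent. *)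
Definition rewrites (xs : seq label) L (xs' : seq label) L' := forall M,
  unzip1 M = L -> (forall l, l \in xs -> flux M l = 0) ->
  exists M', [/\ unzip1 M' = L', flux M' =1 flux M & exists2 u, u != 0 & forall kappa h,
    sum_over xs' (code_weight x kappa M' : (label -> I) -> F) h =
    u * sum_over xs (code_weight x kappa M) h].

Lemma local_transports xs L xs' L' C :
  inner xs L C -> inner xs' L' C -> same_outer xs L xs' L' C ->
  rewrites xs L xs' L' -> transports (L ++ C) (L' ++ C).
Proof.
move=> /andP[uxs /allP xs_in] /andP[uxs' /allP xs'_in] outer LL' D defD D_or.
pose M := take (size L) D; pose N := drop (size L) D.
have defL : unzip1 M = L by rewrite /M /unzip1 map_take -/(unzip1 D) defD take_size_cat.
have defC : unzip1 N = C by rewrite /N /unzip1 map_drop -/(unzip1 D) defD drop_size_cat.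
have defMN : D = M ++ N by rewrite cat_take_drop.
rewrite {}defMN {defD} in D_or *.
have [l l_xs|M' [defL' fluxM [u u0 Zu]]] := LL' M defL.
  have := D_or l; rewrite flux_cat [X in _ + X]flux_notin ?addr0 // defC.
  by case/andP: (xs_in l l_xs).
exists (M' ++ N); split.
- by rewrite /unzip1 map_cat -!/unzip1 defL' defC.
- by move=> l; rewrite flux_cat fluxM -flux_cat D_or.
exists u => // kappa; apply: (@state_sum_local _ _ _ _ _ _ _ xs' xs) => //;
  rewrite ?defL ?defL' ?defC //.
Qed.

Lemma local_interchangeable xs L xs' L' C :
  inner xs L C -> inner xs' L' C -> same_outer xs L xs' L' C ->
  rewrites xs L xs' L' -> rewrites xs' L' xs L -> interchangeable (L ++ C) (L' ++ C).
Proof.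
move=> L_in L'_in outer LL' L'L; split; first exact: local_transports LL'.
by apply: local_transports L'L => // l; rewrite outer.
Qed.

End Moves.

Lemma closed_twice C l s : closed_code C -> perm_eq (labels C) [:: l, l & s] -> l \notin s.
Proof.
move=> C_closed eqC; have l_C : l \in labels C by rewrite (perm_mem eqC) mem_head.
have := closed_count C_closed l_C; rewrite (permP eqC) /= eqxx => -[].
by move/count_memPn.
Qed.

Lemma unzip1_singleton (M : seq oriented_node) v :
  unzip1 M = [:: v] -> exists s, M = [:: (v, s)].
Proof. by case: M => [|[w s] [|? ?]] //= [->]; exists s. Qed.

Lemma unzip1_pair (M : seq oriented_node) v w :
  unzip1 M = [:: v; w] -> exists s t, M = [:: (v, s); (w, t)].
Proof. by case: M => [|[v' s] [|[w' t] [|? ?]]] //= [-> ->]; exists s, t. Qed.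

Lemma unzip1_triple (M : seq oriented_node) u v w :
  unzip1 M = [:: u; v; w] -> exists r s t, M = [:: (u, r); (v, s); (w, t)].
Proof.
by case: M => [|[u' r] [|[v' s] [|[w' t] [|? ?]]]] //= [-> -> ->]; exists r, s, t.
Qed.

Definition fluxE := (flux_cons, big_cons, big_nil, addr0, addr0).

Lemma flux_nil l : flux [::] l = 0.
Proof. by rewrite /flux big_nil. Qed.

Lemma direction_opp l k b : direction l (k, ~~ b) = - direction l (k, b).
Proof. by rewrite /direction /=; case: ifP => _; rewrite ?oppr0 //; case: b;
  rewrite ?opprK. Qed.

Lemma recolor_same (I : finComNzRingType) (h : label -> I) l i : recolor h l i l = i.
Proof. by rewrite /recolor eqxx. Qed.

Lemma recolor_neq (I : finComNzRingType) (h : label -> I) l i k : k != l -> recolor h l i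
  k = h k.
Proof. by rewrite /recolor => /negbTE->. Qed.

Ltac perm_labels := let P := fresh in apply/permP => P; rewrite /=; ring.

Section Moves.
Variables (F : fieldType) (x : F) (I : finComNzRingType).
Hypotheses (x_neq0 : x != 0) (loop_eq : #|I|%:R = - x ^+ 2 - x ^- 2 :> F).
Local Notation Z := (@state_sum F x I).
Local Notation interchangeable := (@interchangeable F x I).
Local Notation rewrites := (@rewrites F x I).

Lemma code_weight1 kappa v (h : label -> I) : code_weight x kappa [:: v] h = weight x
  kappa v h.
Proof. by rewrite /code_weight big_seq1. Qed.

Lemma code_weight2 kappa v w (h : label -> I) :
  code_weight x kappa [:: v; w] h = weight x kappa v h * weight x kappa w h.
Proof. by rewrite code_weight_cons code_weight1. Qed.

Lemma code_weight3 kappa u v w (h : label -> I) :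
  code_weight x kappa [:: u; v; w] h =
  weight x kappa u h * weight x kappa v h * weight x kappa w h.
Proof. by rewrite code_weight_cons code_weight2 mulrA. Qed.

Definition kink_factor (o : bool) : F := if o then - x ^+ 3 else - x ^- 3.

Lemma kink_factor_neq0 o : kink_factor o != 0.
Proof. by case: o; rewrite oppr_eq0 ?invr_eq0 expf_neq0. Qed.

(** With equal booleans the two ends of the inner edge carry the same shift, and so do [a] and [b];
    translating the inner colour reduces to [kink_tensor]. The resulting unit is free of [kappa]. *)
Lemma kink_weight o a b y kappa p p' (h : label -> I) : a != y -> b != y ->
  sum_over [:: y] (code_weight x kappa [:: (Cl o a y y b, (p, p))]) h =
  kink_factor o * code_weight x kappa [:: (Pt a b, p')] h.
Proof.
move=> ay byy; rewrite code_weight1 /weight /= sum_over_cons.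
under eq_bigr do rewrite sum_over_nil code_weight1 /weight /= !recolor_same !recolor_neq //.
rewrite -(inj_eq (@subIr I (kappa *+ p))) -(kink_tensor x_neq0 loop_eq).
by rewrite [RHS](reindex_inj (@subIr I (kappa *+ ~~ p))).
Qed.

Lemma reidemeister1_interchangeable o a b y C : closed_code (Cl o a y y b :: C) ->
  interchangeable (Cl o a y y b :: C) (Pt a b :: C).
Proof.
move=> D_closed.
have : y \notin [:: a, b & labels C] by apply: closed_twice D_closed _; perm_labels.
rewrite !inE !negb_or ![y == _]eq_sym => /and3P[ay byy yC].
apply: (@local_interchangeable _ _ _ [:: y] [:: Cl o a y y b] [::] [:: Pt a b]).
- by rewrite /inner /= !inE eqxx yC orbT.
- by [].
- move=> l; rewrite !inE; case: (eqVneq l y) => [->|_] /=.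
    by rewrite eq_sym (negbTE ay) eq_sym (negbTE byy) (negbTE yC).
  by [].
- move=> M /unzip1_singleton[[p q] ->] flux_y; move: {flux_y}(flux_y y (mem_head y [::])).
  rewrite !fluxE flux_nil !direction_opp /direction /= eqxx (negbTE ay) (negbTE byy) => pq.
  have {}pq : p = q by case: p q pq => [] [].
  rewrite -{}pq; exists [:: (Pt a b, (p, p))]; split=> [// | l |].
    by rewrite !fluxE flux_nil !direction_opp; ring.
  exists (kink_factor o)^-1; first by rewrite invr_eq0 kink_factor_neq0.
  by move=> kappa h; rewrite (kink_weight _ _ _ (p,
    p)) // mulrA mulVf ?mul1r ?kink_factor_neq0.
move=> M /unzip1_singleton[[p q] ->] _; exists [:: (Cl o a y y b, (p, p))];
  split=> [// | l |].
  by rewrite !fluxE flux_nil !direction_opp; ring.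
by exists (kink_factor o); [exact: kink_factor_neq0 | move=> kappa h; apply: kink_weight].
Qed.

(** The shifts at an inner edge agree at the two crossings, as do those at [a] and [d] and at [b]
    and [c], so [kappa] is absorbed whatever the directions of the strands. *)
Lemma bigon_weight o a b c d y z kappa p q r r' (h : label -> I) :
  uniq [:: y; z] -> all (fun l => l \notin [:: y; z]) [:: a; b; c; d] ->
  sum_over [:: y; z]
    (code_weight x kappa [:: (Cl o a b y z, (p, q)); (Cl (~~ o) z y c d, (q, p))]) h =
  code_weight x kappa [:: (Pt a d, r); (Pt b c, r')] h.
Proof.
rewrite /= !inE !negb_or andbT =>
  yz /and5P[/andP[ay az] /andP[by' bz] /andP[cy cz] /andP[dy dz] _].
rewrite code_weight2 /weight /= sum_over_cons.
under eq_bigr => i _ do [rewrite sum_over_cons; under eq_bigr => j _ do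
  rewrite sum_over_nil code_weight2 /weight /= !recolor_same !(recolor_neq _ _ yz)
    !recolor_same !recolor_neq //].
rewrite -(inj_eq (@subIr I (kappa *+ q)) (h a)) -[h b == _](inj_eq (@subIr I (kappa *+ ~~
  p))).
rewrite -natrM mulnb -(bigon_tensor x_neq0 loop_eq o).
rewrite [RHS](reindex_inj (@subIr I (kappa *+ ~~ q))); apply: eq_bigr => i _.
by rewrite [RHS](reindex_inj (@subIr I (kappa *+ p))).
Qed.

Lemma reidemeister2_interchangeable o a b c d y z C :
  closed_code [:: Cl o a b y z, Cl (~~ o) z y c d & C] ->
  interchangeable [:: Cl o a b y z, Cl (~~ o) z y c d & C] [:: Pt a d, Pt b c & C].
Proof.
move=> D_closed.
have : y \notin [:: a, b, c, d, z, z & labels C] by apply: closed_twice D_closed _;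
  perm_labels.
rewrite !inE !negb_or ![y == _]eq_sym => /and5P[ay by' cy dy /and3P[zy _ yC]].
have : z \notin [:: a, b, c, d, y, y & labels C] by apply: closed_twice D_closed _;
  perm_labels.
rewrite !inE !negb_or ![z == _]eq_sym => /and5P[az bz cz dz /and3P[yz _ zC]].
have yz_uniq : uniq [:: y; z] by rewrite /= inE yz.
have outer : all (fun l => l \notin [:: y; z]) [:: a; b; c; d].
  by rewrite /= !inE !negb_or ay az by' bz cy cz dy dz.
have fluxM p q r s l : flux [:: (Pt a d, (p, r)); (Pt b c, (q, s))] l =
    flux [:: (Cl o a b y z, (p, q)); (Cl (~~ o) z y c d, (q, p))] l.
  by rewrite !fluxE flux_nil !direction_opp; ring.
apply: (@local_interchangeable _ _ _ [:: y; z] [:: Cl o a b y z; Cl (~~ o) z y c d]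
   [::] [:: Pt a d; Pt b c]).
- by rewrite /inner yz_uniq /= !inE !eqxx yC zC !orbT.
- by [].
- move=> l; rewrite !inE; case: (eqVneq l y) => [->|_] /=.
    by rewrite ![y == _]eq_sym (negbTE ay) (negbTE by') (negbTE cy) (negbTE dy) (negbTE yC).
  case: (eqVneq l z) => [->|_] /=.
    by rewrite ![z == _]eq_sym (negbTE az) (negbTE bz) (negbTE cz) (negbTE dz) (negbTE zC).
  by case: (l == a); case: (l == b); case: (l == c); case: (l == d).
- move=> M /unzip1_pair[[p q] [[q' p'] ->]] flux0.
  have pp' : p' = p.
    move: {flux0}(flux0 y (mem_head _ _));
      rewrite !fluxE flux_nil !direction_opp /direction /=.
    rewrite eqxx (negbTE zy) (negbTE ay) (negbTE by') (negbTE cy) (negbTE dy).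
    by case: p p' => [] [].
  have qq' : q' = q.
    move: {flux0}(flux0 z (mem_last y [:: z]));
      rewrite !fluxE flux_nil !direction_opp /direction /=.
    rewrite eqxx (negbTE yz) (negbTE az) (negbTE bz) (negbTE cz) (negbTE dz).
    by case: q q' => [] [].
  rewrite pp' qq'; exists [:: (Pt a d, (p, p)); (Pt b c, (q, q))]; split=> //.
  exists 1 => [|kappa h]; first exact: oner_neq0.
  by rewrite mul1r (@bigon_weight _ _ _ _ _ _ _ _ _ _ (p, p) (q, q)) // sum_over_nil.
move=> M /unzip1_pair[[p r] [[q s] ->]] _.
exists [:: (Cl o a b y z, (p, q)); (Cl (~~ o) z y c d, (q, p))]; split=> //.
exists 1 => [|kappa h]; first exact: oner_neq0.
by rewrite mul1r (@bigon_weight _ _ _ _ _ _ _ _ _ _ (p, r) (q, s)) // sum_over_nil.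
Qed.

Section Triangle.
Variables (o12 o13 o23 : bool) (a1 a2 a3 b1 b2 b3 u v w : label).
Hypotheses (o_order : (o12 == o23) ==> (o13 == o12)) (uvw_uniq : uniq [:: u; v; w])
  (outer : all (fun l => l \notin [:: u; v; w]) [:: a1; a2; a3; b1; b2; b3]).

Definition triangle_before p1 p2 p3 : seq oriented_node :=
  [:: (Cl o12 a1 a2 u v, (p1, p2)); (Cl o13 u a3 b3 w, (p1, p3));
    (Cl o23 v w b2 b1, (p2, p3))].

Definition triangle_after p1 p2 p3 : seq oriented_node :=
  [:: (Cl o23 a2 a3 u v, (p2, p3)); (Cl o13 a1 v w b1, (p1, p3));
    (Cl o12 w u b3 b2, (p1, p2))].

Lemma triangle_weight kappa p1 p2 p3 (h : label -> I) :
  sum_over [:: u; v; w] (code_weight x kappa (triangle_before p1 p2 p3)) h =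
  sum_over [:: u; v; w] (code_weight x kappa (triangle_after p1 p2 p3)) h.
Proof.
have /and4P[uv uw vw _] : [&& u != v, u != w, v != w & true].
  by move: uvw_uniq; rewrite /= !inE !negb_or andbT => /andP[/andP[-> ->] ->].
have ne l : l \in [:: a1; a2; a3; b1; b2; b3] -> [/\ l != u, l != v & l != w].
  by move/(allP outer); rewrite !inE !negb_or => /and3P.
have [a1u a1v a1w] := ne a1 (mem_head _ _).
have [a2u a2v a2w] : [/\ a2 != u, a2 != v & a2 != w] by apply: ne; rewrite !inE eqxx !orbT.
have [a3u a3v a3w] : [/\ a3 != u, a3 != v & a3 != w] by apply: ne; rewrite !inE eqxx !orbT.
have [b1u b1v b1w] : [/\ b1 != u, b1 != v & b1 != w] by apply: ne; rewrite !inE eqxx !orbT.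
have [b2u b2v b2w] : [/\ b2 != u, b2 != v & b2 != w] by apply: ne; rewrite !inE eqxx !orbT.
have [b3u b3v b3w] : [/\ b3 != u, b3 != v & b3 != w] by apply: ne; rewrite !inE eqxx !orbT.
have := twisted_triangle_tensor x_neq0 loop_eq kappa p1 p2 p3
  (h a1) (h a2) (h a3) (h b1) (h b2) (h b3) o_order.
rewrite !sum_over_cons /=; congr (_ = _); apply: eq_bigr => i _;
  rewrite sum_over_cons; apply: eq_bigr => j _; rewrite sum_over_cons;
  apply: eq_bigr => k _; rewrite sum_over_nil code_weight3 /weight /=;
  by rewrite !(recolor_same, recolor_neq _ _ uv, recolor_neq _ _ uw, recolor_neq _ _ vw) //
     !recolor_neq.
Qed.

Lemma triangle_flux p1 p2 p3 l :
  flux (triangle_before p1 p2 p3) l = flux (triangle_after p1 p2 p3) l.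
Proof. by rewrite !fluxE flux_nil !direction_opp; ring. Qed.

End Triangle.

Lemma reidemeister3_interchangeable o12 o13 o23 a1 a2 a3 b1 b2 b3 u v w C :
  (o12 == o23) ==> (o13 == o12) ->
  closed_code [:: Cl o12 a1 a2 u v, Cl o13 u a3 b3 w, Cl o23 v w b2 b1 & C] ->
  interchangeable [:: Cl o12 a1 a2 u v, Cl o13 u a3 b3 w, Cl o23 v w b2 b1 & C]
                  [:: Cl o23 a2 a3 u v, Cl o13 a1 v w b1, Cl o12 w u b3 b2 & C].
Proof.
move=> o_order D_closed.
have : u \notin [:: a1, a2, a3, b1, b2, b3, v, v, w, w & labels C].
  by apply: closed_twice D_closed _; perm_labels.
rewrite !inE !negb_or ![u == _]eq_sym =>
  /and5P[a1u a2u a3u b1u /and5P[b2u b3u vu _ /and3P[wu _ uC]]].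
have : v \notin [:: a1, a2, a3, b1, b2, b3, u, u, w, w & labels C].
  by apply: closed_twice D_closed _; perm_labels.
rewrite !inE !negb_or ![v == _]eq_sym =>
  /and5P[a1v a2v a3v b1v /and5P[b2v b3v uv _ /and3P[wv _ vC]]].
have : w \notin [:: a1, a2, a3, b1, b2, b3, u, u, v, v & labels C].
  by apply: closed_twice D_closed _; perm_labels.
rewrite !inE !negb_or ![w == _]eq_sym =>
  /and5P[a1w a2w a3w b1w /and5P[b2w b3w uw _ /and3P[vw _ wC]]].
have uvw_uniq : uniq [:: u; v; w] by rewrite /= !inE !negb_or uv uw vw.
have outer : all (fun l => l \notin [:: u; v; w]) [:: a1; a2; a3; b1; b2; b3].
  by rewrite /= !inE !negb_or a1u a1v a1w a2u a2v a2w a3u a3v a3w b1u b1v b1w b2u b2v b2w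
    b3u b3v b3w.
have u_in : u \in [:: u; v; w] by rewrite !inE eqxx.
have v_in : v \in [:: u; v; w] by rewrite !inE eqxx orbT.
have w_in : w \in [:: u; v; w] by rewrite !inE eqxx !orbT.
have sign_eq p q : (if ~~ p then 1 else -1) + (if q then 1 else -1) = 0 :> int -> q = p.
  by case: p q => [] [].
apply: (@local_interchangeable _ _ _ [:: u; v; w]
   [:: Cl o12 a1 a2 u v; Cl o13 u a3 b3 w; Cl o23 v w b2 b1] [:: u; v; w]
   [:: Cl o23 a2 a3 u v; Cl o13 a1 v w b1; Cl o12 w u b3 b2]).
- by rewrite /inner uvw_uniq /= !inE !eqxx uC vC wC !orbT.
- by rewrite /inner uvw_uniq /= !inE !eqxx uC vC wC !orbT.
- move=> l; rewrite !inE !negb_or; case: (l == u); case: (l == v); case: (l == w) => //=.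
  by case: (l == a1); case: (l == a2); case: (l == a3); case: (l == b1); case: (l == b2);
     case: (l == b3).
- move=> M /unzip1_triple[[p1 p2] [[p1' p3] [[p2' p3'] ->]]] flux0.
  have p1E : p1' = p1.
    apply: sign_eq; move: (flux0 u u_in); rewrite !fluxE flux_nil /direction /=.
    rewrite eqxx (negbTE vu) (negbTE wu) (negbTE a1u) (negbTE a2u) (negbTE a3u).
    by rewrite (negbTE b1u) (negbTE b2u) (negbTE b3u) !add0r !addr0.
  have p2E : p2' = p2.
    apply: sign_eq; move: (flux0 v v_in); rewrite !fluxE flux_nil /direction /=.
    rewrite eqxx (negbTE uv) (negbTE wv) (negbTE a1v) (negbTE a2v) (negbTE a3v).
    by rewrite (negbTE b1v) (negbTE b2v) (negbTE b3v) !add0r !addr0.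
  have p3E : p3' = p3.
    apply: sign_eq; move: (flux0 w w_in); rewrite !fluxE flux_nil /direction /=.
    rewrite eqxx (negbTE uw) (negbTE vw) (negbTE a1w) (negbTE a2w) (negbTE a3w).
    by rewrite (negbTE b1w) (negbTE b2w) (negbTE b3w) !add0r !addr0.
  rewrite p1E p2E p3E; exists (triangle_after o12 o13 o23 a1 a2 a3 b1 b2 b3 u v w p1 p2 p3).
  split=> // [l|]; first by rewrite -triangle_flux.
  exists 1 => [|kappa h]; first exact: oner_neq0.
  by rewrite mul1r -triangle_weight.
move=> M /unzip1_triple[[p2 p3] [[p1 p3'] [[p1' p2'] ->]]] flux0.
have p1E : p1' = p1.
  apply: sign_eq; move: (flux0 w w_in); rewrite !fluxE flux_nil /direction /=.
  rewrite eqxx (negbTE uw) (negbTE vw) (negbTE a1w) (negbTE a2w) (negbTE a3w).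
  by rewrite (negbTE b1w) (negbTE b2w) (negbTE b3w) !add0r !addr0.
have p2E : p2' = p2.
  apply: sign_eq; move: (flux0 u u_in); rewrite !fluxE flux_nil /direction /=.
  rewrite eqxx (negbTE vu) (negbTE wu) (negbTE a1u) (negbTE a2u) (negbTE a3u).
  by rewrite (negbTE b1u) (negbTE b2u) (negbTE b3u) !add0r !addr0.
have p3E : p3' = p3.
  apply: sign_eq; move: (flux0 v v_in); rewrite !fluxE flux_nil /direction /=.
  rewrite eqxx (negbTE uv) (negbTE wv) (negbTE a1v) (negbTE a2v) (negbTE a3v).
  by rewrite (negbTE b1v) (negbTE b2v) (negbTE b3v) !add0r !addr0.
rewrite p1E p2E p3E; exists (triangle_before o12 o13 o23 a1 a2 a3 b1 b2 b3 u v w p1 p2 p3).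
split=> // [l|]; first by rewrite triangle_flux.
exists 1 => [|kappa h]; first exact: oner_neq0.
by rewrite mul1r triangle_weight.
Qed.

End Moves.

(** * Different codes of the same diagram *)

Lemma closed_perm C C' : perm_eq (labels C) (labels C') -> closed_code C -> closed_code C'.
Proof.
move=> eqC /allP C_closed; apply/allP=> l; rewrite -(perm_mem eqC) => /C_closed.
by rewrite (permP eqC).
Qed.

Lemma closed_remove C C' l : perm_eq (labels C) [:: l, l & labels C'] ->
  closed_code C -> closed_code C'.
Proof.
move=> eqC C_closed; have l_C' := closed_twice C_closed eqC.
apply/allP=> k k_C'; have neq_lk : l != k by apply: contraNneq l_C' => ->.
have k_C : k \in labels C by rewrite (perm_mem eqC) !inE k_C' !orbT.
have := closed_count C_closed k_C.
by rewrite (permP eqC) /= (negbTE neq_lk) !add0n => ->.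
Qed.

Definition relabel_oriented f (v : oriented_node) : oriented_node := (relabel f v.1, v.2).

Lemma ends_relabel f v : ends (relabel f v) = map f (ends v).
Proof. by case: v. Qed.

Lemma labels_relabel f C : labels (map (relabel f) C) = map f (labels C).
Proof.
by rewrite /labels map_flatten -!map_comp; congr flatten; apply: eq_map => v /=;
  rewrite ends_relabel.
Qed.

Lemma unzip1_relabel f D : unzip1 (map (relabel_oriented f) D) = map (relabel f) (unzip1 D).
Proof. by rewrite /unzip1 -!map_comp. Qed.

Lemma directed_ends_relabel f v :
  directed_ends (relabel_oriented f v) = [seq (f e.1, e.2) | e <- directed_ends v].
Proof. by case: v => [[a b | a b c d | o a b c d] [p q]]. Qed.

Lemma flux_relabel f D l :
  flux (map (relabel_oriented f) D) l =
  \sum_(v <- D) \sum_(e <- directed_ends v) direction l (f e.1, e.2).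
Proof.
rewrite /flux big_map; apply: eq_bigr => v _.
by rewrite directed_ends_relabel big_map.
Qed.

Lemma map_relabel_lift f (C : code) (D : seq oriented_node) :
  unzip1 D = map (relabel f) C ->
  exists2 D', unzip1 D' = C & D = map (relabel_oriented f) D'.
Proof.
elim: C D => [|v C IHC] [|[w s] D] //=; first by exists [::].
by case=> -> /IHC[D' <- ->]; exists ((v, s) :: D').
Qed.

Lemma perm_unzip1_lift (S T : eqType) (D : seq (S * T)) (C : seq S) :
  perm_eq (unzip1 D) C -> exists2 D', unzip1 D' = C & perm_eq D D'.
Proof.
elim: C D => [|v C IHC] D eqD.
  by exists [::] => //; move/perm_size: eqD; case: D.
have : v \in unzip1 D by rewrite (perm_mem eqD) mem_head.
case/mapP=> -[w s] ws_D /= eq_vw; subst w.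
have eqD' : perm_eq D ((v, s) :: rem (v, s) D) by apply: perm_to_rem.
have [D' defC eqDD'] : exists2 D', unzip1 D' = C & perm_eq (rem (v, s) D) D'.
  by apply: IHC; rewrite -(perm_cons v) -(permPr eqD) perm_sym (perm_map fst eqD').
exists ((v, s) :: D'); first by rewrite /= defC.
by rewrite (permPl eqD') perm_cons.
Qed.

Section Moves.
Variables (F : fieldType) (x : F) (I : finComNzRingType).
Hypotheses (x_neq0 : x != 0) (loop_eq : #|I|%:R = - x ^+ 2 - x ^- 2 :> F).
Local Notation Z := (@state_sum F x I).
Local Notation transports := (@transports F x I).
Local Notation interchangeable := (@interchangeable F x I).
Local Notation rewrites := (@rewrites F x I).

Lemma transports_same_sums C C' : (forall D, unzip1 D = C -> is_oriented D ->
    exists D', [/\ unzip1 D' = C', is_oriented D' & forall kappa,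
      Z kappa D' = Z kappa D]) ->
  transports C C'.
Proof.
move=> CC' D defC D_or; have [D' [defC' D'_or eqZ]] := CC' D defC D_or.
by exists D'; split=> //; exists 1 => [|kappa]; rewrite ?oner_neq0 // mul1r.
Qed.

Lemma perm_transports C C' : perm_eq C C' -> transports C C'.
Proof.
move=> eqC; apply: transports_same_sums => D defC D_or.
have [|D' defC' eqD] := @perm_unzip1_lift _ _ D C'; first by rewrite defC.
exists D'; split=> // [l|kappa]; last by apply/esym/state_sum_perm.
by rewrite -(D_or l); apply/perm_big; rewrite perm_sym.
Qed.

Lemma perm_interchangeable C C' : perm_eq C C' -> interchangeable C C'.
Proof. by move=> eqC; split; apply: perm_transports; rewrite // perm_sym. Qed.

Lemma weight_relabel kappa f v (h : label -> I) :
  weight x kappa (relabel_oriented f v) h = weight x kappa v (h \o f).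
Proof. by case: v => [[a b | a b c d | o a b c d] s]. Qed.

Lemma code_weight_relabel kappa f D (h : label -> I) :
  code_weight x kappa (map (relabel_oriented f) D) h = code_weight x kappa D (h \o f).
Proof. by rewrite /code_weight big_map; apply: eq_bigr => v _; apply: weight_relabel. Qed.

Lemma state_sum_relabel kappa f D : injective f ->
  Z kappa (map (relabel_oriented f) D) = Z kappa D.
Proof.
move=> injf; rewrite /state_sum unzip1_relabel labels_relabel undup_map_inj //.
rewrite (eq_sum_over _ (code_weight_relabel kappa f D)).
by rewrite (@sum_over_map _ _ f _ (code_weight x kappa D)).
Qed.

Lemma flux_relabel_inj f D l : injective f -> flux (map (relabel_oriented f) D) (f l) =
  flux D l.
Proof.
move=> injf; rewrite flux_relabel; apply: eq_bigr => v _; apply: eq_bigr => e _.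
by rewrite /direction /= (inj_eq injf).
Qed.

Lemma relabel_interchangeable f C : injective f -> interchangeable C (map (relabel f) C).
Proof.
move=> injf; split; apply: transports_same_sums => D.
  move=> defC D_or; exists (map (relabel_oriented f) D); split.
  - by rewrite unzip1_relabel defC.
  - move=> l; have [|l_D] := boolP (l \in labels (unzip1 (map (relabel_oriented f) D))).
      rewrite unzip1_relabel labels_relabel => /mapP[k _ ->].
      by rewrite flux_relabel_inj // D_or.
    exact: flux_notin.
  by move=> kappa; rewrite state_sum_relabel.
case/map_relabel_lift=> D' defC -> D_or; exists D'; split=> // [l|kappa].
  by rewrite -(flux_relabel_inj _ _ injf) D_or.
by rewrite state_sum_relabel.
Qed.

Lemma reversible_local L L' C : labels L =i labels L' ->
  (forall M, unzip1 M = L -> exists M', [/\ unzip1 M' = L', flux M' =1 flux M &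
     forall kappa, code_weight x kappa M' =1 (code_weight x kappa M : (label -> I) ->
       F)]) ->
  transports (L ++ C) (L' ++ C).
Proof.
move=> eqL LL'; apply: (@local_transports _ _ _ [::] _ [::]) => // [l|M defL _].
  by rewrite eqL.
have [M' [defL' fluxM wM]] := LL' M defL; exists M'; split=> //.
by exists 1 => [|kappa h]; rewrite ?oner_neq0 // mul1r !sum_over_nil wM.
Qed.

Lemma turn_Pt_interchangeable a b C : interchangeable (Pt a b :: C) (Pt b a :: C).
Proof.
suff turn a' b' : transports (Pt a' b' :: C) (Pt b' a' :: C) by split.
apply: (@reversible_local [:: Pt a' b'] [:: Pt b' a']) => [l|M].
  by rewrite !inE orbC.
case/unzip1_singleton=> -[p q] ->; exists [:: (Pt b' a', (~~ p, q))];
  split=> // [l|kappa h].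
  by rewrite !fluxE flux_nil !direction_opp; ring.
by rewrite !code_weight1 /weight /= eq_sym.
Qed.

(** The state sum sees a virtual crossing as two unrelated arcs. Detours therefore reduce to cutting
    and joining arcs, with no appeal to planarity. *)
Lemma split_Vi_interchangeable a b c d C :
  interchangeable (Vi a b c d :: C) [:: Pt a c, Pt b d & C].
Proof.
split.
  apply: (@reversible_local [:: Vi a b c d] [:: Pt a c; Pt b d]) => [l|M].
    by rewrite !inE; do !bool_congr.
  case/unzip1_singleton=> -[p q] ->.
  exists [:: (Pt a c, (p, p)); (Pt b d, (q, q))]; split=> // [l|kappa h].
    by rewrite !fluxE flux_nil !direction_opp; ring.
  by rewrite code_weight1 code_weight2 /weight /= -natrM mulnb.
apply: (@reversible_local [:: Pt a c; Pt b d] [:: Vi a b c d]) => [l|M].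
  by rewrite !inE; do !bool_congr.
case/unzip1_pair=> -[p r] [[q s] ->].
exists [:: (Vi a b c d, (p, q))]; split=> // [l|kappa h].
  by rewrite !fluxE flux_nil !direction_opp; ring.
by rewrite code_weight1 code_weight2 /weight /= -natrM mulnb.
Qed.

Lemma turn_Vi_interchangeable a b c d C :
  interchangeable (Vi a b c d :: C) (Vi b c d a :: C).
Proof.
apply: interchangeable_trans (split_Vi_interchangeable _ _ _ _ _) _.
apply: interchangeable_trans (turn_Pt_interchangeable _ _ _) _.
apply: interchangeable_trans (interchangeable_sym (split_Vi_interchangeable _ _ _ _ _)).
by apply: perm_interchangeable; perm_labels.
Qed.

Lemma crossing_weight_turn o (i j k l : I) :
  crossing_weight x (~~ o) j k l i = crossing_weight x o i j k l.
Proof.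
rewrite /crossing_weight addrC (eq_sym l i) (eq_sym j i) (andbC (i == j)) andbC.
by rewrite (eq_sym j k) (andbC (i == l)); case: o.
Qed.

(** After a quarter turn the strand b-d comes first and the other one is read from c to a, so the
    directions become [(q, ~~ p)]. *)
Lemma turn_Cl_interchangeable o a b c d C :
  interchangeable (Cl o a b c d :: C) (Cl (~~ o) b c d a :: C).
Proof.
split.
  apply: (@reversible_local [:: Cl o a b c d] [:: Cl (~~ o) b c d a]) => [l|M].
    by rewrite !inE; do !bool_congr.
  case/unzip1_singleton=> -[p q] ->.
  exists [:: (Cl (~~ o) b c d a, (q, ~~ p))]; split=> // [l|kappa h].
    by rewrite !fluxE flux_nil !direction_opp; ring.
  by rewrite !code_weight1 /weight /= negbK crossing_weight_turn.
apply: (@reversible_local [:: Cl (~~ o) b c d a] [:: Cl o a b c d]) => [l|M].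
  by rewrite !inE; do !bool_congr.
case/unzip1_singleton=> -[p q] ->.
exists [:: (Cl o a b c d, (~~ q, p))]; split=> // [l|kappa h].
  by rewrite !fluxE flux_nil !direction_opp; ring.
by rewrite !code_weight1 /weight /= negbK -crossing_weight_turn.
Qed.

Lemma flux_once D l : count_mem l (labels (unzip1 D)) = 1%N -> flux D l = 1 \/ flux D l =
  -1.
Proof.
have -> : flux D l = \sum_(e <- flatten (map directed_ends D)) direction l e.
  by rewrite big_flatten big_map.
have -> : labels (unzip1 D) = unzip1 (flatten (map directed_ends D)).
  rewrite /labels /unzip1 map_flatten -!map_comp; congr flatten.
  by apply: eq_map => v /=; rewrite -directed_endsE.
elim: (flatten _) => //= -[k b] s IHs; rewrite big_cons /direction /=.
case: eqP => [_ /= [/count_memPn l_s]|_ /IHs]; last by rewrite add0r.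
rewrite big1_seq => [|e /andP[_ e_s]]; first by case: b; [left | right].
by case: eqP => // eq_l; rewrite -eq_l map_f in l_s.
Qed.

Section Marks.
Variables (a b : label) (C : code).
Hypotheses (ab : a != b) (D_closed : closed_code (Pt a b :: C)).
Let f l := if l == b then a else l.

Lemma merge_count l : l = a \/ l = b -> count_mem l (labels C) = 1%N.
Proof.
move=> l_ab; have := @closed_count _ l D_closed.
rewrite labels_cons /= !inE; case: l_ab => ->; rewrite !eqxx ?orbT => /(_ isT).
  by rewrite eq_sym (negbTE ab) => -[].
by rewrite (negbTE ab) => -[].
Qed.

Lemma flux_merge D l :
  flux (map (relabel_oriented f) D) l =
  if l == a then flux D a + flux D b else if l == b then 0 else flux D l.
Proof.
rewrite flux_relabel; have [->|la] := eqVneq l a.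
  rewrite -big_split; apply: eq_bigr => v _; rewrite -big_split; apply: eq_bigr => e _.
  rewrite /direction /f /=; have [->|_] := eqVneq e.1 b; last by rewrite addr0.
  by rewrite eqxx eq_sym (negbTE ab) add0r.
have [->|lb] := eqVneq l b.
  rewrite big1 // => v _; rewrite big1 // => e _; rewrite /direction /f /=.
  by have [_|/negbTE->] := eqVneq e.1 b; rewrite ?(negbTE ab).
apply: eq_bigr => v _; apply: eq_bigr => e _; rewrite /direction /f /=.
by have [->|//] := eqVneq e.1 b;
  rewrite [a == l]eq_sym (negbTE la) [b == l]eq_sym (negbTE lb).
Qed.

Lemma state_sum_merge kappa D s : unzip1 D = C ->
  Z kappa ((Pt a b, s) :: D) = Z kappa (map (relabel_oriented f) D).
Proof.
move=> defC; have a_C : a \in labels C by rewrite -has_pred1 has_count merge_count //; left.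
have b_C : b \in labels C by rewrite -has_pred1 has_count merge_count //; right.
set ls := undup (labels (unzip1 (map (relabel_oriented f) D))).
rewrite /state_sum (@sum_over_perm _ _ _ (ls ++ [:: b])); last first.
  apply: uniq_perm; first exact: undup_uniq.
    rewrite cat_uniq undup_uniq /= orbF andbT.
    rewrite /ls mem_undup unzip1_relabel labels_relabel; apply/mapP=> -[k _].
    by rewrite /f; case: eqP => [_ /eqP|/nesym]; rewrite 1?eq_sym ?(negbTE ab).
  move=> l; rewrite mem_undup mem_cat /ls mem_undup unzip1_relabel labels_relabel.
  have -> : unzip1 ((Pt a b, s) :: D) = Pt a b :: C by rewrite /= defC.
  rewrite defC labels_cons mem_cat !inE.
  have [->|la] := eqVneq l a => /=.
    by apply/esym/orP; left; apply/mapP; exists a; rewrite // /f (negbTE ab).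
  have [->|lb] := eqVneq l b; rewrite ?orbT //= orbF.
  apply/idP/mapP=> [l_C | [k k_C ->]]; first by exists l; rewrite // /f (negbTE lb).
  by rewrite /f; case: eqP.
rewrite sum_over_cat; apply: eq_sum_over => h; rewrite code_weight_relabel sum_over_cons.
under eq_bigr do rewrite sum_over_nil code_weight_cons /weight /= recolor_same
  recolor_neq //.
rewrite (bigD1 (h a)) //= eqxx mul1r big1 ?addr0 => [|i /negbTE neq_i]; last first.
  by rewrite eq_sym neq_i mul0r.
congr (code_weight _ _ _ _); apply: functional_extensionality => l.
by rewrite /recolor /f /=; case: eqP.
Qed.

Lemma mark_interchangeable :
  interchangeable (Pt a b :: C) (map (relabel f) C).
Proof.
split; apply: transports_same_sums; last move=> D /map_relabel_lift[D' defC ->] D_or.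
  case=> [|[v s] D] //= [-> defC] D_or.
  exists (map (relabel_oriented f) D); split=> [|l|kappa].
  - by rewrite unzip1_relabel defC.
  - rewrite flux_merge.
    have fluxD k : flux D k = - \sum_(e <- directed_ends (Pt a b, s)) direction k e.
      by apply/eqP; rewrite -subr_eq0 opprK addrC -flux_cons D_or.
    case: ifP => [_|/negbT la]; [|case: ifP => // /negbT lb]; rewrite !fluxD.
      case: (s) => p q; rewrite /= !big_cons !big_nil !direction_opp /direction /=.
      by rewrite !eqxx eq_sym (negbTE ab); case: p.
    case: (s) => p q; rewrite /= !big_cons !big_nil /direction /=.
    by rewrite [a == l]eq_sym (negbTE la) [b == l]eq_sym (negbTE lb).
  by rewrite (state_sum_merge _ _ defC).
(* The one end labelled [a] left in [D'] dictates the direction of the reinserted mark; the flux at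
   [b] then balances because the merged label did. *)
have [p flux_a] : exists p : bool, flux D' a = if p then -1 else 1.
  have [|->|->] := @flux_once D' a; [|by exists false|by exists true].
  by rewrite defC merge_count //; left.
exists ((Pt a b, (p, p)) :: D'); split=> [|l|kappa].
- by rewrite /= defC.
- have := D_or a; rewrite flux_merge eqxx flux_a => flux_b.
  rewrite flux_cons /= !big_cons big_nil direction_opp /direction /=.
  have [->|la] := eqVneq l a; first by rewrite eq_sym (negbTE ab) flux_a; case: (p).
  have [->|lb] := eqVneq l b.
    by move: flux_b; case: (p) => /=; move: (flux _ _) => z; lia.
  by rewrite oppr0 !add0r; have := D_or l; rewrite flux_merge (negbTE la) (negbTE lb).
by rewrite (state_sum_merge _ _ defC).
Qed.

End Marks.

End Moves.

(** * Detours, and invariance under virtual equivalence *)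

Section Invariance.
Variables (F : fieldType) (x : F) (I : finComNzRingType).
Hypotheses (x_neq0 : x != 0) (loop_eq : #|I|%:R = - x ^+ 2 - x ^- 2 :> F).
Local Notation Z := (@state_sum F x I).
Local Notation transports := (@transports F x I).
Local Notation interchangeable := (@interchangeable F x I).
Local Notation rewrites := (@rewrites F x I).

Lemma same_diagram_interchangeable D D' :
  closed_code D -> same_diagram D D' -> interchangeable D D'.
Proof.
move=> D_closed same; case: same D_closed.
- by move=> C C' eqC _; apply: perm_interchangeable.
- by move=> f C injf _; apply: relabel_interchangeable.
- by move=> a b C _; apply: turn_Pt_interchangeable.
- by move=> a b c d C _; apply: turn_Vi_interchangeable.
- by move=> o a b c d C _; apply: turn_Cl_interchangeable.
by move=> a b C ab D_closed; apply: mark_interchangeable.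
Qed.

Lemma reidemeister_interchangeable D D' :
  closed_code D -> reidemeister D D' -> interchangeable D D'.
Proof.
move=> D_closed move_DD'; case: move_DD' D_closed.
- by move=> o a b y C; apply: reidemeister1_interchangeable.
- by move=> o a b c d y z C; apply: reidemeister2_interchangeable.
by move=> o12 o13 o23 a1 a2 a3 b1 b2 b3 u v w C; apply: reidemeister3_interchangeable.
Qed.

Lemma join_arcs_interchangeable e f g C : closed_code [:: Pt g f, Pt e g & C] ->
  interchangeable [:: Pt g f, Pt e g & C] (Pt e f :: C).
Proof.
move=> D_closed.
have : g \notin [:: e, f & labels C] by apply: closed_twice D_closed _; perm_labels.
rewrite !inE !negb_or ![g == _]eq_sym => /and3P[eg fg gC].
have weightE kappa r s t (h : label -> I) :
    sum_over [:: g] (code_weight x kappa [:: (Pt g f, r); (Pt e g, s)]) h =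
    code_weight x kappa [:: (Pt e f, t)] h.
  rewrite code_weight1 sum_over_cons /weight /=.
  under eq_bigr do rewrite sum_over_nil code_weight2 /weight /= recolor_same !recolor_neq
    // -natrM mulnb.
  by apply: sum_delta1 => i; apply/andP/andP=> -[/eqP-> /eqP->]; rewrite ?eqxx.
apply: (@local_interchangeable _ _ _ [:: g] [:: Pt g f; Pt e g] [::] [:: Pt e f]).
- by rewrite /inner /= !inE eqxx gC.
- by [].
- move=> l; rewrite !inE; have [->|_] := eqVneq l g.
    by rewrite ![g == _]eq_sym (negbTE eg) (negbTE fg) (negbTE gC).
  by rewrite /= orbF; case: (l == e); case: (l == f).
- move=> M /unzip1_pair[[p p'] [[q q'] ->]] flux0.
  have {flux0} -> : p = q.
    move: {flux0}(flux0 g (mem_head _ _));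
      rewrite !fluxE flux_nil !direction_opp /direction /=.
    by rewrite eqxx (negbTE eg) (negbTE fg); case: p q => [] [].
  exists [:: (Pt e f, (q, q))]; split=> // [l|].
    by rewrite !fluxE flux_nil !direction_opp; ring.
  exists 1 => [|kappa h]; first exact: oner_neq0.
  by rewrite mul1r (@weightE _ _ _ (q, q)) sum_over_nil.
move=> M /unzip1_singleton[[p p'] ->] _.
exists [:: (Pt g f, (p, p)); (Pt e g, (p, p))]; split=> // [l|].
  by rewrite !fluxE flux_nil !direction_opp; ring.
exists 1 => [|kappa h]; first exact: oner_neq0.
by rewrite mul1r (@weightE _ _ _ (p, p')) sum_over_nil.
Qed.

Lemma cross_strand_interchangeable e f g s t C1 C2 :
  closed_code [:: Pt g f, Vi e s g t & C1 ++ C2] ->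
  interchangeable [:: Pt g f, Vi e s g t & C1 ++ C2] (Pt e f :: C1 ++ Pt s t :: C2).
Proof.
move=> D_closed.
have swap : interchangeable [:: Pt g f, Vi e s g t & C1 ++ C2] [:: Vi e s g t,
  Pt g f & C1 ++ C2].
  by apply: perm_interchangeable; perm_labels.
apply: interchangeable_trans swap _.
apply: interchangeable_trans (split_Vi_interchangeable _ _ _ _ _ _ _) _.
have reorder : interchangeable [:: Pt e g, Pt s t, Pt g f & C1 ++ C2]
    [:: Pt g f, Pt e g, Pt s t & C1 ++ C2].
  by apply: perm_interchangeable; perm_labels.
apply: interchangeable_trans reorder _.
apply: interchangeable_trans (join_arcs_interchangeable _) _.
  by apply: closed_perm D_closed; perm_labels.
apply: perm_interchangeable; apply/permP=> P; rewrite /= !count_cat /=; ring.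
Qed.

(** Any virtual arc can be traded for a bare mark joining its ends, so two arcs with the same ends
    are compared through that mark. Closedness is known for the final code and has to be pulled back
    along the drawing. *)
Lemma draw_arc_interchangeable e f C D : draw_arc e f C D -> closed_code D ->
  closed_code (Pt e f :: C) /\ interchangeable D (Pt e f :: C).
Proof.
elim=> {e f C D} [e f C | e f g C D _ IH | e f g s t C1 C2 D _ IH | e f g s t C1 C2 D _
  IH] D_closed.
- by split=> //; apply: perm_interchangeable.
- have [C'_closed DC'] := IH D_closed; split.
    by apply: (closed_remove (l := g)) C'_closed; perm_labels.
  exact: interchangeable_trans DC' (join_arcs_interchangeable _).
- have [C'_closed DC'] := IH D_closed; split.
    by apply: (closed_remove (l := g)) C'_closed; apply/permP=> P;
      rewrite !labels_cons !labels_cat !labels_cons /= !count_cat /=; ring.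
  exact: interchangeable_trans DC' (cross_strand_interchangeable _).
have [C'_closed DC'] := IH D_closed; split.
  by apply: (closed_remove (l := g)) C'_closed; apply/permP=> P;
    rewrite !labels_cons !labels_cat !labels_cons /= !count_cat /=; ring.
apply: interchangeable_trans DC' (interchangeable_trans (cross_strand_interchangeable _)
  _) => //.
have front u v : interchangeable (Pt e f :: C1 ++ Pt u v :: C2) [:: Pt u v,
  Pt e f & C1 ++ C2].
  by apply: perm_interchangeable; apply/permP=> P; rewrite /= !count_cat /=; ring.
apply: interchangeable_trans (front _ _) _.
by apply: interchangeable_trans (turn_Pt_interchangeable _ _ _ _ _) (interchangeable_sym
  (front _ _)).
Qed.

Lemma detour_interchangeable D D' : closed_code D -> closed_code D' ->
  detour D D' -> interchangeable D D'.
Proof.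
move=> D_closed D'_closed [e [f [C [CD CD']]]].
have [_ DC] := draw_arc_interchangeable CD D_closed.
have [_ D'C] := draw_arc_interchangeable CD' D'_closed.
exact: interchangeable_trans DC (interchangeable_sym D'C).
Qed.

Lemma virtual_equiv_interchangeable D D' : virtual_equiv D D' -> interchangeable D D'.
Proof.
elim=> {D D'} [D D' [/andP[D_closed _] /andP[D'_closed _] DD'] | D | D D' _ | D1 D2 D3 _
  t12 _ t23].
- case: DD'; first exact: same_diagram_interchangeable.
    exact: reidemeister_interchangeable.
  exact: detour_interchangeable.
- by split; apply: transports_refl.
- exact: interchangeable_sym.
exact: interchangeable_trans t12 t23.
Qed.

End Invariance.

(** * Alexander numberings of planar diagrams *)

(* An Alexander numbering of the edges: the larger of the two numbers on the sides. *)
Definition alexander (m : label -> int) (v : oriented_node) : Prop :=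
  let: (p, q) := v.2 in
  match v.1 with
  | Pt a b => m a = m b
  | Vi _ _ _ _ => False
  | Cl _ a b c d => exists t,
      [/\ m a = t + q%:Z, m b = t + (~~ p)%:Z, m c = t + (~~ q)%:Z & m d = t + p%:Z]
  end.

Lemma sum_slot_nat (R : nmodType) (C : code) (G : nat -> nat -> R) :
  \sum_(s : slot C) G (at_vertex s) (at_place s) =
  \sum_(i < size C) \sum_(j < degree C i) G i j.
Proof. by rewrite sum_slot; apply: eq_bigr => i _; rewrite degreeE. Qed.

Definition sign_of (b : bool) : rat := if b then 1 else -1.

Definition orientation_flow (X : seq oriented_node) i j : rat :=
  sign_of (nth (0%N, true) (directed_ends (nth (Pt 0 0, (true, true)) X i)) j).2.

Section Alexander.
Variable X : seq oriented_node.
Let C := unzip1 X.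
Let g := orientation_flow X.
Hypotheses (X_oriented : is_oriented X) (C_closed : closed_code C).

Lemma vertex_unzip1 i : vertex C i = (nth (Pt 0 0, (true, true)) X i).1.
Proof.
rewrite /vertex /C /unzip1; have [lt_i|ge_i] := ltnP i (size X); first exact: nth_map.
by rewrite !nth_default // size_map.
Qed.

Lemma degree_directed i : degree C i = size (directed_ends (nth (Pt 0 0, (true,
  true)) X i)).
Proof. by rewrite /degree vertex_unzip1 -directed_endsE size_map. Qed.

Lemma half_label_directed i j : half_edge C i j ->
  half_label C i j = (nth (0%N, true) (directed_ends (nth (Pt 0 0, (true, true)) X i)) j).1.
Proof.
case/andP=> _ lt_j; rewrite /half_label vertex_unzip1 -directed_endsE.
by rewrite (nth_map (0%N, true)) // -degree_directed.
Qed.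

Lemma flux_slots l :
  (flux X l)%:~R = \sum_(s : slot C) if slot_label s == l then g (at_vertex s) (at_place
    s) else 0.
Proof.
pose G i j := if half_label C i j == l then g i j else 0.
transitivity (\sum_(s : slot C) G (at_vertex s) (at_place s)); last first.
  by apply: eq_bigr => s _; rewrite /G half_label_slot.
rewrite sum_slot_nat /flux (big_nth (Pt 0 0, (true, true))) big_mkord.
have -> : size X = size C by rewrite size_map.
rewrite rmorph_sum /=; apply: eq_bigr => i _.
rewrite (big_nth (0%N, true)) big_mkord -degree_directed.
rewrite rmorph_sum /=; apply: eq_bigr => j _.
have half_ij : half_edge C i j by rewrite /half_edge !ltn_ord.
rewrite /G half_label_directed // /direction /g /orientation_flow /sign_of.
by case: (_ == l) => //; case: (nth _ _ j) => k [].
Qed.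

Lemma orientation_is_flow : flow C g.
Proof.
split=> [i lt_i | i j i' j' /half_edgeP[s <- <-] /half_edgeP[t <- <-] neq_st lab_st].
  rewrite degree_directed /g /orientation_flow.
  transitivity (\sum_(e <- directed_ends (nth (Pt 0 0, (true, true)) X i)) sign_of e.2).
    by rewrite (big_nth (0%N, true)) big_mkord.
  case: (nth _ X i) => -[a b | a b c d | o a b c d] [p q];
  by rewrite /directed_ends /= !big_cons big_nil /=; case: p; case: q;
    rewrite /sign_of /=; lra.
have {neq_st} t_opp : t = slot_opp s.
  by apply/eqP; rewrite -half_edge_oppP // neq_st lab_st eqxx.
have := flux_slots (slot_label s); rewrite X_oriented (bigD1 s) //= eqxx.
have lab_t : slot_label t = slot_label s by rewrite t_opp slot_label_opp.
have neq_ts : t != s by rewrite t_opp slot_opp_neq.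
rewrite (bigD1 t) //= lab_t eqxx big1 ?addr0 => [|k /andP[neq_ks neq_kt]].
  by move/eqP; rewrite eq_sym addrC addr_eq0 => /eqP.
by rewrite ifN //; apply: contra neq_kt => lab_k; rewrite t_opp slot_oppE // neq_ks.
Qed.

Variable r : nat -> nat -> rat.
Hypothesis r_pot : corner_potential C g r.

(** The two sides of the half-edge have face values [r i j] and [r i j - g i j]; this is the larger
    one. *)
Let top i j := if g i j == 1 then r i j else r i (j.+1 %% degree C i)%N.
(** Face values are rational and determined only up to constants, but neighbouring ones differ by 1;
    [Num.floor] keeps these differences and makes the numbering integral. *)
Let m (l : label) : int :=
  if [pick s : slot C | slot_label s == l] is Some s
  then Num.floor (top (at_vertex s) (at_place s)) else 0.

Lemma g_sign i j : g i j = 1 \/ g i j = -1.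
Proof. by rewrite /g /orientation_flow /sign_of; case: ifP => _; [left | right]. Qed.

Lemma m_half_label i j : half_edge C i j -> m (half_label C i j) = Num.floor (top i j).
Proof.
move=> half_ij; have /half_edgeP[s def_i def_j] := half_ij.
rewrite /m -def_i -def_j half_label_slot; case: pickP => [t /eqP lab_t | /(_ s)];
  last by rewrite eqxx.
congr Num.floor; case: (eqVneq t s) => [-> // | neq_ts].
have [r_g r_opp] := r_pot; have [_ g_opp] := orientation_is_flow.
have half_t := half_edge_slot t; have half_s := half_edge_slot s.
have neq_st : (at_vertex s, at_place s) != (at_vertex t,
  at_place t) by rewrite -slot_eqE eq_sym.
have neq_ts' : (at_vertex t, at_place t) != (at_vertex s, at_place s) by rewrite -slot_eqE.
have lab_st : half_label C (at_vertex s) (at_place s) = half_label C (at_vertex t)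
  (at_place t).
  by rewrite !half_label_slot.
have g_ts := g_opp _ _ _ _ half_s half_t neq_st lab_st.
have r_st := r_opp _ _ _ _ half_s half_t neq_st lab_st.
have r_ts := r_opp _ _ _ _ half_t half_s neq_ts' (esym lab_st).
by rewrite /top g_ts r_st r_ts; case: (g_sign (at_vertex s) (at_place s)) => ->.
Qed.

Lemma alexander_exists : classical C -> {in X, forall v, alexander m v}.
Proof.
move=> C_classical v v_X.
have v_classical : ~~ is_virtual v.1 by apply: contra C_classical => v_virt; apply/hasP;
  exists v.1; rewrite // map_f.
have [i lt_i nth_i] : exists2 i, (i < size C)%N & nth (Pt 0 0, (true, true)) X i = v.
  by exists (index v X); rewrite ?nth_index // size_map index_mem.
have deg_i : degree C i = size (ends v.1) by rewrite /degree vertex_unzip1 nth_i.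
have half_i j : (j < size (ends v.1))%N -> half_edge C i j by rewrite /half_edge lt_i deg_i.
have lab_i j : half_label C i j = nth 0%N (ends v.1) j by rewrite /half_label
  vertex_unzip1 nth_i.
have g_i j : g i j = sign_of (nth (0%N, true) (directed_ends v) j).2.
  by rewrite /g /orientation_flow nth_i.
have [r_g _] := r_pot.
have m_i j (half_j : (j < size (ends v.1))%N) : m (nth 0%N (ends v.1) j) = Num.floor (top
  i j).
  by rewrite -lab_i m_half_label // half_i.
have floorD (y z : rat) (k l : nat) : z = y - k%:R + l%:R ->
    Num.floor z = Num.floor y - k%:Z + l%:Z.
  move=> ->; have -> : y - k%:R + l%:R = y + (l%:Z - k%:Z)%:~R :> rat by rewrite intrB;
    ring.
  by rewrite floorDrz ?intr_int // intrKfloor; ring.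
have r_i j : (j < size (ends v.1))%N -> r i j - r i (j.+1 %% size (ends v.1))%N = g i j.
  by move=> lt_j; rewrite -deg_i r_g // half_i.
case: v {v_X nth_i} v_classical deg_i half_i lab_i g_i m_i r_i =>
  -[a b | // | o a b c d] [p q] _.
  move=> deg_i half_i lab_i g_i m_i r_i.
  have := m_i 0%N isT; have := m_i 1%N isT; rewrite /alexander /= => -> ->.
  have := r_i 0%N isT; have := r_i 1%N isT; rewrite /top !g_i deg_i /= modnn modn_small //.
  by case: (p).
move=> deg_i half_i lab_i g_i m_i r_i.
have := m_i 0%N isT; have := m_i 1%N isT; have := m_i 2%N isT; have := m_i 3%N isT.
(* Up to [Num.floor], this is the middle one of the three consecutive numbers met around the
   crossing. *)
rewrite /alexander /= => -> -> -> ->; exists (Num.floor (top i 0) - q%:Z).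
have := r_i 0%N isT; have := r_i 1%N isT; have := r_i 2%N isT; have := r_i 3%N isT.
rewrite /top !g_i deg_i /= /sign_of.
have -> : (1 %% 4 = 1)%N by []. have -> : (2 %% 4 = 2)%N by [].
have -> : (3 %% 4 = 3)%N by []. have -> : (4 %% 4 = 0)%N by [].
by case: (p); case: (q) => /= r3 r2 r1 r0; split; apply: floorD; lra.
Qed.

End Alexander.

Lemma alexander_planar X : is_diagram (unzip1 X) -> classical (unzip1 X) -> is_oriented X ->
  exists m, {in X, forall v, alexander m v}.
Proof.
move=> /andP[C_closed C_planar] C_classical X_or.
have [r r_pot] := (planar_cornerP C_closed).1 C_planar _ (orientation_is_flow X_or
  C_closed).
by eexists; apply: (alexander_exists X_or C_closed r_pot).
Qed.

Section Gauge.
Variables (F : fieldType) (x : F) (I : finComNzRingType).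

(** At a crossing the shifts of [weight] differ from [kappa *~ m] by the common term [kappa *~ t],
    which a crossing does not see. *)
Lemma alexander_weight kappa m X (h : label -> I) : {in X, forall v, alexander m v} ->
  code_weight x kappa X h = code_weight x 0 X (fun l => h l - kappa *~ m l).
Proof.
move=> X_alex; apply: eq_big_seq => v /X_alex.
case: v => -[a b | a b c d | o a b c d] [p q]; rewrite /alexander /weight //=.
  by move->; rewrite (inj_eq (@subIr I _)).
case=> t [-> -> -> ->]; rewrite !mul0rn !subr0 -(@crossing_weightB _ _ _ (kappa *~ t)).
by congr crossing_weight; rewrite mulrzDr addrC pmulrn; ring.
Qed.

Lemma state_sum_planar (kappa : I) X : is_diagram (unzip1 X) -> classical (unzip1 X) ->
  is_oriented X -> state_sum x kappa X = state_sum x (0 : I) X.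
Proof.
move=> C_diag C_class X_or; have [m X_alex] := alexander_planar C_diag C_class X_or.
rewrite /state_sum (eq_sum_over _ (fun h => alexander_weight kappa h X_alex)).
by rewrite (@sum_over_shift _ _ _ (fun l => kappa *~ m l)) -state_sum_base.
Qed.

End Gauge.

(** * Existence of an orientation *)

Definition edge_flux (l : label) (y : (label * label) * bool) : int :=
  direction l (y.1.1, y.2) + direction l (y.1.2, ~~ y.2).

(* Merging two edges at a common end preserves the imbalance, so every multigraph has
   an orientation whose imbalance is at most one at each vertex. *)
Definition balanceable (E : seq (label * label)) :=
  exists2 Y, unzip1 Y = E & forall l, `|\sum_(y <- Y) edge_flux l y| <= 1.

Lemma balanceable_perm E E' : perm_eq E E' -> balanceable E -> balanceable E'.
Proof.
move=> eqE [Y defE balY]; have [|Y' defE' eqY] := @perm_unzip1_lift _ _ Y E'.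
  by rewrite defE.
by exists Y' => // l; rewrite -(perm_big _ eqY).
Qed.

Lemma balanceable_flip u v E : balanceable ((u, v) :: E) -> balanceable ((v, u) :: E).
Proof.
case=> -[|[_ b] Y] //= [-> defE] balY; exists (((v, u), ~~ b) :: Y);
  first by rewrite /= defE.
move=> l; have := balY l; rewrite !big_cons /edge_flux /= negbK.
by rewrite [direction l (u, b) + _]addrC.
Qed.

Lemma balanceable_merge u v w E :
  balanceable ((u, w) :: E) -> balanceable [:: (u, v), (v, w) & E].
Proof.
case=> -[|[_ b] Y] //= [-> defE] balY.
exists [:: ((u, v), b), ((v, w), b) & Y]; first by rewrite /= defE.
move=> l; have := balY l; rewrite !big_cons /edge_flux /= !direction_opp.
by congr (`|_| <= _); ring.
Qed.

Lemma balanceable_all E : balanceable E.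
Proof.
have [n] := ubnP (size E); elim: n E => // n IHn [|[u v] E] /=.
  by exists [::] => // l; rewrite big_nil.
rewrite ltnS => le_n.
(* An edge meeting another one at [t] is merged with it, which lowers the number of edges. *)
have extend s t : has (fun e => (e.1 == t) || (e.2 == t)) E -> balanceable ((s, t) :: E).
  case/hasP=> e e_E e_t; have E_rem := perm_to_rem e_E.
  have merged w : balanceable [:: (s, t), (t, w) & rem e E].
    by apply/balanceable_merge/IHn; rewrite /= size_rem //; case: (E) e_E le_n.
  apply: (@balanceable_perm [:: (s, t), e & rem e E]); first by rewrite perm_cons perm_sym.
  case: e e_t {e_E E_rem} merged => y z /= e_t merged.
  have swap (p q : label * label) E' : balanceable [:: p, q & E'] -> balanceable [:: q,
    p & E'].
    by apply: balanceable_perm; apply/permP=> P /=; ring.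
  by case/orP: e_t merged => /eqP-> merged; last apply/swap/balanceable_flip/swap.
have [v_E | no_v] := boolP (has (fun e => (e.1 == v) || (e.2 == v)) E).
  exact: extend.
have [u_E | no_u] := boolP (has (fun e => (e.1 == u) || (e.2 == u)) E).
  exact: (balanceable_flip (extend v u u_E)).
have [Y defE balY] := IHn E le_n.
(* Both ends of this edge avoid all the others, so it creates an imbalance of at most one there,
   whichever way it is directed. *)
exists (((u, v), true) :: Y) => [|l]; first by rewrite /= defE.
have zero w : ~~ has (fun e => (e.1 == w) || (e.2 == w)) E -> \sum_(y <- Y) edge_flux w y
  = 0.
  move/hasPn=> no_w; apply: big1_seq => y /andP[_ y_Y].
  have /no_w : y.1 \in E by rewrite -defE map_f.
  by rewrite /edge_flux /direction /= negb_or => /andP[/negbTE-> /negbTE->].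
rewrite big_cons /edge_flux direction_opp /direction /=.
have [<-|ul] := eqVneq u l; first by rewrite zero // addr0; case: eqP.
have [<-|vl] := eqVneq v l; first by rewrite zero // addr0.
by rewrite subrr add0r; apply: balY.
Qed.

Definition strands (v : node) : seq (label * label) :=
  match v with
  | Pt a b => [:: (a, b)]
  | Vi a b c d | Cl _ a b c d => [:: (a, c); (b, d)]
  end.

Lemma orient_strands C Y : unzip1 Y = flatten (map strands C) ->
  exists2 X, unzip1 X = C & forall l, flux X l = \sum_(y <- Y) edge_flux l y.
Proof.
elim: C Y => [|v C IHC] Y; first by case: Y => // _; exists [::] => // l;
  rewrite flux_nil big_nil.
have extend s Y1 Y2 : unzip1 Y2 = flatten (map strands C) ->
    (forall l, \sum_(e <- directed_ends (v,
      s)) direction l e = \sum_(y <- Y1) edge_flux l y) ->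
    exists2 X, unzip1 X = v :: C & forall l, flux X l = \sum_(y <- Y1 ++ Y2) edge_flux l y.
  move=> /IHC[X <- fluxX] flux_v; exists ((v, s) :: X) => // l.
  by rewrite flux_cons big_cat flux_v fluxX.
case: v extend => [a b | a b c d | o a b c d] extend /=.
- case: Y => [|[e p] Y] //= [-> /extend extY]; apply: (extY (p, p) [:: ((a, b), p)]) => l.
  by rewrite !big_cons !big_nil /edge_flux /=; ring.
- case: Y => [|[e p] [|[e' q] Y]] //= [-> -> /extend extY].
  apply: (extY (p, q) [:: ((a, c), p); ((b, d), q)]) => l.
  by rewrite !big_cons !big_nil /edge_flux /=; ring.
case: Y => [|[e p] [|[e' q] Y]] //= [-> -> /extend extY].
apply: (extY (p, q) [:: ((a, c), p); ((b, d), q)]) => l.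
by rewrite !big_cons !big_nil /edge_flux /=; ring.
Qed.

Lemma flux_parity X l : exists k : int,
  flux X l = (count_mem l (labels (unzip1 X)))%:Z - 2 * k.
Proof.
elim: X => [|v X [k IHX]]; first by exists 0; rewrite flux_nil.
rewrite flux_cons IHX /= labels_cons count_cat -directed_endsE PoszD.
have [j ->] : exists j : int, \sum_(e <- directed_ends v) direction l e
    = (count_mem l (unzip1 (directed_ends v)))%:Z - 2 * j.
  elim: (directed_ends v) => [|[w b] s [j IHs]]; first by exists 0; rewrite big_nil.
  rewrite big_cons IHs /= /direction /= PoszD.
  case: eqP => _; last by exists j; rewrite add0r.
  by case: b; [exists j | exists (j + 1)] => /=; ring.
by exists (j + k); ring.
Qed.

(** Strands are the edges of a multigraph on the labels. Every label has degree two, so an imbalance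
    of absolute value at most one is even, hence zero. *)
Lemma orientation_exists C : closed_code C -> exists2 X, unzip1 X = C & is_oriented X.
Proof.
move=> C_closed; have [Y defY balY] := balanceable_all (flatten (map strands C)).
have [X defX fluxX] := orient_strands defY; exists X => // l.
have [l_C|l_C] := boolP (l \in labels (unzip1 X)); last exact: flux_notin.
have := balY l; rewrite -fluxX; have [k ->] := flux_parity X l.
have -> : count_mem l (labels (unzip1 X)) = 2 by rewrite closed_count // defX.
by rewrite ler_norml => /andP[]; lia.
Qed.

(** * Counting the colourings of a state *)

Section SumTuple.
Variables (R : comPzRingType) (I : finZmodType).

Definition assign (ls : seq label) (t : seq I) (h : label -> I) : label -> I :=
  fun l => nth (h l) t (index l ls).

Lemma sum_tuple_cons n (G : n.+1.-tuple I -> R) :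
  \sum_t G t = \sum_i \sum_(t : n.-tuple I) G [tuple of i :: t].
Proof.
rewrite pair_bigA (reindex (fun p : I * n.-tuple I => [tuple of p.1 :: p.2])) //=.
exists (fun t => (thead t, [tuple of behead t])) => [[i t] _ | t _] /=.
  by rewrite theadE; congr (_, _); apply: val_inj.
by rewrite -tuple_eta.
Qed.

Lemma sum_over_tuple (ls : seq label) (G : (label -> I) -> R) h : uniq ls ->
  sum_over ls G h = \sum_(t : (size ls).-tuple I) G (assign ls t h).
Proof.
elim: ls h => [|l ls IHls] h /=.
  move=> _; rewrite (big_pred1 [tuple]) => [|t]; last by rewrite [t]tuple0 /= eqxx.
  by congr G; apply: functional_extensionality => k; rewrite /assign nth_nil.
case/andP=> l_ls ls_uniq; rewrite sum_over_cons sum_tuple_cons; apply: eq_bigr => i _.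
rewrite IHls //; apply: eq_bigr => t _; congr G; apply: functional_extensionality => k.
rewrite /assign /recolor /=; have [<-|//] := eqVneq l k.
by rewrite nth_default // size_tuple memNindex.
Qed.

End SumTuple.

Lemma card_class_functions (T I : finType) (e : rel T) : connect_sym e ->
  #|[pred f : {ffun T -> I} | [forall x, forall y, e x y ==> (f x == f y)]]|
  = (#|I| ^ n_comp e predT)%N.
Proof.
move=> e_sym; set k := n_comp e predT.
have root_in y : fingraph.root e y \in predI (roots e) predT by rewrite inE andbT
  roots_root.
pose rank y : 'I_k := enum_rank_in (root_in y) (fingraph.root e y).
have rankE y : enum_val (rank y) = fingraph.root e y by rewrite enum_rankK_in.
pose phi (g : {ffun 'I_k -> I}) : {ffun T -> I} := [ffun y => g (rank y)].
rewrite -[k in RHS]card_ord -card_ffun -(card_imset _ (f := phi)); last first.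
  move=> g1 g2 /ffunP eq_phi; apply/ffunP=> a; have := eq_phi (enum_val a).
  rewrite !ffunE; suff -> : rank (enum_val a) = a by [].
  apply: enum_val_inj; rewrite rankE; have := enum_valP a.
  by rewrite inE andbT => /eqP.
apply: eq_card => f; rewrite !inE; apply/forallP/imsetP => [f_const | [g _ ->] y].
  have f_root y : f (fingraph.root e y) = f y.
    have /connectP[p ep ->] := connect_root e y.
    elim: p y ep => //= z p IHp y /andP[eyz /IHp ->].
    by have /forallP/(_ z)/implyP/(_ eyz)/eqP-> := f_const y.
  exists [ffun a => f (enum_val a)] => //.
  by apply/ffunP=> y; rewrite !ffunE rankE f_root.
apply/forallP=> z; apply/implyP=> eyz; rewrite !ffunE.
have eq_root : fingraph.root e y = fingraph.root e z by apply/(fingraph.rootP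
  e_sym)/connect1.
by apply/eqP; congr (g _); apply: enum_val_inj; rewrite !rankE.
Qed.

Definition consistent (I : eqType) (S : code) (h : label -> I) : bool :=
  all (fun v => if v is Pt a b then h a == h b else true) S.

Section StateCount.
Variables (S : code).
Hypothesis S_marks : crossingless S.

Let ls := undup (labels S).
Let m := size ls.
Let lab (i : 'I_m) : label := nth 0%N ls i.
Let share (i j : 'I_m) := has (fun v => (lab i \in ends v) && (lab j \in ends v)) S.

Lemma mark_ends v : v \in S -> exists a b, v = Pt a b.
Proof. by move/(allP S_marks); case: v => // a b _; exists a, b. Qed.

Lemma lab_in i : lab i \in labels S.
Proof. by rewrite -mem_undup mem_nth. Qed.

Lemma labelsP (l : label) : reflect (exists2 v, v \in S & l \in ends v) (l \in labels S).
Proof.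
by apply: (iffP flatten_mapP) => -[v]; exists v.
Qed.

Lemma lab_onto (l : label) : l \in labels S -> exists i, lab i = l.
Proof.
move=> l_S; have lt_l : (index l ls < m)%N by rewrite index_mem mem_undup.
by exists (Ordinal lt_l); rewrite /lab nth_index // mem_undup.
Qed.

Lemma share_sym : connect_sym share.
Proof. by apply: sym_connect_sym => i j; apply: eq_has => v; rewrite andbC. Qed.

Lemma consistentP (I : eqType) (h : label -> I) :
  reflect (forall i j, share i j -> h (lab i) = h (lab j)) (consistent S h).
Proof.
apply: (iffP allP) => [h_cons i j /hasP[v v_S] | h_share v v_S].
  have [a [b def_v]] := mark_ends v_S; have := h_cons v v_S; rewrite def_v => /eqP eq_h.
  by rewrite /= !inE => /andP[/orP[]/eqP-> /orP[]/eqP->].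
have [a [b def_v]] := mark_ends v_S; rewrite def_v.
have a_v : a \in ends v by rewrite def_v mem_head.
have b_v : b \in ends v by rewrite def_v !inE eqxx orbT.
have [i lab_i] : exists i, lab i = a by apply/lab_onto/labelsP; exists v.
have [j lab_j] : exists j, lab j = b by apply/lab_onto/labelsP; exists v.
rewrite -lab_i -lab_j; apply/eqP/h_share/hasP; exists v => //.
by rewrite lab_i lab_j a_v.
Qed.

Lemma adjacent_sym : connect_sym (@adjacent S).
Proof.
apply: sym_connect_sym => i j; apply/hasP/hasP => -[l l_i l_j]; exists l => //.
Qed.

Lemma adjacent_share l i j :
  l \in ends (tnth (in_tuple S) i) -> l \in ends (tnth (in_tuple S) j) -> adjacent i j.
Proof. by move=> l_i l_j; apply/hasP; exists l. Qed.

(** Marks and labels are the two sides of one incidence graph, and each component meets both; [nd]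
    and [rep] pass from one side to the other. *)
Lemma n_comp_share : n_comp share predT = components S.
Proof.
have /fin_all_exists[nd ndP] (i : 'I_m) : exists j, lab i \in ends (tnth (in_tuple S) j).
  have /labelsP[v v_S lab_v] := lab_in i; have /tnthP[j def_v] : v \in in_tuple S by [].
  by exists j; rewrite -def_v.
have /fin_all_exists[rep repP] (j : 'I_(size S)) : exists i,
  lab i \in ends (tnth (in_tuple S) j).
  have v_S := mem_tnth j (in_tuple S); have [a [b def_v]] := mark_ends v_S.
  have [i lab_i] : exists i, lab i = a.
    by apply/lab_onto/labelsP; exists (tnth (in_tuple S) j); rewrite // def_v mem_head.
  by exists i; rewrite lab_i def_v mem_head.
have share_node j i1 i2 : lab i1 \in ends (tnth (in_tuple S) j) ->
    lab i2 \in ends (tnth (in_tuple S) j) -> share i1 i2.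
  by move=> l1 l2; apply/hasP; exists (tnth (in_tuple S) j); rewrite ?mem_tnth ?l1.
rewrite (@adjunction_n_comp _ _ rep _ _ share_sym adjacent_sym predT) //.
apply: (intro_adjunction adjacent_sym _ (fun i _ => nd i)) => // [i _ | j _].
  split=> [|i' _ /hasP[v v_S /andP[lab_i lab_i']]].
    by apply/connect1/(share_node (nd i)).
  have /tnthP[j def_v] : v \in in_tuple S by [].
  rewrite def_v in lab_i lab_i'; apply: (connect_trans (y := j)); apply/connect1.
    exact: adjacent_share lab_i.
  exact: adjacent_share lab_i' _.
split=> [|j' /hasP[l l_j l_j']].
  by apply/connect1/adjacent_share/ndP; apply: repP.
have [i lab_i] : exists i, lab i = l.
  by apply/lab_onto/labelsP; exists (tnth (in_tuple S) j); rewrite ?mem_tnth.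
rewrite -lab_i in l_j l_j'.
by apply: (connect_trans (y := i)); apply/connect1;
  [apply: (share_node j) | apply: (share_node j')].
Qed.

Lemma sum_over_consistent (R : comPzRingType) (I : finZmodType) (h : label -> I) :
  sum_over ls (fun h : label -> I => (consistent S h)%:R) h = (#|I| ^ components S)%:R :> R.
Proof.
rewrite sum_over_tuple ?undup_uniq // -n_comp_share -(card_class_functions I share_sym).
rewrite -sum1_card natr_sum [RHS]big_mkcond.
rewrite (reindex (fun f : {ffun 'I_m -> I} => [tuple f i | i < m])) /=; last first.
  exists (fun t => [ffun i => tnth t i]) => [f _ | t _].
    by apply/ffunP=> i; rewrite ffunE tnth_mktuple.
  by apply: eq_from_tnth => i; rewrite tnth_mktuple ffunE.
apply: eq_bigr => f _; rewrite inE.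
have assignE i : assign ls [tuple f i | i < m] h (lab i) = f i.
  by rewrite /assign index_uniq ?undup_uniq // -tnth_nth tnth_mktuple.
suff -> : consistent S (assign ls [tuple f i | i < m] h) =
    [forall i, forall j, share i j ==> (f i == f j)] by case: [forall i, _].
apply/consistentP/forallP=> [h_share i | f_share i j ij].
  by apply/forallP=> j; apply/implyP=> /h_share; rewrite !assignE => ->.
by rewrite !assignE; have /forallP/(_ j)/implyP/(_ ij)/eqP := f_share i.
Qed.

(** A graph has at least as many components as vertices minus edges: each mark imposes one linear
    equation, and the functions satisfying all of them are class functions. *)
Lemma components_ge : (m - size S <= components S)%N.
Proof.
rewrite -n_comp_share -(rank_class_mx share_sym) -[X in (X - _)%N]card_ord.
pose M : 'M[rat]_(#|'I_m|, size S) := \matrix_(i, j)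
  if tnth (in_tuple S) j is Pt a b
  then (lab (enum_val i) == a)%:R - (lab (enum_val i) == b)%:R else 0.
apply: leq_trans (mxrankS (_ : kermx M <= _)%MS); last first.
  apply/row_subP=> k; have /sub_kermxP := row_sub k (kermx M).
  move: (row _ _) => w wM; apply/(class_mxP share_sym).
  have w_const j i1 i2 : lab i1 \in ends (tnth (in_tuple S) j) ->
      lab i2 \in ends (tnth (in_tuple S) j) -> w 0 (enum_rank i1) = w 0 (enum_rank i2).
    have [a [b def_v]] := mark_ends (mem_tnth j (in_tuple S)).
    have := congr1 (fun A : 'M[rat]_(1, size S) => A 0 j) wM; rewrite !mxE.
    under eq_bigr do rewrite mxE def_v mulrBr.
    rewrite sumrB; move/eqP; rewrite subr_eq0 def_v => /eqP w_eq.
    have sum_w i c : lab i = c -> \sum_k0 w 0 k0 * (lab (enum_val k0) == c)%:R = w 0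
      (enum_rank i).
      move=> <-; rewrite (bigD1 (enum_rank i)) //= enum_rankK eqxx mulr1 big1 ?addr0 //
        => k0 neq_k0.
      rewrite /lab nth_uniq ?undup_uniq //; case: eqP => [/val_inj eq_i|];
        last by rewrite mulr0.
      by rewrite -eq_i enum_valK eqxx in neq_k0.
    rewrite /= !inE => /orP[]/eqP lab1 /orP[]/eqP lab2;
      by rewrite -?(sum_w _ _ lab1) -?(sum_w _ _ lab2) ?w_eq.
  move=> i j /hasP[v v_S /andP[lab_i lab_j]];
    have /tnthP[k0 def_v] : v \in in_tuple S by [].
  by rewrite def_v in lab_i lab_j; apply: w_const lab_j.
by rewrite mxrank_ker leq_sub2l // rank_leq_col.
Qed.

Lemma connect_consistent (I : eqType) (h : label -> I) i j k l : consistent S h ->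
  connect (@adjacent S) i j -> k \in ends (tnth (in_tuple S) i) ->
  l \in ends (tnth (in_tuple S) j) -> h k = h l.
Proof.
move=> /allP h_cons; have node_const i' k' l' : k' \in ends (tnth (in_tuple S) i') ->
    l' \in ends (tnth (in_tuple S) i') -> h k' = h l'.
  have [a [b def_v]] := mark_ends (mem_tnth i' (in_tuple S)).
  have := h_cons _ (mem_tnth i' (in_tuple S)); rewrite def_v => /eqP eq_h.
  by rewrite /= !inE => /orP[]/eqP-> /orP[]/eqP->.
case/connectP=> p ip ->; elim: p i k ip => [|i' p IHp] i k /=; first by move=> _;
  apply: node_const.
case/andP=> /hasP[k' k'_i' k'_i] ip k_i l_j.
by rewrite (node_const i k k') //; apply: (IHp i' k').
Qed.

Lemma joinedP k l : reflect (exists i j, [/\ k \in ends (tnth (in_tuple S) i),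
   l \in ends (tnth (in_tuple S) j) & connect (@adjacent S) i j]) (joined S k l).
Proof.
apply: (iffP existsP) => [[i /existsP[j /and3P[k_i l_j ij]]] | [i [j [k_i l_j ij]]]].
  by exists i, j.
by exists i; apply/existsP; exists j; apply/and3P.
Qed.

Lemma joined_refl k : k \in labels S -> joined S k k.
Proof.
case/labelsP=> v v_S k_v; have /tnthP[i def_v] : v \in in_tuple S by [].
by apply/joinedP; exists i, i; rewrite -def_v.
Qed.

Lemma joined_sym k l : joined S k l = joined S l k.
Proof.
by apply/joinedP/joinedP => -[i [j [k_i l_j ij]]]; exists j, i; rewrite adjacent_sym.
Qed.

Lemma joined_trans k l n : joined S k l -> joined S l n -> joined S k n.
Proof.
move=> /joinedP[i [j [k_i l_j ij]]] /joinedP[i' [j' [l_i' n_j' ij']]].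
apply/joinedP; exists i, j'; split=> //; apply: connect_trans ij (connect_trans _ ij').
exact/connect1/(adjacent_share l_j).
Qed.

Lemma joined_mark k a b : Pt a b \in S -> joined S k a = joined S k b.
Proof.
have ab : Pt a b \in S -> joined S a b.
  move=> ab_S; have /tnthP[i def_v] : Pt a b \in in_tuple S by [].
  by apply/joinedP; exists i, i; rewrite -def_v !inE !eqxx orbT.
move=> /ab ab_j; apply/idP/idP=> k_j; first exact: joined_trans k_j ab_j.
by apply: joined_trans k_j _; rewrite joined_sym.
Qed.

Lemma joined_consistent (I : eqType) (h : label -> I) k l :
  consistent S h -> joined S k l -> h k = h l.
Proof.
by move=> h_cons /joinedP[i [j [k_i l_j ij]]]; apply: connect_consistent ij k_i l_j.
Qed.

End StateCount.

Lemma closed_double C : closed_code C ->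
  perm_eq (labels C) (undup (labels C) ++ undup (labels C)).
Proof.
move=> C_closed.
apply/allP=> l; rewrite !mem_cat !mem_undup !orbb => l_C.
have := count_uniq_mem l (undup_uniq (labels C)); rewrite mem_undup l_C /= => count1.
by rewrite count_cat closed_count // !count1.
Qed.

Lemma crossingless_even S (X : pred label) : crossingless S ->
  (forall a b, Pt a b \in S -> X a = X b) -> ~~ odd (count X (labels S)).
Proof.
elim: S => //= w S IHS /andP[w_mark S_marks] X_S.
rewrite labels_cons count_cat oddD (negbTE (IHS _ _)) // => [|a b ab]; last first.
  by apply: X_S; rewrite inE ab orbT.
case: w w_mark X_S => // a b _ X_S.
by rewrite /= (X_S a b (mem_head _ _)) addn0 addnn odd_double.
Qed.

Lemma crossingless_size S : crossingless S -> size (labels S) = (size S).*2.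
Proof.
by elim: S => //= w S IHS /andP[w_mark /IHS sizeS]; rewrite labels_cons size_cat sizeS;
  case: w w_mark.
Qed.

(** * Crossingless tangles with four ends *)

Section PairedEnds.
Variables (S : code) (u v u' v' : label).
Hypotheses (S_marks : crossingless S) (ends_uniq : uniq [:: u; v; u'; v'])
  (S_closed : closed_code [:: Pt u v, Pt u' v' & S]).

Let ends_in l : l \in [:: u; v; u'; v'] -> l \in labels S.
Proof.
move=> l_end; have l_in : l \in labels [:: Pt u v, Pt u' v' & S].
  by rewrite !labels_cons catA mem_cat l_end.
have := closed_count S_closed l_in; rewrite !labels_cons catA count_cat.
rewrite (count_uniq_mem _ ends_uniq) l_end add1n => -[count_l].
by rewrite -has_pred1 has_count count_l.
Qed.

(** In the closure by two marks every label occurs twice, so [S] has exactly two more labels than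
    marks. *)
Lemma components_ge2 : (2 <= components S)%N.
Proof.
apply: leq_trans (components_ge S_marks).
suff : (size (undup (labels S))).*2 = (size S).*2 + 4 by lia.
have := perm_size (closed_double S_closed).
have -> : size (labels [:: Pt u v, Pt u' v' & S]) = (size S).*2 + 4.
  by rewrite !labels_cons !size_cat crossingless_size //=; lia.
rewrite size_cat addnn => ->.
congr (_.*2); apply/perm_size/uniq_perm; rewrite ?undup_uniq // => l.
rewrite !mem_undup -[RHS]/(l \in [:: u; v; u'; v'] ++ labels S) mem_cat.
by case: (boolP (l \in [:: u; v; u'; v'])) => [/ends_in|].
Qed.

(** A union of components has an even number of loose ends: every label in it has two ends, and
    every mark uses up none or two. *)
Lemma ends_even (X : pred label) : (forall a b, Pt a b \in S -> X a = X b) ->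
  X u (+) X v = X u' (+) X v'.
Proof.
move=> X_S; have /negbTE S_even := crossingless_even S_marks X_S.
have : ~~ odd (count X (labels [:: Pt u v, Pt u' v' & S])).
  by rewrite (permP (closed_double S_closed)) count_cat addnn odd_double.
rewrite !labels_cons catA count_cat oddD S_even /=.
by case: (X u); case: (X v); case: (X u'); case: (X v').
Qed.

Lemma joined_pairs : joined S u v -> joined S u' v'.
Proof.
move=> uv; have even_u := ends_even (@joined_mark S u).
have even_u' := ends_even (@joined_mark S u').
have u'_S : u' \in labels S by apply: ends_in; rewrite !inE eqxx !orbT.
have u_S : u \in labels S by apply: ends_in; rewrite !inE eqxx.
rewrite uv joined_refl // in even_u; rewrite joined_refl // in even_u'.
have [uu'|uu'] := boolP (joined S u u').
  apply: (joined_trans (l := u)); first by rewrite joined_sym.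
  by move: even_u; rewrite uu'; case: (joined S u v').
have u'u : joined S u' u = false by rewrite joined_sym (negbTE uu').
have u'v : joined S u' v = false.
  apply: contraNF uu' => u'v; apply: joined_trans uv _; by rewrite joined_sym.
by move: even_u'; rewrite u'u u'v; case: (joined S u' v').
Qed.

Variables (R : comPzRingType) (I : finComNzRingType) (k : I).
Hypotheses (k_neq0 : k != 0) (k_double : k + k = 0).

(* If u and v are not joined, shifting by k the colours of the component of u, which
   contains exactly one of u' and v', exchanges the two sums. *)
Lemma paired_sum :
  sum_over (undup (labels S)) (fun h : label -> I =>
     [&& h u == h v, h u' == h v' & consistent S h]%:R -
     [&& h u == h v + k, h u' == h v' + k & consistent S h]%:R) (fun=> 0) =
  if same_joins S [:: Pt u v; Pt u' v'] then (#|I| ^ components S)%:R else 0 :> R.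
Proof.
rewrite /same_joins /= andbT; have [uv|uv] /= := boolP (joined S u v).
  rewrite joined_pairs // -(sum_over_consistent S_marks R (fun=> 0)).
  apply: eq_sum_over => h; have [h_cons|] := boolP (consistent S h);
    last by rewrite !andbF subrr.
  rewrite !(joined_consistent S_marks h_cons uv,
    joined_consistent S_marks h_cons (joined_pairs uv)).
  by rewrite !eqxx /= eq_sym -subr_eq0 addrAC subrr add0r (negbTE k_neq0) subr0.
have u_S : u \in labels S by apply: ends_in; rewrite !inE eqxx.
have kN : - k = k by apply/eqP; rewrite eq_sym -subr_eq0 opprK k_double.
pose m l : I := if joined S u l then k else 0.
rewrite sum_overB; apply/eqP; rewrite subr_eq0; apply/eqP.
have cons_shift (h : label -> I) : consistent S (fun l => h l - m l) = consistent S h.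
  apply: eq_in_all => w w_S; have [p [q def_w]] := mark_ends S_marks w_S.
  by rewrite def_w in w_S *; rewrite /m (joined_mark u w_S) (inj_eq (@subIr I _)).
pose G (h : label -> I) : R := [&& h u == h v, h u' == h v' & consistent S h]%:R.
transitivity (sum_over (undup (labels S)) (fun h => G (fun l => h l - m l)) (fun=> 0)).
  rewrite sum_over_shift; apply: sum_over_base => h h' eq_h.
  have in_undup l : l \in labels S -> h l = h' l by move=> l_S; rewrite eq_h // mem_undup.
  rewrite /G !in_undup //; try by apply: ends_in; rewrite !inE eqxx ?orbT.
  congr (nat_of_bool [&& _, _ & _])%:R; apply: eq_in_all => w w_S.
  have [p [q def_w]] := mark_ends S_marks w_S; rewrite def_w in w_S *.
  by rewrite !in_undup //; apply/labelsP; exists (Pt p q); rewrite ?inE ?eqxx ?orbT.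
apply: eq_sum_over => h; rewrite /G cons_shift /m joined_refl // (negbTE uv) subr0.
have := ends_even (@joined_mark S u); rewrite joined_refl // (negbTE uv) subr_eq.
case: (joined S u u'); case: (joined S u v') => //= _; rewrite subr0;
  first by rewrite subr_eq.
by rewrite kN.
Qed.

End PairedEnds.

(** * Specialization of the bracket variable *)

(* The states of [C], with the exponent of the coefficient shifted by [size C]. *)
Fixpoint state_exponents (C : code) : seq (nat * code) :=
  match C with
  | [::] => [:: (0%N, [::])]
  | Cl o a b c d :: C' =>
      [seq (e.1.+2, A_smoothing o a b c d ++ e.2) | e <- state_exponents C'] ++
      [seq (e.1, B_smoothing o a b c d ++ e.2) | e <- state_exponents C']
  | Vi a b c d :: C' => [seq (e.1.+1, [:: Pt a c, Pt b d & e.2]) | e <- state_exponents C']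
  | Pt a b :: C' => [seq (e.1.+1, Pt a b :: e.2) | e <- state_exponents C']
  end.

Lemma A_neq0 : A != 0.
Proof. by rewrite tofrac_eq0 polyX_eq0. Qed.

Section ExponentShift.
Variables (K : fieldType) (y : K) (e n : nat).
Hypothesis y_neq0 : y != 0.

Lemma exp_shift2 : y * (y ^+ e / y ^+ n) = y ^+ e.+2 / y ^+ n.+1.
Proof. by rewrite !exprS; field; rewrite y_neq0 expf_neq0. Qed.

Lemma exp_shift1 : y ^+ e / y ^+ n = y ^+ e.+1 / y ^+ n.+1.
Proof. by rewrite !exprS; field; rewrite y_neq0 expf_neq0. Qed.

Lemma exp_shift0 : y^-1 * (y ^+ e / y ^+ n) = y ^+ e / y ^+ n.+1.
Proof. by rewrite !exprS; field; rewrite y_neq0 expf_neq0. Qed.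

End ExponentShift.

Lemma states_exponents C :
  states C = [seq (A ^+ e.1 / A ^+ size C, e.2) | e <- state_exponents C].
Proof.
elim: C => [|v C IHC] /=; first by rewrite expr0 divr1.
case: v => [a b | a b c d | o a b c d]; rewrite IHC ?map_cat -!map_comp;
  [ | | congr (_ ++ _)]; apply: eq_map => e; rewrite [RHS]/= [LHS]/=.
- by rewrite (exp_shift1 _ _ A_neq0).
- by rewrite (exp_shift1 _ _ A_neq0).
- by rewrite (exp_shift2 _ _ A_neq0).
by rewrite (exp_shift0 _ _ A_neq0).
Qed.

Lemma state_exponents_spec C e : e \in state_exponents C ->
  crossingless e.2 /\ perm_eq (labels e.2) (labels C).
Proof.
elim: C e => [|v C IHC] e /=; first by rewrite inE => /eqP->.
case: v => [a b | a b c d | o a b c d]; rewrite ?mem_cat => e_in.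
- have /mapP[e' /IHC[marks' perm'] ->] := e_in; split=> //.
  by rewrite !labels_cons /= !perm_cons.
- have /mapP[e' /IHC[marks' perm'] ->] := e_in; split=> //.
  apply: perm_trans (_ : perm_eq _ ([:: a; b; c; d] ++ labels e'.2)) _;
    first by perm_labels.
  by rewrite perm_cat2l.
have smooth o' e' : e' \in state_exponents C ->
    crossingless (A_smoothing o' a b c d ++ e'.2) /\
    perm_eq (labels (A_smoothing o' a b c d ++ e'.2)) (labels (Cl o a b c d :: C)).
  move=> /IHC[marks' perm']; split; first by rewrite /crossingless all_cat; case: o'.
  apply: perm_trans (_ : perm_eq _ ([:: a; b; c; d] ++ labels e'.2)) _;
    last by rewrite perm_cat2l.
  by case: o'; perm_labels.
case/orP: e_in => /mapP[e' e'_C ->]; first exact: smooth.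
by have := smooth (~~ o) e' e'_C; case: (o).
Qed.

(** The value of [tangle_coef] at [A = y]. Evaluation is not defined on the whole fraction field, so
    the formula is written again over the exponents, for an arbitrary field. *)
Definition tangle_poly_coef (K : fieldType) (y : K) (T E : code) : K :=
  \sum_(e <- state_exponents T | same_joins e.2 E)
    y ^+ e.1 / y ^+ size T * (- y ^+ 2 - y ^- 2) ^+ (components e.2 - size E).

Lemma tangle_coefE T E : tangle_coef T E = tangle_poly_coef A T E.
Proof. by rewrite /tangle_coef states_exponents big_map. Qed.

Lemma tangle_coef_poly T E : exists (P : {poly int}) (n : nat),
  forall (K : fieldType) (y : K),
  y != 0 -> (map_poly intr P).[y] = y ^+ n * tangle_poly_coef y T E.
Proof.
pose k (e : nat * code) := (components e.2 - size E)%N.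
(* Any common bound for the exponents [k e] would do; it serves to clear the denominators [y ^+ 2]
   of the loop factors. *)
pose M := (\sum_(e <- state_exponents T) k e)%N.
exists (\sum_(e <- state_exponents T | same_joins e.2 E)
   'X^(e.1) * ('X^2) ^+ (M - k e) * (- 'X^4 - 1) ^+ k e), (size T + 2 * M)%N => K y y0.
rewrite rmorph_sum horner_sum /tangle_poly_coef big_distrr /= big_seq_cond
  [RHS]big_seq_cond.
apply: eq_bigr => e /andP[e_T _].
have XE : map_poly intr 'X = 'X :> {poly K} by rewrite map_polyX.
rewrite exprD [y ^+ (2 * M)]exprM !rmorphM !rmorphXn rmorphB rmorphN !rmorphXn rmorph1 /=
  XE.
rewrite !(hornerM, horner_exp, hornerD, hornerN, hornerC, hornerX).
have le_kM : (k e <= M)%N.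
  by rewrite /M (big_rem e) //= leq_addr.
have yk (j : nat) : y ^+ j != 0 by rewrite expf_neq0.
have -> : - y ^+ 2 - y ^- 2 = (- y ^+ 4 - 1) / y ^+ 2 by field.
rewrite -/(k e) expr_div_n; have [j ->] : exists j, M = (j + k e)%N.
  by exists (M - k e)%N; rewrite subnK.
rewrite addnK !exprD.
have := yk (size T); have : (y ^+ 2) ^+ k e != 0 by rewrite expf_neq0.
by move=> yk0 yT0; field; rewrite yk0 yT0.
Qed.

Lemma tangle_coef_specialize T E : tangle_coef T E != 0 ->
  exists (n : nat) (x : algC), [/\ (0 < n)%N, x != 0, (4 * n)%:R = - x ^+ 2 - x ^- 2
    & tangle_poly_coef x T E != 0].
Proof.
rewrite tangle_coefE => coef0; have [P [N PE]] := tangle_coef_poly T E.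
have P0 : P != 0.
  apply: contraNneq coef0 => P0; have := PE _ _ A_neq0.
  rewrite P0 rmorph0 horner0 => /esym/eqP; rewrite mulf_eq0 => /orP[|//].
  by rewrite expf_eq0 (negbTE A_neq0) andbF.
pose Q : {poly algC} := map_poly intr P.
have Q0 : Q != 0 by rewrite map_poly_eq0_id0 // intr_eq0 lead_coef_eq0.
(* The square [u] of this number is a root of [u ^+ 2 + 4 n u + 1], which is the loop equation
   multiplied by [u]. *)
pose y (n : nat) : algC :=
  sqrtC ((sqrtC ((4 * n)%:R ^+ 2 - 4) - (4 * n)%:R) / 2).
have yP n : y n != 0 /\ (4 * n)%:R = - y n ^+ 2 - y n ^- 2.
  pose q : algC := (4 * n)%:R; pose s := sqrtC (q ^+ 2 - 4).
  pose u := (s - q) / 2.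
  have s2 : s ^+ 2 = q ^+ 2 - 4 by rewrite sqrtCK.
  have u_eq : u ^+ 2 + q * u + 1 = 0.
    have -> : u ^+ 2 + q * u + 1 = (s ^+ 2 - q ^+ 2) / 4 + 1 by rewrite /u; field.
    by rewrite s2; field.
  have u0 : u != 0.
    apply/eqP=> u0; move: u_eq; rewrite u0 expr0n mulr0 !add0r => /eqP.
    by rewrite oner_eq0.
  rewrite /y -/q -/s -/u sqrtC_eq0 sqrtCK; split=> //.
  apply: (mulIf u0); rewrite mulrDl mulNr mulNr mulVf //.
  by apply/eqP; rewrite -subr_eq0 -u_eq; apply/eqP; ring.
have y_inj : injective y.
  move=> n1 n2 eq_y; have /eqP : (4 * n1)%:R = (4 * n2)%:R :> algC.
    by rewrite (yP n1).2 (yP n2).2 eq_y.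
  by rewrite eqr_nat eqn_pmul2l // => /eqP.
(* Since [n] can be read off from [y n], these are [size Q] distinct numbers, more than [Q] has
   roots. Starting at 1 keeps the ring nonempty. *)
have [n n_in y_root] : exists2 n, n \in iota 1 (size Q) & ~~ root Q (y n).
  apply/hasP; rewrite has_predC; apply/negP=> all_roots.
  have uniq_roots : uniq (map y (iota 1 (size Q))) by rewrite map_inj_uniq ?iota_uniq.
  have := max_poly_roots Q0 _ uniq_roots;
    rewrite size_map size_iota ltnn => /(_ _)/negP[] //.
  by rewrite all_map.
have [y0 y_loop] := yP n; exists n, (y n); split=> //.
  by move: n_in; rewrite mem_iota => /andP[].
by apply: contraNneq y_root => coef_y; rewrite /root PE // coef_y mulr0.
Qed.

(** * The state sum of a virtualized diagram *)

Section StateExpansion.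
Variables (F : fieldType) (x : F) (I : finComNzRingType).
Hypothesis (x_neq0 : x != 0).

Lemma code_weight_states X (h : label -> I) :
  code_weight x 0 X h =
  \sum_(e <- state_exponents (unzip1 X)) x ^+ e.1 / x ^+ size X * (consistent e.2 h)%:R.
Proof.
have xk (k : nat) : x ^+ k != 0 by rewrite expf_neq0.
elim: X => [|[v [p q]] X IHX] /=.
  by rewrite /code_weight big_nil big_seq1 /= expr0 divr1 mulr1.
rewrite code_weight_cons IHX /weight /=.
case: v => [a b | a b c d | o a b c d]; rewrite ?big_cat !big_map big_distrr /=.
- apply: eq_bigr => e _; rewrite -mulnb natrM !exprS; field.
  by rewrite x_neq0 xk.
- apply: eq_bigr => e _; rewrite -!mulnb !natrM !exprS; field.
  by rewrite x_neq0 xk.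
rewrite -big_split; apply: eq_bigr => e _ /=; rewrite !mul0rn !subr0 /crossing_weight.
by case: o; rewrite /= -!mulnb !natrM !exprS; field; rewrite x_neq0 xk.
Qed.

End StateExpansion.

Section Virtualized.
Variables (F : fieldType) (x : F) (I : finComNzRingType) (kappa : I).
Hypotheses (x_neq0 : x != 0) (loop_eq : #|I|%:R = - x ^+ 2 - x ^- 2 :> F).
Hypotheses (loop_neq0 : #|I|%:R != 0 :> F) (kappa2 : kappa *+ 2 != 0) (kappa4 : kappa *+
  4 = 0).
Variables (o : bool) (a b c d : label) (p q : bool) (X : seq oriented_node).
Let T := unzip1 X.
Hypotheses (K_diagram : is_diagram (Cl o a b c d :: T)) (K_classical : classical (Cl o a
  b c d :: T))
  (four_ends : uniq [:: a; b; c; d]) (K_oriented : is_oriented ((Cl o a b c d, (p,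
    q)) :: X)).

(** When [p == q], the ends [a] and [b] both enter the crossing or both leave it, so pairing them is
    the smoothing against the orientation. A state of [T] pairing its ends in this same way closes
    up with that smoothing to two circles through the crossing. *)
Let partner : code := if p == q then smoothing_ab a b c d else smoothing_ad a b c d.

(* The crossing of K_v, seen from the four ends: it is the mirror image of [v]. *)
Let flipped : oriented_node := (Cl (~~ o) b a d c, (q, p)).

(** The weight of [flipped] once the Alexander numbering of K has been added to the colours. Because
    the cyclic order is reversed, the numbering no longer cancels the shifts of the crossing. *)
Let mirror_weight (kappa : I) (h : label -> I) : F :=
  crossing_weight x (~~ o) (h b + kappa *+ ~~ p - kappa *+ p) (h a + kappa *+ q - kappa
    *+ ~~ q)
     (h d + kappa *+ p - kappa *+ ~~ p) (h c + kappa *+ ~~ q - kappa *+ q).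

Let partner_coef : F := if (p == q) (+) o then x^-1 else x.

Let eq_same (i j k l : I) : i - j = k - l -> (i == j) = (k == l).
Proof. by rewrite -subr_eq0 -[k == l]subr_eq0 => ->. Qed.

Let eq_same4 (i j k l : I) : i - j = k - l + kappa *+ 4 -> (i == j) = (k == l).
Proof. by rewrite kappa4 addr0; apply: eq_same. Qed.

Let eq_opp (i j k l : I) : i - j = l - k -> (i == j) = (k == l).
Proof. by move/eq_same->; rewrite eq_sym. Qed.

Let eq_opp4 (i j k l : I) : i - j + kappa *+ 4 = l - k -> (i == j) = (k == l).
Proof. by rewrite kappa4 addr0; apply: eq_opp. Qed.

(** The residual shifts cancel along the smoothing that respects the orientation and amount to plus
    or minus [2 kappa] along each arc of the other one. The signs disappear because
    [4 kappa = 0]. *)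
Lemma mirror_weight_diff :
  exists u v u' v', [/\ perm_eq [:: u; v; u'; v'] [:: a; b; c; d], partner = [:: Pt u v;
    Pt u' v'] &
  forall h, mirror_weight 0 h - mirror_weight kappa h = partner_coef *
   (((h u == h v) && (h u' == h v'))%:R -
    ((h u == h v + kappa *+ 2) && (h u' == h v' + kappa *+ 2))%:R)].
Proof.
rewrite /partner /partner_coef /mirror_weight; case: p; case: q => /=.
- exists a, b, c, d; split=> // h.
  rewrite /crossing_weight !(mul0rn, mulr1n, mulr0n, addr0, subr0).
  rewrite (@eq_same (h b - kappa) (h c - kappa) (h b) (h c)); last by ring.
  rewrite (@eq_same (h a + kappa) (h d + kappa) (h a) (h d)); last by ring.
  rewrite (@eq_opp4 (h b - kappa) (h a + kappa) (h a) (h b + kappa *+ 2)); last by ring.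
  rewrite (@eq_opp (h d + kappa) (h c - kappa) (h c) (h d + kappa *+ 2)); last by ring.
  by rewrite (eq_sym (h b) (h a)) (eq_sym (h d) (h c)); case: o => /=; ring.
- exists a, d, b, c; split=> [|//|h]; first by perm_labels.
  rewrite /crossing_weight !(mul0rn, mulr1n, mulr0n, addr0, subr0).
  rewrite (@eq_same (h b - kappa) (h c + kappa) (h b) (h c + kappa *+ 2)); last by ring.
  rewrite (@eq_same (h a - kappa) (h d + kappa) (h a) (h d + kappa *+ 2)); last by ring.
  rewrite (@eq_same (h b - kappa) (h a - kappa) (h b) (h a)); last by ring.
  rewrite (@eq_same (h d + kappa) (h c + kappa) (h d) (h c)); last by ring.
  by rewrite ![(h a == _) && _]andbC; case: o => /=; ring.
- exists a, d, b, c; split=> [|//|h]; first by perm_labels.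
  rewrite /crossing_weight !(mul0rn, mulr1n, mulr0n, addr0, subr0).
  rewrite (@eq_same4 (h b + kappa) (h c - kappa) (h b) (h c + kappa *+ 2)); last by ring.
  rewrite (@eq_same4 (h a + kappa) (h d - kappa) (h a) (h d + kappa *+ 2)); last by ring.
  rewrite (@eq_same (h b + kappa) (h a + kappa) (h b) (h a)); last by ring.
  rewrite (@eq_same (h d - kappa) (h c - kappa) (h d) (h c)); last by ring.
  by rewrite ![(h a == _) && _]andbC; case: o => /=; ring.
exists a, b, c, d; split=> // h.
rewrite /crossing_weight !(mul0rn, mulr1n, mulr0n, addr0, subr0).
rewrite (@eq_same (h b + kappa) (h c + kappa) (h b) (h c)); last by ring.
rewrite (@eq_same (h a - kappa) (h d - kappa) (h a) (h d)); last by ring.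
rewrite (@eq_opp (h b + kappa) (h a - kappa) (h a) (h b + kappa *+ 2)); last by ring.
rewrite (@eq_opp4 (h d - kappa) (h c + kappa) (h c) (h d + kappa *+ 2)); last by ring.
by rewrite (eq_sym (h b) (h a)) (eq_sym (h d) (h c)); case: o => /=; ring.
Qed.

Lemma ends_in_tangle l : l \in [:: a; b; c; d] -> l \in labels T.
Proof.
move=> l_end; have [K_closed _] := andP K_diagram.
have l_K : l \in labels (Cl o a b c d :: T) by rewrite labels_cons mem_cat l_end.
have := closed_count K_closed l_K; rewrite labels_cons count_cat.
rewrite (count_uniq_mem _ four_ends) l_end add1n => -[count_l].
by rewrite -has_pred1 has_count count_l.
Qed.

(** The tangle belongs to K as well, so the Alexander numbering of K untwists it by a change of
    variables; the whole effect of [k] is concentrated at the crossing. *)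
Lemma mirror_state_sum k : state_sum x k (flipped :: X) =
  sum_over (undup (labels T)) (fun h => mirror_weight k h * code_weight x 0 X h) (fun=> 0).
Proof.
have [m K_alex] := @alexander_planar ((Cl o a b c d, (p,
  q)) :: X) K_diagram K_classical K_oriented.
have [t [ma mb mc md]] : alexander m (Cl o a b c d, (p, q)) by apply: K_alex;
  rewrite mem_head.
have X_alex : {in X, forall v, alexander m v} by move=> v v_X; apply: K_alex;
  rewrite inE v_X orbT.
rewrite /state_sum (@sum_over_perm _ _ _ (undup (labels T))); last first.
  apply: uniq_perm; rewrite ?undup_uniq // => l; rewrite !mem_undup.
  rewrite -[unzip1 (flipped :: X)]/(Cl (~~ o) b a d c :: T) labels_cons mem_cat.
  case: (boolP (l \in ends _)) => //= l_end; apply/esym/ends_in_tangle.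
  by move: l_end; rewrite /= !inE => /or4P[]/eqP->; rewrite eqxx ?orbT.
pose G h := mirror_weight k h * code_weight x 0 X h.
transitivity (sum_over (undup (labels T)) (fun h => G (fun l =>
  h l - k *~ m l)) (fun=> 0)); last first.
  rewrite sum_over_shift; apply: sum_over_base => h h' eq_h.
  have eq_T : {in labels T, h =1 h'} by move=> l l_T; apply: eq_h; rewrite mem_undup.
  rewrite /G (eq_code_weight _ _ eq_T); congr (_ * _); rewrite /mirror_weight.
  by rewrite !eq_T //; apply: ends_in_tangle; rewrite !inE eqxx ?orbT.
apply: eq_sum_over => h; rewrite code_weight_cons /G -(alexander_weight _ _ _ X_alex).
congr (_ * _); rewrite /weight /mirror_weight /= -(@crossing_weightB _ _ _ (k *~ t)) ma
  mb mc md.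
by congr crossing_weight; rewrite mulrzDr -?pmulrn; ring.
Qed.

(** State by state, [paired_sum] cancels everything except the states of [T] joining the ends as
    [partner] does. These add up to the coefficient times a unit and [#|I| ^ 2]. *)
Lemma virtualized_detects : tangle_poly_coef x T partner != 0 ->
  state_sum x kappa (flipped :: X) != state_sum x (0 : I) (flipped :: X).
Proof.
move=> coef0; rewrite eq_sym -subr_eq0 !mirror_state_sum -sum_overB.
have [u [v [u' [v' [ends_uv def_partner diff]]]]] := mirror_weight_diff.
have uv_uniq : uniq [:: u; v; u'; v'] by rewrite (perm_uniq ends_uv).
have [K_closed _] := andP K_diagram.
have state_closed e : e \in state_exponents T -> closed_code [:: Pt u v, Pt u' v' & e.2].
  move=> /state_exponents_spec[_ perm_e]; apply: closed_perm K_closed.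
  rewrite perm_sym -[labels _]/([:: u; v; u'; v'] ++ labels e.2).
  by apply: (perm_trans (_ : perm_eq _ ([:: u; v; u'; v'] ++ labels T)));
    rewrite ?perm_cat2l ?perm_cat2r.
suff -> : sum_over (undup (labels T)) (fun h : label -> I =>
  mirror_weight 0 h * code_weight x 0 X h -
    mirror_weight kappa h * code_weight x 0 X h) (fun=> 0) =
    partner_coef * #|I|%:R ^+ 2 * tangle_poly_coef x T partner.
  rewrite !mulf_neq0 ?expf_neq0 //; first by rewrite /partner_coef; case: ifP;
    rewrite ?invr_eq0.
pose c_ (e : nat * code) := partner_coef * (x ^+ e.1 / x ^+ size X).
pose G (e : nat * code) (h : label -> I) : F := [&& h u == h v,
  h u' == h v' & consistent e.2 h]%:R -
  [&& h u == h v + kappa *+ 2, h u' == h v' + kappa *+ 2 & consistent e.2 h]%:R.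
transitivity (sum_over (undup (labels T))
    (fun h : label -> I => \sum_(e <- state_exponents T) c_ e * G e h) (fun=> 0)).
  apply: eq_sum_over => h; rewrite -mulrBl diff (code_weight_states x_neq0) big_distrr /=.
  by apply: eq_bigr => e _; rewrite /c_ /G -!mulnb !natrM; ring.
rewrite sum_over_sum /tangle_poly_coef big_distrr /= [RHS]big_mkcond big_seq [RHS]big_seq.
have size_X : size X = size T by rewrite size_map.
apply: eq_bigr => e e_T; rewrite sum_overZ /c_ size_X.
have [e_marks e_labels] := state_exponents_spec e_T.
have k2_double : kappa *+ 2 + kappa *+ 2 = 0 by rewrite -mulrnDr.
have := paired_sum e_marks uv_uniq (state_closed e e_T) F kappa2 k2_double.
rewrite (@sum_over_perm _ _ _ (undup (labels T))); last first.
  by apply: uniq_perm; rewrite ?undup_uniq // => l; rewrite !mem_undup (perm_mem e_labels).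
rewrite -/(G e) => ->; rewrite def_partner; case: ifP => _; last by rewrite mulr0.
(* Ensures that the truncated exponent [components e.2 - 2] is a true difference, so that exactly
   [#|I| ^ 2] splits off. *)
have ge2 := components_ge2 e_marks uv_uniq (state_closed e e_T).
by rewrite natrX -loop_eq -[in LHS](subnK ge2) exprD /=; ring.
Qed.

End Virtualized.

(** * The virtualized code is a planar diagram *)

Lemma fresh_lt C l : l \in labels C -> (l < fresh C)%N.
Proof. by move=> l_C; rewrite /fresh ltnS; exact: (@leq_bigmax_seq _ _ xpredT id). Qed.

Section Virtualization.
Variables (o : bool) (a b c d : label) (T : code).
Let K := Cl o a b c d :: T.
Let n := fresh K.
Let Kv := virtualize o a b c d T.
Let KvE : Kv = [:: Vi a b n.+1 n, Cl (~~ o) n n.+1 n.+2 n.+3, Vi n.+3 n.+2 c d & T].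
Proof. by []. Qed.

Lemma labels_virtualize :
  perm_eq (labels Kv) (labels K ++ [:: n; n.+1; n.+2; n.+3] ++ [:: n; n.+1; n.+2; n.+3]).
Proof. by apply/permP=> P; rewrite KvE !count_cat /=; ring. Qed.

Lemma closed_virtualize : closed_code K -> closed_code Kv.
Proof.
move=> K_closed; have new_uniq : uniq [:: n; n.+1; n.+2; n.+3] by rewrite /= !inE; lia.
apply/allP=> l; rewrite (perm_mem labels_virtualize) (permP labels_virtualize) => l_in.
rewrite count_cat [X in (_ + X)%N]count_cat (count_uniq_mem _ new_uniq).
have [l_new|l_new] := boolP (l \in [:: n; n.+1; n.+2; n.+3]).
  rewrite (_ : count_mem l (labels K) = 0%N) //; apply/count_memPn.
  by apply/negP=> /fresh_lt; move: l_new; rewrite !inE -/n; lia.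
by rewrite addn0 closed_count //; move: l_in; rewrite !mem_cat (negbTE l_new) !orbF.
Qed.

(* The half-edges of K, inside K_v. *)
Let old i j : nat * nat :=
  match i, j with
  | 0%N, 0%N => (0, 0)%N
  | 0%N, 1%N => (0, 1)%N
  | 0%N, 2%N => (2, 2)%N
  | 0%N, 3%N => (2, 3)%N
  | 0%N, _ => (0, 4)%N
  | i'.+1, _ => (i'.+3, j)
  end.

Let new_half_edges : seq (nat * nat) :=
  [:: (0, 2); (0, 3); (1, 0); (1, 1); (1, 2); (1, 3); (2, 0); (2, 1)]%N.

Lemma old_half_edge i j : half_edge K i j ->
  half_edge Kv (old i j).1 (old i j).2 /\
  half_label Kv (old i j).1 (old i j).2 = half_label K i j.
Proof.
case: i => [|i]; last by move=> ij; split; [exact: ij | by []].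
by case: j => [|[|[|[|j]]]].
Qed.

Lemma old_inj i j i' j' : half_edge K i j -> half_edge K i' j' ->
  old i j = old i' j' -> (i, j) = (i', j').
Proof.
case: i i' => [|i] [|i']; last by move=> _ _ [-> ->].
- by case: j j' => [|[|[|[|j]]]] [|[|[|[|j']]]].
- by case: j => [|[|[|[|j]]]].
by case: j' => [|[|[|[|j']]]].
Qed.

Lemma half_edge_virtualize i j : half_edge Kv i j ->
  (exists i' j', half_edge K i' j' /\ old i' j' = (i, j)) \/ (i, j) \in new_half_edges.
Proof.
case: i => [|[|[|i]]].
- case: j => [|[|[|[|j]]]] // _; [left; exists 0%N, 0%N | left;
    exists 0%N, 1%N | right | right] => //.
- by case: j => [|[|[|[|j]]]] // _; right.
- case: j => [|[|[|[|j]]]] // _; [right | right | left; exists 0%N, 2%N | left;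
    exists 0%N, 3%N] => //.
by move=> ij; left; exists i.+1, j; split; [exact: ij | by []].
Qed.

Lemma half_label_old i j : half_edge K i j -> (half_label K i j < n)%N.
Proof.
case/andP=> lt_i lt_j; apply: fresh_lt; apply/flatten_mapP.
by exists (vertex K i); [apply: mem_nth | apply: mem_nth].
Qed.

(** Two new half-edges form an edge exactly when they have the same offset, which reduces the
    matching of fresh labels to a finite check. *)
Let new_offset i j : nat :=
  match i, j with
  | 0, 2 => 1 | 0, _ => 0
  | 1, 0 => 0 | 1, 1 => 1 | 1, 2 => 2 | 1, _ => 3
  | _, 0 => 3 | _, _ => 2
  end%N.

Lemma half_label_new i j : (i, j) \in new_half_edges ->
  half_label Kv i j = (new_offset i j + n)%N.
Proof. by rewrite !inE => /or4P[|||/or4P[|||/orP[|]]] /eqP[-> ->]. Qed.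

Hypotheses (K_planar : planar K) (K_closed : closed_code K).

Let Kv_closed : closed_code Kv := closed_virtualize K_closed.

Lemma new_opposite (g : nat -> nat -> rat) : flow Kv g ->
  [/\ g 1%N 0%N = - g 0%N 3%N, g 1%N 1%N = - g 0%N 2%N,
      g 2%N 1%N = - g 1%N 2%N & g 2%N 0%N = - g 1%N 3%N].
Proof. by case=> _ g_opp; split; apply: g_opp. Qed.

(** Through the flow criterion: a flow on K_v restricts to one on K, and the face values found there
    extend over the two bigons created between consecutive crossings. *)
Lemma planar_virtualize : planar Kv.
Proof.
apply/(planar_cornerP Kv_closed) => g g_flow.
have [gx gy gz gw] := new_opposite g_flow; have [g_sum g_opp] := g_flow.
have sum0 := g_sum 0%N isT; have sum1 := g_sum 1%N isT; have sum2 := g_sum 2%N isT.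
rewrite /= !big_ord_recr big_ord0 /= in sum0; rewrite /= !big_ord_recr big_ord0 /= in sum1.
rewrite /= !big_ord_recr big_ord0 /= in sum2.
(* Adding the balance equations of the three new crossings, where the four inner edges cancel, gives
   the balance at the crossing of K. *)
pose g' i j := g (old i j).1 (old i j).2.
have g'_flow : flow K g'.
  split=> [[|i] lt_i | i j i' j' ij ij' neq_ij lab_ij].
  - by rewrite /= !big_ord_recr big_ord0 /= /g' /=; lra.
  - exact: (g_sum i.+3).
  have [old_ij lab_old] := old_half_edge ij; have [old_ij' lab_old'] := old_half_edge ij'.
  apply: g_opp => //; last by rewrite lab_old lab_old'.
  by apply: contra neq_ij => /eqP eq_old; apply/eqP/(old_inj ij ij'); move: eq_old;
    rewrite -!surjective_pairing.
have [r' [r'_pot r'_opp]] := (planar_cornerP K_closed).1 K_planar g' g'_flow.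
have pot0 : r' 0%N 0%N - r' 0%N 1%N = g 0%N 0%N := r'_pot 0%N 0%N isT.
have pot1 : r' 0%N 1%N - r' 0%N 2%N = g 0%N 1%N := r'_pot 0%N 1%N isT.
have pot2 : r' 0%N 2%N - r' 0%N 3%N = g 2%N 2%N := r'_pot 0%N 2%N isT.
have pot3 : r' 0%N 3%N - r' 0%N 0%N = g 2%N 3%N := r'_pot 0%N 3%N isT.
(* The values on the two bigons, each read off across one of its edges. *)
pose y := r' 0%N 2%N - g 0%N 2%N; pose z := r' 0%N 0%N - g 2%N 0%N.
pose r i j : rat := match i, j with
  | 0, 0 => r' 0 0 | 0, 1 => r' 0 1 | 0, 2 => r' 0 2 | 0, _ => y
  | 1, 0 => r' 0 0 | 1, 1 => y | 1, 2 => r' 0 2 | 1, _ => z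
  | 2, 0 => r' 0 0 | 2, 1 => z | 2, 2 => r' 0 2 | 2, _ => r' 0 3
  | i'.+3, _ => r' i'.+1 j
  end%N.
have r_old i j : half_edge K i j -> r (old i j).1 (old i j).2 = r' i j.
  by case: i => [|i]; [case: j => [|[|[|[|j]]]] | ].
have r_old_next i j : half_edge K i j ->
    r (old i j).1 ((old i j).2.+1 %% degree Kv (old i j).1)%N = r' i (j.+1 %% degree K i)%N.
  by case: i => [|i]; [case: j => [|[|[|[|j]]]] | ].
exists r; split=> [[|[|[|i]]] j | i j i' j' ij ij' neq_ij lab_ij].
- by case: j => [|[|[|[|j]]]] // _; rewrite /= /y /z; lra.
- by case: j => [|[|[|[|j]]]] // _; rewrite /= /y /z; lra.
- by case: j => [|[|[|[|j]]]] // _; rewrite /= /y /z; lra.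
- exact: (r'_pot i.+1 j).
(* Old and fresh labels never match, so an edge is either one of K or one of the four inner
   edges. *)
have [[i0 [j0 [ij0 old_ij]]]|new_ij] := half_edge_virtualize ij;
  have [[i0' [j0' [ij0' old_ij']]]|new_ij'] := half_edge_virtualize ij'.
- have [/= _ lab0] := old_half_edge ij0; have [/= _ lab0'] := old_half_edge ij0'.
  have := r_old _ _ ij0; have := r_old_next _ _ ij0'.
  rewrite old_ij old_ij' in lab0 lab0' *; move=> /= -> ->.
  apply: r'_opp => //; last by rewrite -lab0 -lab0'.
  by apply: contra neq_ij => /eqP[eq_i eq_j]; rewrite -old_ij -old_ij' eq_i eq_j.
- have := half_label_old ij0; have [_ /= <-] := old_half_edge ij0.
  by rewrite old_ij /= lab_ij ltnNge half_label_new // leq_addl.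
- have := half_label_old ij0'; have [_ /= <-] := old_half_edge ij0'.
  by rewrite old_ij' /= -lab_ij ltnNge half_label_new // leq_addl.
have {lab_ij} : new_offset i j = new_offset i' j'.
  by apply: (@addIn n); rewrite -!half_label_new.
move: neq_ij new_ij new_ij'; rewrite !inE => neq_ij.
move=> /or4P[|||/or4P[|||/orP[|]]] /eqP[def_i def_j];
  rewrite def_i def_j {def_i def_j} in neq_ij *;
move=> /or4P[|||/or4P[|||/orP[|]]] /eqP[def_i def_j];
  rewrite def_i def_j {def_i def_j} in neq_ij *;
by [].
Qed.

End Virtualization.

(** * The virtualized crossing as a crossing with reversed cyclic order *)

Section MirroredCrossing.
Variables (F : fieldType) (x : F) (I : finComNzRingType).

Lemma sum_pick (G : I -> F) i0 : \sum_i (i0 == i)%:R * G i = G i0.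
Proof.
rewrite (bigD1 i0) //= eqxx mul1r big1 ?addr0 // => i neq_i.
by rewrite eq_sym (negbTE neq_i) mul0r.
Qed.

(** The virtual crossings only transfer colours: they identify the four inner labels with [b], [a],
    [d] and [c], in this order. *)
Lemma mirrored_crossing_weight o a b c d p q k1 k2 k3 k4 kappa (h : label -> I) :
  uniq [:: k1; k2; k3; k4] -> all (fun l => l \notin [:: k1; k2; k3; k4]) [:: a; b; c; d] ->
  sum_over [:: k1; k2; k3; k4] (code_weight x kappa [:: (Vi a b k2 k1, (p, q));
    (Cl o k1 k2 k3 k4, (q, p)); (Vi k4 k3 c d, (p, q))]) h =
  code_weight x kappa [:: (Cl o b a d c, (q, p))] h.
Proof.
rewrite /= !inE !negb_or !andbT => /and3P[/and3P[k12 k13 k14] /andP[k23 k24] k34].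
move=> /and4P[/and4P[a1 a2 a3 a4] /and4P[b1 b2 b3 b4] /and4P[c1 c2 c3 c4] /and4P[d1 d2 d3
  d4]].
transitivity (\sum_i (h b == i)%:R * \sum_j (h a == j)%:R * \sum_k (h d == k)%:R *
    \sum_l (h c == l)%:R * weight x kappa (Cl o k1 k2 k3 k4, (q, p))
       (recolor (recolor (recolor (recolor h k1 i) k2 j) k3 k) k4 l)).
  rewrite sum_over_cons; apply: eq_bigr => i _; rewrite big_distrr /=.
  rewrite sum_over_cons; apply: eq_bigr => j _; rewrite !big_distrr /=.
  rewrite sum_over_cons; apply: eq_bigr => k _; rewrite !big_distrr /=.
  rewrite sum_over_cons; apply: eq_bigr => l _; rewrite sum_over_nil code_weight3.
  rewrite {1 3}/weight /= !(recolor_same, recolor_neq _ _ k12, recolor_neq _ _ k13,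
    recolor_neq _ _ k14, recolor_neq _ _ k23, recolor_neq _ _ k24, recolor_neq _ _ k34) //.
  rewrite !recolor_neq // -!mulnb !natrM (eq_sym l) (eq_sym k); ring.
rewrite sum_pick sum_pick sum_pick sum_pick code_weight1 /weight /=.
by rewrite !(recolor_same, recolor_neq _ _ k12, recolor_neq _ _ k13,
    recolor_neq _ _ k14, recolor_neq _ _ k23, recolor_neq _ _ k24, recolor_neq _ _ k34).
Qed.

End MirroredCrossing.

Section OrientedVirtualization.
Variables (o : bool) (a b c d : label) (p q : bool) (X : seq oriented_node).
Let T := unzip1 X.
Let n := fresh (Cl o a b c d :: T).

Definition virtualized_crossing : seq oriented_node :=
  [:: (Vi a b n.+1 n, (p, q)); (Cl (~~ o) n n.+1 n.+2 n.+3, (q, p));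
    (Vi n.+3 n.+2 c d, (p, q))].

Lemma virtualize_oriented : is_oriented ((Cl o a b c d, (p, q)) :: X) ->
  is_oriented (virtualized_crossing ++ X).
Proof.
move=> K_or l; rewrite -(K_or l) /virtualized_crossing !fluxE !direction_opp; ring.
Qed.

Variables (F : fieldType) (x : F) (I : finComNzRingType).

Lemma state_sum_virtualized (kappa : I) :
  state_sum x kappa (virtualized_crossing ++ X) =
  state_sum x kappa ((Cl (~~ o) b a d c, (q, p)) :: X).
Proof.
have new_lt l : l \in [:: n; n.+1; n.+2; n.+3] -> (n <= l)%N.
  rewrite !inE => /or4P[]/eqP->.
  - exact: leqnn.
  - exact: (leq_addl 1 n).
  - exact: (leq_addl 2 n).
  exact: (leq_addl 3 n).
have new_notin l : l \in [:: n; n.+1; n.+2; n.+3] -> l \notin labels (Cl o a b c d :: T).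
  by move/new_lt=> le_nl; apply/negP=> /fresh_lt; rewrite ltnNge le_nl.
have new_T l : l \in [:: n; n.+1; n.+2; n.+3] -> l \notin labels T.
  by move/new_notin; rewrite labels_cons mem_cat negb_or => /andP[].
have new_end l e : e \in [:: a; b; c; d] -> l \in [:: n; n.+1; n.+2; n.+3] -> e != l.
  move=> e_end /new_notin; rewrite labels_cons mem_cat negb_or => /andP[l_end _].
  by apply: contraNneq l_end => <-.
have new_uniq : uniq [:: n; n.+1; n.+2; n.+3] by rewrite /= !inE; lia.
rewrite -[RHS]mul1r.
apply: (@state_sum_local _ _ _ _ virtualized_crossing [:: (Cl (~~ o) b a d c, (q, p))] X
  [:: n; n.+1; n.+2; n.+3] [::]) => //.
- move=> l l_new; rewrite new_T // andbT.
  by move: l_new; rewrite /= !inE => /or4P[]/eqP->; rewrite eqxx ?orbT.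
- have labelsL : perm_eq (labels (unzip1 virtualized_crossing)) ([:: a; b; c; d] ++
      [:: n; n.+1; n.+2; n.+3] ++ [:: n; n.+1; n.+2; n.+3]).
    by apply/permP=> P; rewrite !count_cat /=; ring.
  move=> l; rewrite (perm_mem labelsL) !mem_cat orbb.
  have [l_new|_] := boolP (l \in [:: n; n.+1; n.+2; n.+3]).
    have := new_notin l l_new; rewrite labels_cons mem_cat negb_or =>
      /andP[l_end /negbTE->].
    by apply/esym/negbTE; rewrite orbF; apply: contra l_end;
      rewrite /= !inE ?in_nil ?orbF => /or4P[]/eqP->; rewrite eqxx ?orbT.
  rewrite orbF; congr (_ || _); rewrite /= !inE ?in_nil ?orbF.
  by case: (l == a); case: (l == b); case: (l == c); case: (l == d).
move=> h; rewrite mul1r sum_over_nil; apply: mirrored_crossing_weight => //.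
by apply/allP=> e e_end; apply/negP=> e_new; have := new_end _ _ e_end e_new; rewrite eqxx.
Qed.

End OrientedVirtualization.

(** The element [n] of the integers modulo [4 n]. *)
Lemma order_four_element n : (0 < n)%N -> exists (I : finComNzRingType) (kappa : I),
  [/\ #|I| = (4 * n)%N, kappa *+ 2 != 0 & kappa *+ 4 = 0].
Proof.
move=> n_gt0; have [m def_m] : exists m, (4 * n = m)%N by exists (4 * n)%N.
have m_gt1 : (1 < m)%N by lia.
have natr_eq0 k : (k%:R == 0 :> 'Z_m) = (m %| k)%N.
  by rewrite -(inj_eq val_inj) /= val_Zp_nat.
exists 'Z_m, n%:R; split; first by rewrite def_m card_ord Zp_cast.
  by rewrite -mulrnA natr_eq0 gtnNdvd; lia.
by apply/eqP; rewrite -mulrnA natr_eq0 mulnC def_m.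
Qed.

Theorem theorem3p3 (o : bool) (a b c d : label) (T : code)
    (Ealpha Ebeta : code) (alpha beta : laurent)
    (K_diagram : is_diagram (Cl o a b c d :: T))
    (K_classical : classical (Cl o a b c d :: T))
    (four_ends : uniq [:: a; b; c; d])
    (E_crossingless :
      perm_eq [:: Ealpha; Ebeta] [:: smoothing_ab a b c d; smoothing_ad a b c d])
    (E_alpha : bracket (Cl o a b c d :: Ealpha) = - A ^- 3)
    (E_beta : bracket (Cl o a b c d :: Ebeta) = - A ^+ 3)
    (alpha_def : alpha = tangle_coef T Ealpha)
    (beta_def : beta = tangle_coef T Ebeta)
    (alpha_neq0 : alpha != 0) (beta_neq0 : beta != 0) :
  let Kv := virtualize o a b c d T in
  [/\ is_diagram Kv, ~ classical_link Kv & ~ trivial_link Kv].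
Proof.
move=> Kv; have [K_closed K_planar] := andP K_diagram.
(* The orientation, still to be chosen, decides between the two smoothings, so nonvanishing is
   recorded for both. *)
have coef_neq0 E : E \in [:: smoothing_ab a b c d;
  smoothing_ad a b c d] -> tangle_coef T E != 0.
  rewrite -(perm_mem E_crossingless) !inE => /orP[]/eqP->; first by rewrite -alpha_def.
  by rewrite -beta_def.
have Kv_nonclassical : ~ classical_link Kv.
  case=> D [D_diagram D_classical KvD].
  have [[|[_ [p q]] X] //= [-> defT] K_or] := orientation_exists K_closed.
  pose partner := if p == q then smoothing_ab a b c d else smoothing_ad a b c d.
  have [|n [x [n_gt0 x0 loop_eq coef_x]]] := @tangle_coef_specialize T partner.
    by apply: coef_neq0; rewrite /partner !inE; case: ifP; rewrite eqxx ?orbT.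
  have [I [kappa [card_I kappa2 kappa4]]] := order_four_element n_gt0.
  have loop_I : #|I|%:R = - x ^+ 2 - x ^- 2 :> algC by rewrite card_I.
  have loop_I0 : #|I|%:R != 0 :> algC by rewrite card_I pnatr_eq0 muln_eq0 -lt0n.
  have coef_partner : tangle_poly_coef x (unzip1 X) partner != 0 by rewrite defT.
  rewrite -defT in K_diagram K_classical.
  have Kv_detected := virtualized_detects x0 loop_I loop_I0 kappa2 kappa4 K_diagram
    K_classical four_ends K_or coef_partner.
  have [KvD_transports _] := virtual_equiv_interchangeable x0 loop_I KvD.
  have [|Y [defD Y_or [u u0 ZY]]] := KvD_transports _ _ (virtualize_oriented K_or).
    (* The detecting orientation of K_v is the one inherited from K; it is carried to an orientation
       [Y] of the supposed classical diagram, where the twist has no effect. *)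
    by rewrite /Kv -defT.
  rewrite -defD in D_diagram D_classical; case/negP: Kv_detected; apply/eqP/(mulfI u0).
  rewrite -!state_sum_virtualized -!ZY.
  exact: state_sum_planar.
split=> //; first by apply/andP; split;
  [apply: closed_virtualize | apply: planar_virtualize].
(* A crossingless diagram has no virtual crossing, so triviality would imply classicality. *)
case=> D [D_diagram D_crossingless KvD]; apply: Kv_nonclassical; exists D; split=> //.
by apply/hasPn=> v /(allP D_crossingless); case: v.
Qed.
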